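(* Let $M$ be a simply connected complex $n$-manifold endowed with a gradient Kähler Ricci soliton $g$ with associated Kähler form $\Omega$ and a choice of Ricci potential $f$. Then there exists a holomorphic volume form $\Upsilon$ on $M$, unique up to multiplication by a complex number of modulus $1$, with the property that $$d\mathrm{vol}_g=\frac{1}{n!}\,\Omega^n=\left(\frac{i^n}{2}\right)^n e^{-f}\,\Upsilon\wedge\overline{\Upsilon}.$$
   Context: A gradient Kähler Ricci soliton on a complex $n$-manifold $M$ is a Kähler metric $g$ for which there exists a real-valued function $f$ on $M$ (a Ricci potential) with $\mathrm{Ric}(g)=\nabla^2 f$, where $\nabla$ is the Levi-Civita connection of $g$ and $\nabla^2 f$ is the Hessian. In local holomorphic coordinates, $g=g_{i\bar j}\,dz^i\circ d\bar z^j$ (with $a\circ b=\frac12(a\otimes b+b\otimes a)$) and the associated Kähler form is $\Omega=\frac{i}{2}\,g_{i\bar j}\,dz^i\wedge d\bar z^j$; $d\mathrm{vol}_g$ is the Riemannian volume form for the orientation of the complex structure. A holomorphic volume form is a nowhere-vanishing holomorphic $n$-form. Simply connected manifolds are understood to be connected. *)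

(* Defs.v *)
From HB Require Import structures.
From mathcomp Require Import all_boot all_order all_algebra all_fingroup.
From mathcomp Require Import all_classical all_reals all_analysis.
From mathcomp Require Import complex.
Set Implicit Arguments.
Unset Strict Implicit.
Unset Printing Implicit Defensive.
Import Order.TTheory GRing.Theory Num.Theory numFieldNormedType.Exports.
Local Open Scope classical_set_scope.
Local Open Scope ring_scope.

(* C^n is identified with R^(2n) through z_j = x_j + i y_j, the real
   coordinates being ordered as (x_1, y_1, ..., x_n, y_n), so that the
   standard orientation of R^(2n) is the one of the complex structure. *)

Section Local.
Variables (R : realType) (n : nat).
Local Notation C := R[i].
Local Notation E := 'rV[R]_(n * 2).

Lemma xidx_lt (j : 'I_n) : (j * 2 < n * 2)%N.
Proof. by rewrite ltn_mul2r ltn_ord. Qed.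

Lemma yidx_lt (j : 'I_n) : ((j * 2).+1 < n * 2)%N.
Proof. by have := leq_mul (ltn_ord j) (leqnn 2); rewrite mulSn. Qed.

Definition xidx (j : 'I_n) : 'I_(n * 2) := Ordinal (xidx_lt j).
Definition yidx (j : 'I_n) : 'I_(n * 2) := Ordinal (yidx_lt j).

Definition evec (k : 'I_(n * 2)) : E := delta_mx 0 k.

(* The j-th complex coordinate on E; being linear, it is also the covector
   dz^j on each tangent space. *)
Definition zc (j : 'I_n) (v : E) : C := Complex (v 0 (xidx j)) (v 0 (yidx j)).

Definition cderive (v : E) (F : E -> C) (x : E) : C :=
  Complex ('D_v (fun y => complex.Re (F y)) x)
          ('D_v (fun y => complex.Im (F y)) x).

(* d/dz^j = (d/dx_j - i d/dy_j)/2 and d/dzbar^j = (d/dx_j + i d/dy_j)/2 *)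
Definition dz (j : 'I_n) (F : E -> C) (x : E) : C :=
  2^-1 * (cderive (evec (xidx j)) F x - 'i%C * cderive (evec (yidx j)) F x).
Definition dzbar (j : 'I_n) (F : E -> C) (x : E) : C :=
  2^-1 * (cderive (evec (xidx j)) F x + 'i%C * cderive (evec (yidx j)) F x).

Fixpoint partials (s : seq 'I_(n * 2)) (f : E -> R) : E -> R :=
  if s is k :: s' then fun x => 'D_(evec k) (partials s' f) x else f.

(* C^oo; meant for open sets U. *)
Definition smooth_on (U : set E) (f : E -> R) : Prop :=
  forall (s : seq 'I_(n * 2)) (x : E), U x ->
    {for x, continuous (partials s f)} /\
    forall k, derivable (partials s f) x (evec k).

Definition csmooth_on (U : set E) (F : E -> C) : Prop :=
  smooth_on U (fun x => complex.Re (F x)) /\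
  smooth_on U (fun x => complex.Im (F x)).

(* C^oo and dbar F = 0: by Goursat and Hartogs-Osgood this is the same as
   complex differentiability at each point of the open set U. *)
Definition holomorphic_on (U : set E) (F : E -> C) : Prop :=
  csmooth_on U F /\ forall x, U x -> forall j, dzbar j F x = 0.

(* Complex-valued alternating k-forms on E, as functions of k vectors. *)
Definition cform (k : nat) : Type := ('I_k -> E) -> C.

(* Normalized so that dz /\ dzbar = dz (x) dzbar - dzbar (x) dz; thus
   (i/2) dz /\ dzbar = dx /\ dy takes the value 1 on (d/dx, d/dy). *)
Definition form_wedge (k l : nat) (a : cform k) (b : cform l) : cform (k + l) :=
  fun v => (k`! * l`!)%:R^-1 *
    \sum_(s : 'S_(k + l)) (-1) ^+ odd_perm s *
      (a (fun i => v (s (lshift l i))) * b (fun j => v (s (rshift k j)))).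

Definition form_conj (k : nat) (a : cform k) : cform k := fun v => conjc (a v).

Definition form_cast (k l : nat) (e : k = l) (a : cform k) : cform l :=
  fun v => a (fun i => v (cast_ord e i)).

Fixpoint form_pow (w : cform 2) (m : nat) : cform (m * 2) :=
  if m is m'.+1 then (form_wedge w (@form_pow w m') : cform (2 + m' * 2))
  else fun _ => 1.

(* Exterior derivative, evaluated on constant vector fields. *)
Definition ext_deriv (k : nat) (w : E -> cform k) (x : E) : cform k.+1 :=
  fun v => \sum_(i < k.+1)
    (-1) ^+ i * cderive (v i) (fun y => w y (fun j => v (lift i j))) x.

Definition dz_form (j : 'I_n) : cform 1 := fun v => zc j (v ord0).

(* dz^1 /\ ... /\ dz^n, evaluated on n vectors *)
Definition dz_top : cform n := fun v => \det (\matrix_(i, j) zc i (v j)).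

(* For H = (g_{i jbar}): the metric g_{i jbar} dz^i o dzbar^j, where
   a o b = (a (x) b + b (x) a)/2, its matrix in the real coordinates, and the
   form (i/2) g_{i jbar} dz^i /\ dzbar^j. *)
Definition herm_metric (H : 'M[C]_n) (u v : E) : C :=
  \sum_i \sum_j H i j *
    (2^-1 * (zc i u * conjc (zc j v) + conjc (zc j u) * zc i v)).

Definition real_metric (H : 'M[C]_n) : 'M[R]_(n * 2) :=
  \matrix_(k, l) complex.Re (herm_metric H (evec k) (evec l)).

Definition kahler_form (H : 'M[C]_n) : cform 2 :=
  fun v => 'i%C / 2 *
    \sum_i \sum_j H i j * form_wedge (dz_form i) (form_conj (dz_form j)) v.

Definition riem_volume (G : 'M[R]_(n * 2)) : cform (n * 2) :=
  fun v => real_complex R (Num.sqrt (\det G) * \det (\matrix_(i, k) v i 0 k)).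

Section LeviCivita.
Variable G : E -> 'M[R]_(n * 2).
Local Notation "'d_ k f" := (fun x => 'D_(evec k) f x)
  (at level 10, k at level 8, f at level 8, only parsing).

(* Gamma^k_{ij} *)
Definition christoffel (k i j : 'I_(n * 2)) (x : E) : R :=
  2^-1 * \sum_l invmx (G x) k l *
    ('D_(evec i) (fun y => G y j l) x + 'D_(evec j) (fun y => G y i l) x
     - 'D_(evec l) (fun y => G y i j) x).

(* The d_l component of R(d_i, d_j) d_k, where
   R(X, Y) = [nabla_X, nabla_Y] - nabla_[X, Y]. *)
Definition curvature (i j k l : 'I_(n * 2)) (x : E) : R :=
  'D_(evec i) (christoffel l j k) x - 'D_(evec j) (christoffel l i k) x
  + \sum_m (christoffel m j k x * christoffel l i m x
            - christoffel m i k x * christoffel l j m x).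

(* Ric(Y, Z) = tr (X |-> R(X, Y) Z) *)
Definition ricci (j k : 'I_(n * 2)) (x : E) : R :=
  \sum_i curvature i j k i x.

Definition hessian (f : E -> R) (i j : 'I_(n * 2)) (x : E) : R :=
  'D_(evec i) (fun y => 'D_(evec j) f y) x
  - \sum_k christoffel k i j x * 'D_(evec k) f x.
End LeviCivita.

End Local.

Arguments form_pow {R n} w m v.

(* A complex n-manifold, presented by a holomorphic atlas: [coord a] is a
   homeomorphism from the open set [dom a] onto an open subset of C^n, with
   inverse [point a]; the values of [coord a] off [dom a] and of [point a] off
   its image are irrelevant. *)
Record cxManifold (R : realType) (n : nat) := CxManifold {
  carrier :> topologicalType;
  cm_hausdorff : hausdorff_space carrier;
  cm_second_countable : @second_countable carrier;
  chart : Type;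
  dom : chart -> set carrier;
  coord : chart -> carrier -> 'rV[R]_(n * 2);
  point : chart -> 'rV[R]_(n * 2) -> carrier;
  dom_cover : forall p, exists a, dom a p;
  dom_open : forall a, open (dom a);
  im_open : forall a, open (coord a @` dom a);
  coordK : forall a p, dom a p -> point a (coord a p) = p;
  coord_continuous : forall a, {within dom a, continuous (coord a)};
  point_continuous : forall a,
    {within coord a @` dom a, continuous (point a)};
  transition_holomorphic : forall a b (j : 'I_n),
    holomorphic_on (coord a @` (dom a `&` dom b))
      (fun x => zc j (coord b (point a x)))
}.

Arguments dom {R n} M a : rename.
Arguments coord {R n} M a p : rename.
Arguments point {R n} M a x : rename.

Section Manifold.
Variables (R : realType) (n : nat) (M : cxManifold R n).
Local Notation C := R[i].
Local Notation E := 'rV[R]_(n * 2).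

Definition chart_im (a : chart M) : set E := coord M a @` dom M a.

Definition overlap (a b : chart M) : set E :=
  coord M a @` (dom M a `&` dom M b).

Definition transition (a b : chart M) (x : E) : E := coord M b (point M a x).

(* entry (i, k) is d(w^k)/d(z^i), for coordinates z in a and w in b *)
Definition transition_jac (a b : chart M) (x : E) : 'M[C]_n :=
  \matrix_(i, k) dz i (fun y => zc k (transition a b y)) x.

(* [gcoef a x i j] is g_{i jbar} in the chart a. *)
Record kahlerMetric := KahlerMetric {
  gcoef : chart M -> E -> 'M[C]_n;
  gcoef_smooth : forall a i j,
    csmooth_on (chart_im a) (fun x => gcoef a x i j);
  gcoef_herm : forall a x, chart_im a x ->
    forall i j, gcoef a x j i = conjc (gcoef a x i j);
  gcoef_pos : forall a x, chart_im a x ->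
    forall u : E, u != 0 -> 0 < herm_metric (gcoef a x) u u;
  gcoef_change : forall a b x, overlap a b x -> forall i j,
    gcoef a x i j = \sum_k \sum_l gcoef b (transition a b x) k l *
      (transition_jac a b x i k * conjc (transition_jac a b x j l));
  gcoef_closed : forall a x, chart_im a x ->
    forall v, ext_deriv (fun y => kahler_form (gcoef a y)) x v = 0
}.

Definition smooth_function (f : M -> R) : Prop :=
  forall a, smooth_on (chart_im a) (fun x => f (point M a x)).

Definition ricci_potential (g : kahlerMetric) (f : M -> R) : Prop :=
  smooth_function f /\
  forall a x, chart_im a x -> forall i j,
    ricci (fun y => real_metric (gcoef g a y)) i j x =
    hessian (fun y => real_metric (gcoef g a y))
            (fun y => f (point M a y)) i j x.

(* A nowhere-vanishing holomorphic n-form; it is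
   [vcoef a] dz^1 /\ ... /\ dz^n in the chart a. *)
Record holVolumeForm := HolVolumeForm {
  vcoef : chart M -> E -> C;
  vcoef_holomorphic : forall a, holomorphic_on (chart_im a) (vcoef a);
  vcoef_neq0 : forall a x, chart_im a x -> vcoef a x != 0;
  vcoef_change : forall a b x, overlap a b x ->
    vcoef a x = vcoef b (transition a b x) * \det (transition_jac a b x)
}.

Definition hol_form (U : holVolumeForm) (a : chart M) (x : E) : cform R n n :=
  fun v => vcoef U a x * @dz_top R n v.

Lemma addn_mul2 : (n + n = n * 2)%N.
Proof. by rewrite muln2 addnn. Qed.

Definition volume_normalized (g : kahlerMetric) (f : M -> R)
    (U : holVolumeForm) : Prop :=
  forall a x, chart_im a x -> forall v : 'I_(n * 2) -> E,
    let Omega := kahler_form (gcoef g a x) in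
    riem_volume (real_metric (gcoef g a x)) v
      = (n`!)%:R^-1 * form_pow Omega n v /\
    (n`!)%:R^-1 * form_pow Omega n v
      = ('i%C ^+ n / 2) ^+ n * real_complex R (expR (- f (point M a x))) *
        form_cast addn_mul2
          (form_wedge (hol_form U a x) (form_conj (hol_form U a x))) v.

Definition is_multiple (c : C) (U V : holVolumeForm) : Prop :=
  forall a x, chart_im a x -> vcoef V a x = c * vcoef U a x.

Definition simply_connected : Prop :=
  connected [set: M] /\
  forall gamma : R -> M,
    {within `[0, 1], continuous gamma} -> gamma 0 = gamma 1 ->
    exists H : R * R -> M,
      [/\ {within `[0, 1]%classic `*` `[0, 1]%classic, continuous H},
          forall t : R, 0 <= t <= 1 -> H (0, t) = gamma t /\ H (1, t) = gamma 0 &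
          forall s : R, 0 <= s <= 1 -> H (s, 0) = gamma 0 /\ H (s, 1) = gamma 0].

End Manifold.

(* Main.v *)
Require Import Defs.
From mathcomp Require Import all_boot all_order all_algebra all_fingroup.
From mathcomp Require Import all_classical all_reals all_analysis.
From mathcomp Require Import complex ring lra zify.
Set Implicit Arguments.
Unset Strict Implicit.
Unset Printing Implicit Defensive.
Import Order.TTheory GRing.Theory Num.Theory numFieldNormedType.Exports.
Local Open Scope classical_set_scope.
Local Open Scope ring_scope.

(** Write H for the matrix (g_{i jbar}) in a chart and J for the complex
    structure. A form F dz^1 /\ ... /\ dz^n satisfies the volume condition at a
    point if and only if |F|^2 = e^f det H there ([volume_normalizedP]): Omega^n
    and Upsilon /\ conj Upsilon are expanded into determinants
    ([form_pow_top], [dz_top_wedge]), and the matrix of the Riemannian metric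
    has determinant (det H)^2 ([det_real_metric]).

    The equation |F|^2 = e^f det H has local solutions because its right-hand
    side is the exponential of a pluriharmonic function u. Indeed, for a closed
    Omega the Christoffel symbols are complex bilinear ([christoffel_J]), so that
    Ric(X, Y) + Ric(JX, JY) and Hess f(X, Y) + Hess f(JX, JY) contain no
    Christoffel symbols: the first is minus the J-average of the second
    derivatives of log det H, the second is the one of f
    ([ricci_J_average], [hessian_J_average]), and the soliton equation says that
    the average of the second derivatives of u = log det H + f vanishes
    ([soliton_pluriharmonic]). Then the one-form - du(J .) is closed. On a cube
    it has a primitive v by the Poincare lemma ([closed_has_potential]), and
    F = exp ((u + i v) / 2) is holomorphic ([exp_pluriharmonic],
    [local_solution]).

    Two local solutions, in the same chart or in two different charts, have a
    holomorphic quotient of modulus 1, which is locally constant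
    ([hol_norm1_cst], [same_norm_ratio]). This gives uniqueness on a connected
    manifold ([volume_form_unique]). It also says that the local solutions are
    the flat sections of a flat line bundle; on a simply connected manifold this
    bundle has a global flat section ([monodromy]), obtained by continuation
    along paths, and a suitable multiple of it is the required form
    ([volume_form_exists]). *)

(** * Partial derivatives on cubes *)

Section AxisCalculus.
Variables (R : realType) (N : nat).
Local Notation E := 'rV[R]_N.
Implicit Types (f g : E -> R) (x y v : E) (k : 'I_N).

Definition axis k : E := delta_mx 0 k.

Lemma is_derive_line f x v (t : R) : derivable f (x + t *: v) v ->
  is_derive t (1 : R) (fun s : R => f (x + s *: v)) ('D_v f (x + t *: v)).
Proof.
move=> fd.
have E1 : (fun h : R => h^-1 *: (((fun s : R => f (x + s *: v)) \o shift t) (h *: (1:R)) -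
     f (x + t *: v))) = (fun h : R => h^-1 *: ((f \o shift (x + t *: v)) (h *: v) - f (x + t *: v))).
  apply/funext => h /=; congr (_ *: (f _ - _)).
  by rewrite scalerDl [h *: 1]mulr1 addrCA.
by apply: DeriveDef; rewrite /derivable /derive /= E1.
Qed.

Lemma axis_MVT f x k (h : R) :
  (forall t : R, 0 <= t <= 1 -> derivable f (x + (t * h) *: axis k) (axis k)) ->
  exists2 t : R, 0 <= t <= 1 &
    f (x + h *: axis k) - f x = h * 'D_(axis k) f (x + (t * h) *: axis k).
Proof.
move=> fd; pose g (t : R) := f (x + (t * h) *: axis k).
have gd (t : R) : 0 <= t <= 1 ->
    is_derive t (1 : R) g ('D_(axis k) f (x + (t * h) *: axis k) * h).
  move=> /fd /is_derive_line fl.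
  have idh : is_derive t (1 : R) (fun t : R => t * h) h.
    have := @is_deriveM _ _ (id : R -> R) (cst h) t 1 1 0 (is_derive_id _ _) (is_derive_cst _ _ _).
    by rewrite scaler0 add0r [_ *: 1]mulr1.
  exact: (@is_derive1_comp _ (fun s : R => f (x + s *: axis k)) ( *%R^~ h) t _ _ fl idh).
have [||c] := @MVT_segment R g (fun t => 'D_(axis k) f (x + (t * h) *: axis k) * h) 0 1 ler01.
- by move=> t; rewrite in_itv/= => /andP[t0 t1]; apply: gd; rewrite !ltW.
- apply: derivable_within_continuous => t; rewrite in_itv /= => /gd [] //.
rewrite in_itv/= => c01; rewrite subr0 mulr1 /g mul1r mul0r scale0r addr0 => ->.
by exists c => //; rewrite mulrC.
Qed.

(** A staircase from x to y, which moves one coordinate at a time. *)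
Definition hybrid x y (m : nat) : E :=
  \row_i (if (i < m)%N then y 0 i else x 0 i).

Lemma hybrid0 x y : hybrid x y 0 = x.
Proof. by apply/rowP => i; rewrite mxE. Qed.

Lemma hybridN x y : hybrid x y N = y.
Proof. by apply/rowP => i; rewrite mxE ltn_ord. Qed.

Lemma hybridS x y k :
  hybrid x y k.+1 = hybrid x y k + (y 0 k - x 0 k) *: axis k.
Proof.
apply/rowP => i; rewrite !mxE/= ltnS leq_eqVlt (inj_eq val_inj).
by case: eqP => [->|_]; rewrite ?ltnn ?mulr1 ?mulr0 ?addr0// addrCA subrr addr0.
Qed.

Lemma telescope_hybrid f x y :
  f y - f x = \sum_(k < N) (f (hybrid x y k.+1) - f (hybrid x y k)).
Proof.
rewrite -(big_mkord xpredT (fun k : nat => f (hybrid x y k.+1) - f (hybrid x y k))).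
by rewrite telescope_sumr// hybridN hybrid0.
Qed.

Lemma ballE x (r : R) y :
  ball x r y <-> 0 < r /\ forall i, `|x 0 i - y 0 i| < r.
Proof.
split=> [[r0 xy]|[r0 xy]]; split=> //.
  by move=> i; exact: (xy 0 i).
by move=> i j; rewrite (ord1 i); exact: xy.
Qed.

(** Balls are cubes, and each coordinate of a point of the staircase lies
    between those of x and y. *)
Lemma hybrid_ball x y (r : R) k (t : R) : 0 <= t <= 1 -> ball x r y ->
  ball x r (hybrid x y k + (t * (y 0 k - x 0 k)) *: axis k).
Proof.
move=> t01 /ballE[r0 xy]; apply/ballE; split=> // i; rewrite !mxE/=.
have [->|ik] := eqVneq i k.
  rewrite ltnn mulr1 opprD addrA subrr add0r normrN normrM distrC.
  rewrite (le_lt_trans _ (xy k))// ler_piMl// ger0_norm; by case/andP: t01.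
by rewrite mulr0 addr0; case: ifP => _; [exact: xy|rewrite subrr normr0].
Qed.

(** One mean value theorem for each step of the staircase. The points xi tend to
    x together with y, which is what replaces differentiability of f. *)
Lemma hybrid_MVT f x y (r : R) :
  (forall z, ball x r z -> forall k, derivable f z (axis k)) ->
  ball x r y ->
  exists2 xi : 'I_N -> E, (forall k, forall s, ball x s y -> ball x s (xi k)) &
    f y - f x = \sum_k (y 0 k - x 0 k) * 'D_(axis k) f (xi k).
Proof.
move=> fd xy.
have /choice[t Ht] (k : 'I_N) : exists t : R, 0 <= t <= 1 /\
    f (hybrid x y k.+1) - f (hybrid x y k) =
    (y 0 k - x 0 k) * 'D_(axis k) f (hybrid x y k + (t * (y 0 k - x 0 k)) *: axis k).
  rewrite hybridS.
  have [|t t01 ->] := @axis_MVT f (hybrid x y k) k (y 0 k - x 0 k).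
    by move=> t t01; apply: fd; exact: hybrid_ball.
  by exists t.
exists (fun k => hybrid x y k + (t k * (y 0 k - x 0 k)) *: axis k).
  by move=> k s xsy; apply: hybrid_ball => //; case: (Ht k).
by rewrite telescope_hybrid; apply: eq_bigr => k _; case: (Ht k).
Qed.

Lemma partials0_cst f x (r : R) :
  (forall z, ball x r z -> forall k, is_derive z (axis k) f 0) ->
  forall y, ball x r y -> f y = f x.
Proof.
move=> fd y xy.
have [z /fd H k|xi xib] := hybrid_MVT (r := r) (f := f) _ xy; first by case: (H k).
move/eqP; rewrite big1 ?subr_eq0; first by move/eqP.
move=> k _; have /fd/(_ k)[_ ->] : ball x r (xi k) by exact: xib.
by rewrite mulr0.
Qed.

Lemma cvg_is_derive (V W : normedModType R) (F : V -> W) (x v : V) (l : W) :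
  h^-1 *: (F (h *: v + x) - F x) @[h --> (0 : R)^'] --> l -> is_derive x v F l.
Proof.
move=> Fl; apply: DeriveDef; first by apply/cvg_ex; exists l.
by apply/cvg_lim.
Qed.

(** The increment of f along c is a combination of partial derivatives at points
    tending to c t0 ([hybrid_MVT]), so that continuous partial derivatives
    suffice. *)
Lemma is_derive_curve f (c : R -> E) (c' : E) (t0 : R) :
  (\forall z \near c t0, forall k, derivable f z (axis k)) ->
  (forall k, {for c t0, continuous ('D_(axis k) f)}) ->
  (forall k, is_derive t0 (1 : R) (fun t => c t 0 k) (c' 0 k)) ->
  is_derive t0 (1 : R) (f \o c) (\sum_k c' 0 k * 'D_(axis k) f (c t0)).
Proof.
move=> /nbhs_ballP[r /= r0 fd] fc cd.
have ch : c (h + t0) @[h --> (0 : R)^'] --> c t0.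
  apply/cvg_ballP => e e0.
  suff : \forall h \near (0 : R)^', forall k, `|c t0 0 k - c (h + t0) 0 k| < e.
    by apply: filterS => h H; apply/ballE.
  apply: filter_forall => k.
  have /derivable1_diffP/differentiable_continuous : derivable (fun t => c t 0 k) t0 1.
    by case: (cd k).
  move=> /cvgrPdist_lt/(_ e e0) H.
  have /nbhs_ballP[d /= d0 Hd] := H.
  exists d => //= h; rewrite /= sub0r normrN => hd _; apply: Hd.
  by rewrite /ball/= opprD addrC subrK normrN.
have /choice[xi Hxi] (h : R) : exists xi : 'I_N -> E, ball (c t0) r (c (h + t0)) ->
   (forall k s, ball (c t0) s (c (h + t0)) -> ball (c t0) s (xi k)) /\
    f (c (h + t0)) - f (c t0) =
      \sum_k (c (h + t0) 0 k - c t0 0 k) * 'D_(axis k) f (xi k).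
  have [cr|cr] := pselect (ball (c t0) r (c (h + t0))); last by exists (fun=> 0).
  by have [|xi] := @hybrid_MVT f (c t0) (c (h + t0)) r _ cr; [exact: fd|exists xi].
have chr : \forall h \near (0 : R)^', ball (c t0) r (c (h + t0)).
  by move/cvg_ballP : ch; apply.
have xic k : xi h k @[h --> (0 : R)^'] --> c t0.
  apply/cvg_ballP => e e0; move/cvg_ballP : ch => /(_ e e0).
  apply: filterS2 chr => h chr che.
  by case: (Hxi h chr) => + _; apply.
apply: cvg_is_derive.
have : \sum_k (h^-1 * (c (h + t0) 0 k - c t0 0 k)) * 'D_(axis k) f (xi h k)
    @[h --> (0 : R)^'] --> \sum_k c' 0 k * 'D_(axis k) f (c t0).
  apply: cvg_big => [|k _]; first exact: add_continuous.
  apply: cvgM; last first.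
    exact: (@cvg_comp _ _ _ (xi ^~ k) ('D_(axis k) f) _ _ _ (xic k) (fc k)).
  case: (cd k) => [/cvg_ex[l Hl]] dl.
  have El : c' 0 k = l by rewrite -dl; exact/cvg_lim.
  rewrite El; apply: cvg_trans Hl; apply: near_eq_cvg; near=> h.
  by rewrite /= [h *: 1]mulr1.
apply: cvg_trans; apply: near_eq_cvg; apply: filterS chr => h /Hxi[_ Eh] /=.
rewrite [h *: 1]mulr1 Eh [_ *: _]mulr_sumr.
by apply: eq_bigr => k _; rewrite mulrA.
Unshelve. all: by end_near. Qed.

Lemma continuous_of_partials f x :
  (\forall z \near x, forall k, derivable f z (axis k)) ->
  (forall k, {for x, continuous ('D_(axis k) f)}) -> {for x, continuous f}.
Proof.
move=> /nbhs_ballP[r /= r0 fd] fc.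
have /choice[xi Hxi] (y : E) : exists xi : 'I_N -> E, ball x r y ->
   (forall k s, ball x s y -> ball x s (xi k)) /\
    f y - f x = \sum_k (y 0 k - x 0 k) * 'D_(axis k) f (xi k).
  have [xy|xy] := pselect (ball x r y); last by exists (fun=> 0).
  by have [|xi] := @hybrid_MVT f x y r _ xy; [exact: fd|exists xi].
have xr : nbhs x (ball x r) by exact: nbhsx_ballx.
have xic k : xi y k @[y --> x] --> x.
  move=> A /nbhs_ballP[e /= e0 HA]; have xe : nbhs x (ball x e) by exact: nbhsx_ballx.
  apply: (@filterS2 _ (nbhs x) _ _ _ _ _ xr xe) => y xyr xye.
  by apply: HA; case: (Hxi y xyr) => + _; apply.
have L (F : set_system E) : Filter F ->
    (forall k, (fun y : E => y 0 k) @ F --> x 0 k) -> (forall k, (fun y => xi y k) @ F --> x) ->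
    (fun y : E => f x + \sum_(k < N) (y 0 k - x 0 k) * 'D_(axis k) f (xi y k)) @ F
      --> f x + \sum_k (x 0 k - x 0 k) * 'D_(axis k) f x.
  move=> FF cF xF; apply: cvgD; first exact: cvg_cst.
  apply: cvg_big => [|k _]; first exact: add_continuous.
  apply: cvgM; last exact: (@cvg_comp _ _ _ (xi ^~ k) ('D_(axis k) f) _ _ _ (xF k) (fc k)).
  by apply: cvgB; [exact: cF|exact: cvg_cst].
have {}L := L (nbhs x) (nbhs_filter x) (fun k => @coord_continuous _ _ _ 0 k x) xic.
have L0 : f x = f x + \sum_k (x 0 k - x 0 k) * 'D_(axis k) f x.
  by rewrite big1 ?addr0// => k _; rewrite subrr mul0r.
rewrite -L0 in L; apply: cvg_trans L.
have Eq : nbhs x (fun y : E => f x + \sum_(k < N) (y 0 k - x 0 k) * 'D_(axis k) f (xi y k) = f y).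
  apply: (@filterS _ (nbhs x) (nbhs_filter x) _ _ _ xr) => y /Hxi[_ <-].
  by rewrite addrC subrK.
exact: near_eq_cvg Eq.
Qed.

Lemma derive_shiftE (V W : normedModType R) (F : V -> W) (w x v : V) :
  'D_v (fun y : V => F (y + w)) x = 'D_v F (x + w).
Proof. by rewrite /derive /=; under eq_fun do rewrite -addrA. Qed.

Lemma derivable_shift (V W : normedModType R) (F : V -> W) (w x v : V) :
  derivable F (x + w) v -> derivable (fun y : V => F (y + w)) x v.
Proof. by rewrite /derivable /=; under [in X in _ -> X]eq_fun do rewrite -addrA. Qed.

Lemma axis_ball x (r : R) i j (s t : R) : `|s| + `|t| < r ->
  ball x r (x + s *: axis i + t *: axis j).
Proof.
move=> str; apply/ballE; split.
  by apply: le_lt_trans str; rewrite addr_ge0.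
move=> k; rewrite !mxE/= -addrA opprD addrA subrr add0r normrN.
apply: le_lt_trans str; apply: (le_trans (ler_normD _ _)).
by rewrite !normrM lerD// ler_piMr// normr_nat lern1; case: (_ == _).
Qed.

(** The left-hand side is symmetric in i and j; this is the reason why mixed
    derivatives commute. *)
Lemma double_MVT f x i j (r h : R) : 0 < h -> h + h < r ->
  (forall z, ball x r z -> derivable f z (axis i) /\
                           derivable ('D_(axis i) f) z (axis j)) ->
  exists2 xi, ball x r xi &
  f (x + h *: axis i + h *: axis j) - f (x + h *: axis j)
    - (f (x + h *: axis i) - f x) = h * (h * 'D_(axis j) ('D_(axis i) f) xi).
Proof.
move=> h0 hr fd; pose g y := f (y + h *: axis j) - f y.
have th (t : R) : 0 <= t <= 1 -> `|t * h| <= h.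
  by move=> /andP[t0 t1]; rewrite normrM (gtr0_norm h0) ger0_norm// ler_piMl// ltW.
have B0 (s : R) : `|s| <= h -> ball x r (x + s *: axis i).
  move=> sh; rewrite -[_ + _]addr0 -[X in _ + X](scale0r (axis j)).
  apply: axis_ball; rewrite normr0 addr0.
  by apply: le_lt_trans sh _; rewrite (lt_trans _ hr)// ltrDl.
have B1 (s t : R) : `|s| <= h -> `|t| <= h -> ball x r (x + s *: axis i + t *: axis j).
  move=> sh tH; apply: axis_ball; apply: le_lt_trans hr; exact: lerD.
have hh : `|h| <= h by rewrite gtr0_norm.
have d1 (s : R) : `|s| <= h -> derivable (fun y => f (y + h *: axis j)) (x + s *: axis i) (axis i).
  by move=> sh; apply: derivable_shift; case: (fd _ (B1 s h sh hh)).
have [|s s01 Hs] := @axis_MVT g x i h.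
  move=> t /th tH; apply: derivableB; first exact: d1.
  by case: (fd _ (B0 _ tH)).
have [|t t01 Ht] := @axis_MVT ('D_(axis i) f) (x + (s * h) *: axis i) j h.
  by move=> t /th tH; case: (fd _ (B1 _ _ (th _ s01) tH)).
exists (x + (s * h) *: axis i + (t * h) *: axis j); first by apply: B1; exact: th.
have -> : f (x + h *: axis i + h *: axis j) - f (x + h *: axis j)
    - (f (x + h *: axis i) - f x) = g (x + h *: axis i) - g x by rewrite /g; ring.
rewrite Hs -Ht; congr (_ * _).
rewrite deriveB; [|exact/d1/th|by case: (fd _ (B0 _ (th _ s01)))].
by rewrite derive_shiftE.
Qed.

(** Both mixed derivatives are limits of the same second difference quotient. *)
Lemma Schwarz f x i j :
  (\forall z \near x, [/\ derivable f z (axis i), derivable f z (axis j),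
     derivable ('D_(axis i) f) z (axis j) & derivable ('D_(axis j) f) z (axis i)]) ->
  {for x, continuous ('D_(axis j) ('D_(axis i) f))} ->
  {for x, continuous ('D_(axis i) ('D_(axis j) f))} ->
  'D_(axis j) ('D_(axis i) f) x = 'D_(axis i) ('D_(axis j) f) x.
Proof.
move=> fd /cvgrPdist_lt cji /cvgrPdist_lt cij.
apply/eqP; rewrite -subr_eq0 -normr_le0 leNgt; apply/negP => e0.
set A := 'D_(axis j) _ x in cji e0; set B := 'D_(axis i) _ x in cij e0.
set e := `|A - B| in e0; have e2 : 0 < e / 2 by lra.
have cA : nbhs x (fun z => `|A - 'D_(axis j) ('D_(axis i) f) z| < e / 2) := cji _ e2.
have cB : nbhs x (fun z => `|B - 'D_(axis i) ('D_(axis j) f) z| < e / 2) := cij _ e2.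
have /nbhs_ballP[r1 /= r10 H1] := fd; have /nbhs_ballP[r2 /= r20 H2] := cA.
have /nbhs_ballP[r3 /= r30 H3] := cB.
pose r := Num.min r1 (Num.min r2 r3).
have r0 : 0 < r by rewrite !lt_min r10 r20.
have H z : ball x r z -> [/\ derivable f z (axis i), derivable f z (axis j),
     derivable ('D_(axis i) f) z (axis j) & derivable ('D_(axis j) f) z (axis i)] /\
    (`|A - 'D_(axis j) ('D_(axis i) f) z| < e / 2 /\ `|B - 'D_(axis i) ('D_(axis j) f) z| < e / 2).
  move=> xz; split; first by apply: H1; apply: le_ball xz; rewrite ge_min lexx.
  by split; [apply: H2|apply: H3]; apply: le_ball xz; rewrite !ge_min lexx !orbT.
pose h := r / 3; have h0 : 0 < h by rewrite /h; lra.
have hr : h + h < r by rewrite /h; lra.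
have [|xi /H[_ [/= xiA _]] Hxi] := @double_MVT f x i j r h h0 hr.
  by move=> z /H[[]].
have [|eta /H[_ [_ /= etaB]] Heta] := @double_MVT f x j i r h h0 hr.
  by move=> z /H[[]].
have /(mulfI (lt0r_neq0 h0))/(mulfI (lt0r_neq0 h0)) xe :
    h * (h * 'D_(axis j) ('D_(axis i) f) xi) = h * (h * 'D_(axis i) ('D_(axis j) f) eta).
  have E0 : f (x + h *: axis j + h *: axis i) = f (x + h *: axis i + h *: axis j).
    by congr (f _); exact: addrAC.
  apply: (etrans (esym Hxi)); apply: (etrans _ Heta); rewrite E0.
  have swap (a b c d : R) : a - b - (c - d) = a - c - (b - d) by ring.
  exact: swap.
suff : e < e by rewrite ltxx.
rewrite {1}/e -[X in X - B](subrK ('D_(axis j) ('D_(axis i) f) xi)) -addrA.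
apply: le_lt_trans (ler_normD _ _) _.
have -> : e = e / 2 + e / 2 by rewrite -splitr.
by apply: ltrD; [exact: xiA|rewrite xe distrC; exact: etaB].
Qed.

End AxisCalculus.

(** * Smooth functions *)

Section LineDerivative.
Variables (R : realType) (V : normedModType R).

Lemma is_derive_lineP (f : V -> R) (x v : V) (d : R) :
  is_derive x v f d <-> is_derive (0 : R) (1 : R) (fun t : R => f (x + t *: v)) d.
Proof.
have E1 : (fun h : R => h^-1 *: (((fun s : R => f (x + s *: v)) \o shift 0) (h *: (1:R)) -
     f (x + 0 *: v))) = (fun h : R => h^-1 *: ((f \o shift x) (h *: v) - f x)).
  apply/funext => h /=; congr (_ *: (f _ - f _)); last by rewrite scale0r addr0.
  by rewrite addr0 [h *: 1]mulr1 addrC.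
by split=> -[fd <-]; apply: DeriveDef; move: fd; rewrite /derivable /derive /= E1.
Qed.

Lemma is_derive_comp_real (phi : R -> R) (f : V -> R) (x v : V) (a b : R) :
  is_derive x v f a -> is_derive (f x) (1 : R) phi b ->
  is_derive x v (fun y => phi (f y)) (b * a).
Proof.
move=> /is_derive_lineP fa pb; apply/is_derive_lineP.
have pb' : is_derive (f (x + (0 : R) *: v)) (1 : R) phi b by rewrite scale0r addr0.
exact: (@is_derive1_comp _ phi (fun t : R => f (x + t *: v)) 0 _ _ pb' fa).
Qed.
End LineDerivative.

Section Smooth.
Variables (R : realType) (n : nat).
Local Notation E := 'rV[R]_(n * 2).
Implicit Types (U : set E) (f g : E -> R) (k : 'I_(n * 2)).

Definition C0partial U f := forall x : E, U x ->
  {for x, continuous f} /\ forall k, derivable f x (evec R k).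

(** Differentiability up to finite order, defined so as to allow inductive
    proofs: the innermost derivative of [partials] is split off. *)
Fixpoint Ck (m : nat) U f : Prop :=
  C0partial U f /\ if m is m'.+1 then forall k, Ck m' U ('D_(evec R k) f) else True.

Lemma partials_rcons (s : seq 'I_(n * 2)) k f :
  partials (rcons s k) f = partials s ('D_(evec R k) f).
Proof. by elim: s => //= i s ->. Qed.

Lemma smooth_CkP U f : smooth_on U f <-> forall m, Ck m U f.
Proof.
split=> [sf m|].
  elim: m f sf => [|m IH] f sf /=; split=> //; try exact: (sf [::]).
  move=> k; apply: IH => s x Ux.
  by have := sf (rcons s k) x Ux; rewrite partials_rcons.
move=> H s; elim/last_ind: s f H => [|s k IH] f H x Ux; first by case: (H 0%N) => + _; apply.
rewrite partials_rcons; apply: IH => // m; by case: (H m.+1) => _; apply.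
Qed.

Lemma CkS m U f : Ck m.+1 U f <-> C0partial U f /\ forall k, Ck m U ('D_(evec R k) f).
Proof. by []. Qed.

Lemma CkW m U f : Ck m.+1 U f -> Ck m U f.
Proof. by elim: m f => [|m IH] f /= [Bf Hf]; split=> // k; apply: IH; exact: Hf. Qed.

Lemma Ck0 m U f : Ck m U f -> C0partial U f.
Proof. by case: m => [|m] []. Qed.

Lemma near_open U (P : E -> Prop) x : open U -> U x -> (forall y, U y -> P y) ->
  \forall y \near x, P y.
Proof. by move=> oU Ux H; apply: filterS (open_nbhs_nbhs (conj oU Ux)). Qed.

Lemma C0partial_eq U f g : open U -> (forall x, U x -> f x = g x) ->
  C0partial U f -> C0partial U g.
Proof.
move=> oU fg Bf x Ux; have nfg := near_open oU Ux fg; have [cf df] := Bf x Ux.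
split=> [|k]; last by apply: near_eq_derivable (df k).
rewrite /prop_for /continuous_at -(fg _ Ux).
exact: cvg_trans (near_eq_cvg nfg) cf.
Qed.

Lemma Ck_eq m U f g : open U -> (forall x, U x -> f x = g x) -> Ck m U f -> Ck m U g.
Proof.
move=> oU; elim: m f g => [|m IH] f g fg.
  by move=> [Bf _]; split=> //; exact: C0partial_eq Bf.
move=> /CkS[Bf Hf]; split; first exact: C0partial_eq Bf.
move=> k; apply: (IH ('D_(evec R k) f)) => // x Ux.
by apply: near_eq_derive; exact: near_open fg.
Qed.

Lemma C0partial_derive U f x k : C0partial U f -> U x -> derivable f x (evec R k).
Proof. by move=> H /H[]. Qed.
Arguments C0partial_derive {U f x} k _ _.

Lemma Ck_cst m U (c : R) : Ck m U (cst c).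
Proof.
have B c' : C0partial U (cst c') by move=> x Ux; split=> [|k]; [exact: cst_continuous|exact: derivable_cst].
elim: m c => [|m IH] c; split=> //.
move=> k; have -> : 'D_(evec R k) (cst c : E -> R) = (cst 0 : E -> R) ; last exact: IH.
by apply/funext => x; rewrite derive_cst.
Qed.

Lemma C0partialD U f g : C0partial U f -> C0partial U g -> C0partial U (f \+ g).
Proof.
move=> Hf Hg x Ux; have [cf df] := Hf x Ux; have [cg dg] := Hg x Ux; split.
  exact: (@continuousD _ _ _ f g x).
by move=> k; exact: derivableD.
Qed.

Lemma C0partialM U f g : C0partial U f -> C0partial U g -> C0partial U (f \* g).
Proof.
move=> Hf Hg x Ux; have [cf df] := Hf x Ux; have [cg dg] := Hg x Ux; split.
  exact: (@continuousM _ _ f g x).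
by move=> k; exact: derivableM.
Qed.

Lemma CkD m U f g : open U -> Ck m U f -> Ck m U g -> Ck m U (f \+ g).
Proof.
move=> oU; elim: m f g => [|m IH] f g [Bf Hf] [Bg Hg].
  by split; [exact: C0partialD|].
split; first exact: C0partialD.
move=> k; apply: (Ck_eq oU _ (IH _ _ (Hf k) (Hg k))) => x Ux /=.
by rewrite (deriveD (C0partial_derive k Bf Ux) (C0partial_derive k Bg Ux)).
Qed.

Lemma CkM m U f g : open U -> Ck m U f -> Ck m U g -> Ck m U (f \* g).
Proof.
move=> oU; elim: m f g => [|m IH] f g Hf Hg.
  by split=> //; exact: C0partialM (Ck0 Hf) (Ck0 Hg).
split; first exact: C0partialM (Ck0 Hf) (Ck0 Hg).
move=> k; apply: (Ck_eq oU _ (CkD oU (IH _ _ (CkW Hf) (Hg.2 k)) (IH _ _ (CkW Hg) (Hf.2 k)))) => x Ux /=.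
by rewrite deriveM//; [case: (Ck0 Hf Ux)|case: (Ck0 Hg Ux)].
Qed.

Lemma C0partial_comp U (phi phi' : R -> R) f : C0partial U f ->
  (forall x, U x -> is_derive (f x) (1 : R) phi (phi' (f x))) ->
  C0partial U (fun x => phi (f x)).
Proof.
move=> Hf Hp x Ux; have [cf df] := Hf x Ux; split.
  apply: (@continuous_comp _ _ _ f phi) => //.
  apply: differentiable_continuous; apply/derivable1_diffP.
  by case: (Hp x Ux).
by move=> k; case: (is_derive_comp_real (derivableP (df k)) (Hp x Ux)).
Qed.

Lemma derive_comp_real (phi : R -> R) f x k (b : R) : derivable f x (evec R k) ->
  is_derive (f x) (1 : R) phi b ->
  'D_(evec R k) (fun x => phi (f x)) x = b * 'D_(evec R k) f x.
Proof. by move=> /derivableP fd pb; case: (is_derive_comp_real fd pb). Qed.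

(** The derivative - f'/f^2 is again a product of inverses of f and derivatives
    of f of lower order. *)
Lemma CkV m U f : open U -> (forall x, U x -> f x != 0) -> Ck m U f ->
  Ck m U (fun x => (f x)^-1).
Proof.
move=> oU f0.
have dV (x : E) : U x -> is_derive (f x) (1 : R) (fun t : R => t^-1) (- (f x) ^- 2).
  move=> /f0 fx; have := @is_deriveV R id (f x) 1 1 fx (is_derive_id _ _).
  by rewrite [_ *: 1]mulr1.
have B : Ck m U f -> C0partial U (fun x => (f x)^-1).
  by move=> /Ck0 Hf; apply: (C0partial_comp (phi' := fun t => - t ^- 2) Hf).
elim: m B => [|m IH] B Hf; split=> //; try exact: B.
have Hi : Ck m U (fun x => (f x)^-1).
  apply: IH; last exact: CkW.
  by move=> /Ck0 Hf'; apply: (C0partial_comp (phi' := fun t => - t ^- 2) Hf').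
move=> k; apply: (Ck_eq oU _ (CkM oU (Ck_cst m U (-1)) (CkM oU (CkM oU Hi Hi) (Hf.2 k)))).
move=> x Ux /=; rewrite (derive_comp_real (C0partial_derive k (Ck0 Hf) Ux) (dV x Ux)).
by rewrite expr2 mulN1r mulNr invfM.
Qed.

Lemma Ck_ln m U f : open U -> (forall x, U x -> 0 < f x) -> Ck m U f ->
  Ck m U (fun x => ln (f x)).
Proof.
move=> oU f0 Hf.
have dl (x : E) : U x -> is_derive (f x) (1 : R) (@ln R) (f x)^-1.
  by move=> /f0; exact: is_derive1_ln.
have B : C0partial U (fun x => ln (f x)).
  exact: (C0partial_comp (phi' := fun t => t^-1) (Ck0 Hf)).
case: m Hf => [|m] Hf; split=> // k.
have f0' x : U x -> f x != 0 by move=> /f0 /lt0r_neq0.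
apply: (Ck_eq oU _ (CkM oU (CkV oU f0' (CkW Hf)) (Hf.2 k))) => x Ux /=.
by rewrite (derive_comp_real (C0partial_derive k (Ck0 Hf) Ux) (dl x Ux)).
Qed.

(** Post-composition with any function from a family of real functions that is
    stable under differentiation, such as (exp) or (cos, sin, - cos, - sin). *)
Lemma Ck_comp_family m U f (S : set (R -> R)) : open U ->
  (forall phi, S phi -> exists2 phi', S phi' &
     forall t : R, is_derive t (1 : R) phi (phi' t)) ->
  Ck m U f -> forall phi, S phi -> Ck m U (fun x => phi (f x)).
Proof.
move=> oU HS; elim: m => [|m IH] Hf phi Sp; have [phi' Sp' dp] := HS _ Sp;
  split=> //; try exact: (C0partial_comp (phi' := phi') (Ck0 Hf)).
move=> k; apply: (Ck_eq oU _ (CkM oU (IH (CkW Hf) _ Sp') (Hf.2 k))) => x Ux /=.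
by rewrite (derive_comp_real (C0partial_derive k (Ck0 Hf) Ux) (dp _)).
Qed.

Lemma smooth_eq U f g : open U -> (forall x, U x -> f x = g x) ->
  smooth_on U f -> smooth_on U g.
Proof. by move=> oU fg /smooth_CkP H; apply/smooth_CkP => m; exact: Ck_eq (H m). Qed.

Lemma smooth_cst U (c : R) : smooth_on U (fun=> c).
Proof. by apply/smooth_CkP => m; exact: Ck_cst. Qed.

Lemma smoothD U f g : open U -> smooth_on U f -> smooth_on U g ->
  smooth_on U (fun x => f x + g x).
Proof. by move=> oU /smooth_CkP Hf /smooth_CkP Hg; apply/smooth_CkP => m; exact: CkD. Qed.

Lemma smoothM U f g : open U -> smooth_on U f -> smooth_on U g ->
  smooth_on U (fun x => f x * g x).
Proof. by move=> oU /smooth_CkP Hf /smooth_CkP Hg; apply/smooth_CkP => m; exact: CkM. Qed.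

Lemma smoothN U f : open U -> smooth_on U f -> smooth_on U (fun x => - f x).
Proof.
move=> oU Hf; apply: (smooth_eq oU _ (smoothM oU (smooth_cst (-1)) Hf)) => x _.
by rewrite mulN1r.
Qed.

Lemma smoothB U f g : open U -> smooth_on U f -> smooth_on U g ->
  smooth_on U (fun x => f x - g x).
Proof. by move=> oU Hf Hg; exact: (smoothD oU Hf (smoothN oU Hg)). Qed.

Lemma smooth_sum U (I : Type) (r : seq I) (P : pred I) (F : I -> E -> R) : open U ->
  (forall i, smooth_on U (F i)) -> smooth_on U (fun x => \sum_(i <- r | P i) F i x).
Proof.
move=> oU HF; elim: r => [|i r IH].
  by apply: (smooth_eq oU _ (smooth_cst 0)) => x _; rewrite big_nil.
case Pi : (P i).
  by apply: (smooth_eq oU _ (smoothD oU (HF i) IH)) => x _; rewrite big_cons Pi.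
by apply: (smooth_eq oU _ IH) => x _; rewrite big_cons Pi.
Qed.

Lemma smooth_prod U (I : Type) (r : seq I) (P : pred I) (F : I -> E -> R) : open U ->
  (forall i, smooth_on U (F i)) -> smooth_on U (fun x => \prod_(i <- r | P i) F i x).
Proof.
move=> oU HF; elim: r => [|i r IH].
  by apply: (smooth_eq oU _ (smooth_cst 1)) => x _; rewrite big_nil.
case Pi : (P i).
  by apply: (smooth_eq oU _ (smoothM oU (HF i) IH)) => x _; rewrite big_cons Pi.
by apply: (smooth_eq oU _ IH) => x _; rewrite big_cons Pi.
Qed.

Lemma smooth_det U m (A : E -> 'M[R]_m) : open U ->
  (forall i j, smooth_on U (fun x => A x i j)) -> smooth_on U (fun x => \det (A x)).
Proof.
move=> oU HA; rewrite /determinant; apply: smooth_sum => // s.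
by apply: smoothM => //; [exact: smooth_cst|exact: smooth_prod].
Qed.

Lemma smoothV U f : open U -> (forall x, U x -> f x != 0) -> smooth_on U f ->
  smooth_on U (fun x => (f x)^-1).
Proof. by move=> oU f0 /smooth_CkP Hf; apply/smooth_CkP => m; exact: CkV. Qed.

Lemma smooth_ln U f : open U -> (forall x, U x -> 0 < f x) -> smooth_on U f ->
  smooth_on U (fun x => ln (f x)).
Proof. by move=> oU f0 /smooth_CkP Hf; apply/smooth_CkP => m; exact: Ck_ln. Qed.

Lemma smooth_expR U f : open U -> smooth_on U f -> smooth_on U (fun x => expR (f x)).
Proof.
move=> oU /smooth_CkP Hf; apply/smooth_CkP => m.
apply: (@Ck_comp_family m U f [set @expR R]) => // phi ->.
by exists (@expR R) => // t; exact: is_derive_expR.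
Qed.

Lemma smooth_trig U f : open U -> smooth_on U f ->
  smooth_on U (fun x => cos (f x)) /\ smooth_on U (fun x => sin (f x)).
Proof.
move=> oU /smooth_CkP Hf.
pose S : set (R -> R) := [set phi | [\/ phi = cos, phi = sin, phi = (fun t => - sin t) | phi = (fun t => - cos t)]].
have HS phi : S phi -> exists2 phi', S phi' & forall t : R, is_derive t (1 : R) phi (phi' t).
  case=> ->.
  - by exists (fun t => - sin t); [constructor 3|exact: is_derive_cos].
  - by exists cos; [constructor 1|exact: is_derive_sin].
  - exists (fun t => - cos t); first by constructor 4.
    by move=> t; apply: (@is_deriveN _ _ _ sin).
  - exists sin; first by constructor 2.
    by move=> t; rewrite -[sin t]opprK; apply: (@is_deriveN _ _ _ cos).
split; apply/smooth_CkP => m; apply: (Ck_comp_family oU HS (Hf m)).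
  by constructor 1.
by constructor 2.
Qed.

Lemma smooth_derive U f k : smooth_on U f -> smooth_on U ('D_(evec R k) f).
Proof. by move=> sf s x Ux; rewrite -partials_rcons; exact: sf. Qed.

Lemma smooth_cont U f x : smooth_on U f -> U x -> {for x, continuous f}.
Proof. by move=> sf Ux; case: (sf [::] x Ux). Qed.

Lemma smooth_derivable U f x k : smooth_on U f -> U x -> derivable f x (evec R k).
Proof. by move=> sf Ux; case: (sf [::] x Ux). Qed.

Arguments smooth_derivable {U f x} k _ _.
Arguments smooth_derive {U f} k _.
Arguments smooth_cont {U f x} _ _.

Lemma smooth_Schwarz U f x i j : open U -> smooth_on U f -> U x ->
  'D_(evec R j) ('D_(evec R i) f) x = 'D_(evec R i) ('D_(evec R j) f) x.
Proof.
move=> oU sf Ux; apply: (@Schwarz R (n * 2) f x i j).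
- apply: (near_open oU Ux) => y Uy; split.
  + exact: smooth_derivable i sf Uy.
  + exact: smooth_derivable j sf Uy.
  + exact: smooth_derivable j (smooth_derive i sf) Uy.
  + exact: smooth_derivable i (smooth_derive j sf) Uy.
- exact: smooth_cont (smooth_derive j (smooth_derive i sf)) Ux.
- exact: smooth_cont (smooth_derive i (smooth_derive j sf)) Ux.
Qed.

Lemma smooth_primitive U f (a : 'I_(n * 2) -> E -> R) : open U ->
  (forall x, U x -> {for x, continuous f}) ->
  (forall x, U x -> forall k, is_derive x (evec R k) f (a k x)) ->
  (forall k, smooth_on U (a k)) -> smooth_on U f.
Proof.
move=> oU cf df sa; apply/smooth_CkP => m.
have B : C0partial U f by move=> x Ux; split=> [|k]; [exact: cf|case: (df x Ux k)].
case: m => [|m]; split=> // k; move/smooth_CkP : (sa k) => /(_ m).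
by apply: Ck_eq => // x Ux; case: (df x Ux k).
Qed.

End Smooth.

(** * The Poincare lemma on a cube *)

Section Poincare.
Variables (R : realType) (n : nat).
Local Notation E := 'rV[R]_(n * 2).
Local Notation mu := (@lebesgue_measure R).

Lemma coord_norm_le (x : E) i : `|x 0 i| <= `|x|.
Proof.
apply/ler_addgt0Pr => e e0.
have : ball x (`|x| + e) (0 : E) by rewrite -ball_normE /= subr0 ltrDl.
by move=> /ballE[_ /(_ i)]; rewrite mxE subr0 => /ltW.
Qed.

Lemma bounded_on_cube (f : E -> R) (c : E) (r rho : R) : rho < r -> 0 <= rho ->
  (forall x, ball c r x -> {for x, continuous f}) ->
  exists M : R, forall z : E, (forall i, `|z 0 i - c 0 i| <= rho) -> `|f z| <= M.
Proof.
move=> rr rho0 cf.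
pose K : set E := [set z | forall i, [set` `[c 0 i - rho, c 0 i + rho]] (z 0 i)].
have Kin (z : E) : (forall i, `|z 0 i - c 0 i| <= rho) <-> K z.
  by split=> H i; have := H i; rewrite /= in_itv /= ler_distl.
have Kc : compact K.
  by apply: (@rV_compact R (n * 2) (fun i => `[c 0 i - rho, c 0 i + rho]%classic)) => i; exact: segment_compact.
have Kball z : K z -> ball c r z.
  move=> /Kin Kz; apply/ballE; split; first exact: le_lt_trans rr.
  by move=> i; rewrite distrC; apply: le_lt_trans rr.
have [||z0 _ Hz0] := @compact_EVT_max E R (fun z => `|f z|) K _ Kc.
- by exists c; apply/Kin => i; rewrite subrr normr0.
- apply: continuous_in_subspaceT => z /set_mem /Kball /cf cfz.
  exact: (@continuous_comp _ _ _ f (fun t : R => `|t|) z cfz (@norm_continuous _ _ (f z))).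
by exists `|f z0| => z /Kin Kz; apply: Hz0; rewrite inE.
Qed.

Lemma coordE (x y : E) (t : R) k : (x + t *: y) 0 k = x 0 k + t * y 0 k.
Proof. by rewrite !mxE. Qed.

Lemma is_derive_affine (a b t : R) : is_derive t (1 : R) (fun t : R => a + t * b) b.
Proof.
have h0 := @is_deriveM _ _ (id : R -> R) (cst b) t 1 1 0 (is_derive_id _ _) (is_derive_cst _ _ _).
have h1 := @is_deriveD _ _ _ (cst a) _ t 1 0 _ (is_derive_cst a t (1 : R)) h0.
by apply: is_derive_eq h1 _; rewrite scaler0 !add0r [_ *: 1]mulr1.
Qed.

Lemma smooth_is_derive_curve U (f : E -> R) (c : R -> E) (c' : E) (t : R) :
  open U -> smooth_on U f -> U (c t) ->
  (forall k, is_derive t (1 : R) (fun t => c t 0 k) (c' 0 k)) ->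
  is_derive t (1 : R) (fun t => f (c t)) (\sum_k c' 0 k * 'D_(evec R k) f (c t)).
Proof.
move=> oU sf Uc cd; apply: (@is_derive_curve R (n * 2) f c c' t) => //.
  by apply: (near_open oU Uc) => y Uy k; exact: smooth_derivable sf Uy.
by move=> k; exact: smooth_cont (smooth_derive k sf) Uc.
Qed.

Lemma smooth_is_derive_line U (f : E -> R) (x v : E) (t : R) :
  open U -> smooth_on U f -> U (x + t *: v) ->
  is_derive t (1 : R) (fun t => f (x + t *: v))
     (\sum_k v 0 k * 'D_(evec R k) f (x + t *: v)).
Proof.
move=> oU sf Uc; apply: (smooth_is_derive_curve oU sf Uc) => k.
under eq_fun do rewrite coordE; exact: is_derive_affine.
Qed.

Section Potential.
Variables (c : E) (r : R) (a : 'I_(n * 2) -> E -> R).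
Let U := ball c r.
Hypothesis sa : forall k, smooth_on U (a k).
Hypothesis closed_a : forall i j x, U x ->
  'D_(evec R i) (a j) x = 'D_(evec R j) (a i) x.

Let phi (x : E) (t : R) := \sum_k a k (c + t *: (x - c)) * (x - c) 0 k.

(** The integral of the one-form along the segment from c to x. *)
Definition potential (x : E) : R := \int[mu]_(t in `[0, 1]) phi x t.

Let oU : open U. Proof. exact: ball_open. Qed.

Let segU (x : E) (t : R) : U x -> 0 <= t <= 1 -> U (c + t *: (x - c)).
Proof.
move=> /ballE[r0 Ux] /andP[t0 t1]; apply/ballE; split=> // i.
rewrite coordE opprD addrA subrr add0r normrN normrM ger0_norm// !mxE distrC.
by apply: le_lt_trans (Ux i); rewrite ler_piMl.
Qed.

Let phi_derive_t (x : E) (t : R) : U x -> 0 <= t <= 1 ->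
  derivable (phi x) t (1 : R).
Proof.
move=> Ux t01; rewrite /phi.
have H k : derivable (fun t : R => a k (c + t *: (x - c)) * (x - c) 0 k) t 1.
  apply: derivableM; last exact: derivable_cst.
  by case: (smooth_is_derive_line oU (sa k) (segU Ux t01)).
have -> : (fun t : R => \sum_k a k (c + t *: (x - c)) * (x - c) 0 k) =
  \sum_(k < n * 2) (fun t : R => a k (c + t *: (x - c)) * (x - c) 0 k).
  by apply/funext => s; rewrite fct_sumE.
exact: derivable_sum H.
Qed.

Let integrable_phi (x : E) : U x -> mu.-integrable `[0%R, 1%R] (EFin \o phi x).
Proof.
move=> Ux; apply: continuous_compact_integrable; first exact: segment_compact.
apply: derivable_within_continuous => t; rewrite in_itv /=; exact: phi_derive_t.
Qed.

(** The derivative of [phi] with respect to the j-th coordinate of x. *)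
Let psi j (x : E) (t : R) :=
  \sum_k t * 'D_(evec R j) (a k) (c + t *: (x - c)) * (x - c) 0 k
  + a j (c + t *: (x - c)).

Let phi_derive_s j (x : E) (s t : R) : U (x + s *: evec R j) -> 0 <= t <= 1 ->
  is_derive s (1 : R) (fun s => phi (x + s *: evec R j) t) (psi j (x + s *: evec R j) t).
Proof.
move=> Ux t01.
have H1 k : is_derive s (1 : R) (fun s : R => a k (c + t *: (x + s *: evec R j - c)))
    (t * 'D_(evec R j) (a k) (c + t *: (x + s *: evec R j - c))).
  have := @smooth_is_derive_curve U (a k) (fun s : R => c + t *: (x + s *: evec R j - c))
     (t *: evec R j) s oU (sa k) (segU Ux t01).
  rewrite (bigD1 j)//= big1 ?addr0 => [|i ij]; last by rewrite !mxE eqxx (negPf ij)/= mulr0 mul0r.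
  rewrite !mxE !eqxx mulr1; apply => i.
  have -> : (fun s : R => (c + t *: (x + s *: evec R j - c)) 0 i) =
            (fun s => (c 0 i + t * (x 0 i - c 0 i)) + s * (t * evec R j 0 i)).
    by apply/funext => s'; rewrite !mxE; ring.
  have -> : (t *: evec R j) 0 i = t * evec R j 0 i by rewrite mxE.
  exact: is_derive_affine.
have H2 k : is_derive s (1 : R) (fun s : R => (x + s *: evec R j - c) 0 k) (evec R j 0 k).
  have -> : (fun s : R => (x + s *: evec R j - c) 0 k) =
            (fun s => (x 0 k - c 0 k) + s * evec R j 0 k).
    by apply/funext => s'; rewrite !mxE; ring.
  exact: is_derive_affine.
have H k : is_derive s (1 : R)
   ((fun s : R => a k (c + t *: (x + s *: evec R j - c))) * (fun s : R => (x + s *: evec R j - c) 0 k)) _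
   := is_deriveM (H1 k) (H2 k).
have := is_derive_sum H.
have -> : \sum_(i < n * 2) (fun s0 : R => a i (c + t *: (x + s0 *: evec R j - c))) *
             (fun s0 : R => (x + s0 *: evec R j - c) 0 i)
   = (fun s => phi (x + s *: evec R j) t).
  by apply/funext => s'; rewrite /phi fct_sumE.
move=> K; apply: is_derive_eq K _.
rewrite /psi big_split/= addrC; congr (_ + _).
  by apply: eq_bigr => k _; rewrite [LHS]mulrC.
rewrite (bigD1 j)//= big1 ?addr0 => [|i ij]; last by rewrite !mxE eqxx (negPf ij)/= scaler0.
by rewrite !mxE !eqxx [_ *: 1]mulr1.
Qed.

(** Closedness is what turns [psi] into a derivative with respect to t. *)
Let psi_exact j (x : E) (t : R) : U x -> 0 <= t <= 1 ->
  is_derive t (1 : R) (fun t : R => t * a j (c + t *: (x - c))) (psi j x t).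
Proof.
move=> Ux t01.
have := is_deriveM (is_derive_id t (1 : R)) (smooth_is_derive_line oU (sa j) (segU Ux t01)).
move=> K; apply: is_derive_eq K _.
rewrite /psi [_ *: 1]mulr1; congr (_ + _).
rewrite [LHS]mulr_sumr; apply: eq_bigr => k _.
by rewrite (closed_a _ _ (segU Ux t01)) mulrA mulrAC.
Qed.

Let continuous_psi j (x : E) : U x -> {within `[0%R, 1%R], continuous (psi j x)}.
Proof.
move=> Ux; apply: derivable_within_continuous => t; rewrite in_itv /= => t01.
have D f : smooth_on U f -> derivable (fun t : R => f (c + t *: (x - c))) t (1 : R).
  by move=> sf; case: (smooth_is_derive_line oU sf (segU Ux t01)).
have H k : derivable (fun t : R => t * 'D_(evec R j) (a k) (c + t *: (x - c)) * (x - c) 0 k) t 1.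
  apply: derivableM; last exact: derivable_cst.
  exact: derivableM (@derivable_id _ _ _ _) (D _ (smooth_derive j (sa k))).
have -> : psi j x =
  \sum_(k < n * 2) (fun t : R => t * 'D_(evec R j) (a k) (c + t *: (x - c)) * (x - c) 0 k)
  + (fun t : R => a j (c + t *: (x - c))).
  by apply/funext => s; rewrite /psi !fctE fct_sumE.
by apply: derivableD; [exact: derivable_sum H|apply: D].
Qed.

(** Domination, for differentiating under the integral sign. *)
Let psi_bounded j (x : E) : U x -> exists2 d : R, 0 < d &
  exists M : R, forall s t : R, `|s| < d -> 0 <= t <= 1 ->
    U (x + s *: evec R j) /\ `|psi j (x + s *: evec R j) t| <= M.
Proof.
move=> Ux; have xc : `|x - c| < r.
  by move: Ux; rewrite /U -ball_normE /= distrC.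
pose d := (r - `|x - c|) / 2; have d0 : 0 < d by rewrite /d; lra.
exists d => //; pose rho := `|x - c| + d.
have rr : rho < r by rewrite /rho /d; lra.
have rho0 : 0 <= rho by rewrite addr_ge0// ltW.
have cf f : smooth_on U f -> forall x, ball c r x -> {for x, continuous f}.
  by move=> sf y Uy; exact: smooth_cont sf Uy.
have [M0 HM0] := bounded_on_cube rr rho0 (cf _ (sa j)).
have /choice[M HM] k := bounded_on_cube rr rho0 (cf _ (smooth_derive j (sa k))).
exists (\sum_k M k * rho + M0) => s t sd /andP[t0 t1].
have B i : `|(x + s *: evec R j - c) 0 i| <= rho.
  have -> : (x + s *: evec R j - c) 0 i = (x - c) 0 i + s * evec R j 0 i.
    by rewrite !mxE addrAC.
  apply: le_trans (ler_normD _ _) _; apply: lerD; first exact: coord_norm_le.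
  rewrite normrM; apply: le_trans (ltW sd); rewrite ler_piMr//.
  by rewrite !mxE/= normr_nat lern1; case: (_ == _).
have Z i : `|(c + t *: (x + s *: evec R j - c)) 0 i - c 0 i| <= rho.
  rewrite coordE addrAC subrr add0r normrM ger0_norm//.
  by apply: le_trans (B i); rewrite ler_piMl.
split.
  apply/ballE; split; first exact: le_lt_trans rr.
  by move=> i; rewrite distrC; apply: le_lt_trans rr; have := B i; rewrite !mxE.
apply: le_trans (ler_normD _ _) _; apply: lerD; last exact: HM0.
apply: le_trans (ler_norm_sum _ _ _) _; apply: ler_sum => k _.
rewrite !normrM (ger0_norm t0); apply: ler_pM => //; first by rewrite mulr_ge0.
by apply: le_trans (HM k _ Z); rewrite ler_piMl.
Qed.

(** By [psi_exact], the derivative of the integral is the increment of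
    t a_j (c + t (x - c)) from t = 0 to t = 1. *)
Lemma potential_derive j (x : E) : U x -> is_derive x (evec R j) potential (a j x).
Proof.
move=> Ux; apply/is_derive_lineP.
have [d d0 [M HM]] := psi_bounded j Ux.
have I0 : (`]-d, d[%classic : set R) 0 by rewrite /= in_itv /= oppr_lt0 d0.
have Id (s : R) : (`]-d, d[%classic : set R) s -> `|s| < d by rewrite /= in_itv /= ltr_norml.
pose f (s : R) (t : R) := phi (x + s *: evec R j) t.
have mB : measurable (`[0%R, 1%R]%classic : set (measurableTypeR R)) by exact: measurable_itv.
have intf (s : R) : (`]-d, d[%classic : set R) s -> mu.-integrable `[0%R, 1%R] (EFin \o f s).
  move=> /Id sd; apply: integrable_phi; case: (HM s 0 sd) => //; lra.
have B01 (t : R) : (`[0%R, 1%R]%classic : set R) t -> 0 <= t <= 1 by rewrite /= in_itv.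
have derf (s t : R) : (`]-d, d[%classic : set R) s -> (`[0%R, 1%R]%classic : set R) t ->
    is_derive s (1 : R) (f ^~ t) (psi j (x + s *: evec R j) t).
  by move=> /Id sd /B01 t01; apply: phi_derive_s => //; case: (HM s t sd).
have dE (s t : R) : (`]-d, d[%classic : set R) s -> (`[0%R, 1%R]%classic : set R) t ->
    partial1of2 f s t = psi j (x + s *: evec R j) t.
  by move=> Is Bt; rewrite partial1of2E; case: (derf s t Is Bt).
have M0 : 0 <= M by apply: le_trans (HM 0 0 _ _).2 => //; [rewrite normr0|lra].
have intG : mu.-integrable `[0%R, 1%R] (EFin \o (fun=> M : R)).
  by apply: continuous_compact_integrable; [exact: segment_compact|move=> ?; exact: cst_continuous].
have derf1 (s t : R) : (`]-d, d[%classic : set R) s -> (`[0%R, 1%R]%classic : set R) t -> derivable (f ^~ t) s 1.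
  by move=> Is Bt; case: (derf s t Is Bt).
have Gub (s t : R) : (`]-d, d[%classic : set R) s -> (`[0%R, 1%R]%classic : set R) t -> `|partial1of2 f s t| <= M.
  by move=> Is Bt; rewrite dE//; case: (HM s t (Id _ Is) (B01 _ Bt)).
have dF := @derivable_under_integral R _ _ mu f `[0%R, 1%R]%classic mB 0 (-d) d I0 intf derf1 (fun=> M)
   (fun=> M0) intG Gub.
have eF := @differentiation_under_integral R _ _ mu f `[0%R, 1%R]%classic mB 0 (-d) d I0 intf derf1 (fun=> M)
   (fun=> M0) intG Gub.
apply: DeriveDef; first exact: dF.
rewrite -derive1E eF.
have -> : \int[mu]_(t in `[0%R, 1%R]) partial1of2 f 0 t = \int[mu]_(t in `[0%R, 1%R]) psi j x t.
  apply: eq_Rintegral => t /set_mem Bt; rewrite dE//.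
  by rewrite scale0r addr0.
rewrite /Rintegral (@continuous_FTC2 _ (psi j x) (fun t : R => t * a j (c + t *: (x - c))))//.
- by rewrite -EFinB /= mul1r scale1r mul0r subr0 addrC subrK.
- exact: continuous_psi.
- have dt (t : R) : 0 <= t <= 1 -> derivable (fun t : R => t * a j (c + t *: (x - c))) t (1 : R).
    by move=> t01; case: (psi_exact j Ux t01).
  have ct (t : R) : 0 <= t <= 1 -> {for t, continuous (fun t : R => t * a j (c + t *: (x - c)))}.
    by move=> /dt /derivable1_diffP; exact: differentiable_continuous.
  split.
  + by move=> t; rewrite in_itv/= => /andP[t0 t1]; apply: dt; rewrite !ltW.
  + by apply: cvg_at_right_filter; apply: ct; lra.
  + by apply: cvg_at_left_filter; apply: ct; lra.
- move=> t; rewrite in_itv/= => /andP[t0 t1]; rewrite derive1E.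
  by case: (psi_exact j Ux (t := t)) => //; rewrite !ltW.
Qed.

End Potential.

(** Poincare lemma: the primitive is the integral along the rays from c. Its
    smoothness follows from that of its partial derivatives. *)
Lemma closed_has_potential (c : E) (r : R) (a : 'I_(n * 2) -> E -> R) :
  (forall k, smooth_on (ball c r) (a k)) ->
  (forall i j x, ball c r x -> 'D_(evec R i) (a j) x = 'D_(evec R j) (a i) x) ->
  exists p : E -> R, smooth_on (ball c r) p /\
    forall k x, ball c r x -> 'D_(evec R k) p x = a k x.
Proof.
move=> sa ca; exists (potential c a).
have D j x : ball c r x -> is_derive x (evec R j) (potential c a) (a j x).
  by move=> Bx; exact: potential_derive Bx.
split; last by move=> k x Bx; case: (D k x Bx).
apply: (smooth_primitive (a := a) (ball_open _ _)) => // x Bx; last by move=> k; exact: D.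
apply: (@continuous_of_partials R (n * 2)).
  by apply: (near_open (ball_open _ _) Bx) => y By k; case: (D k y By).
move=> k; have ck := smooth_cont (sa k) Bx.
have De : \forall y \near x, a k y = 'D_(evec R k) (potential c a) y.
  by apply: (near_open (ball_open _ _) Bx) => y By; case: (D k y By).
rewrite /prop_for /continuous_at -(nbhs_singleton De).
exact: cvg_trans (near_eq_cvg De) ck.
Qed.
End Poincare.

(** * Wedge products as determinants *)

Section PermSum.
Variables (k l : nat) (s : 'S_k) (t : 'S_l).

Definition block_fun (i : 'I_(k + l)) : 'I_(k + l) :=
  match fintype.split i with inl a => lshift l (s a) | inr b => rshift k (t b) end.

Lemma block_fun_inj : injective block_fun.
Proof.
move=> i j; rewrite /block_fun.
case: (split_ordP i) => a ->; case: (split_ordP j) => b -> /eqP.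
- by rewrite eq_lshift => /eqP /perm_inj ->.
- by rewrite eq_lrshift.
- by rewrite eq_rlshift.
- by rewrite eq_rshift => /eqP /perm_inj ->.
Qed.

Definition block_perm : 'S_(k + l) := perm block_fun_inj.

Lemma block_permL a : block_perm (lshift l a) = lshift l (s a).
Proof. by rewrite permE /block_fun; case: split_ordP => b /eqP; rewrite ?eq_lshift ?eq_lrshift// => /eqP <-. Qed.

Lemma block_permR b : block_perm (rshift k b) = rshift k (t b).
Proof. by rewrite permE /block_fun; case: split_ordP => a /eqP; rewrite ?eq_rshift ?eq_rlshift// => /eqP <-. Qed.

Lemma sign_block_perm (K : comNzRingType) :
  (-1) ^+ block_perm = (-1) ^+ s * (-1) ^+ t :> K.
Proof.
rewrite -!det_perm -(det_ublock _ 0); congr (\det _); apply/matrixP => i j.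
rewrite !mxE; case: split_ordP => a ->; rewrite !mxE; case: split_ordP => b ->; rewrite !mxE.
- by rewrite block_permL eq_lshift.
- by rewrite block_permL eq_lrshift.
- by rewrite block_permR eq_rlshift.
- by rewrite block_permR eq_rshift.
Qed.
End PermSum.

(** Laplace expansion along the first k rows, with every choice of columns
    repeated k! l! times: summing over all permutations, the determinants of
    the two blocks may be expanded and absorbed in the permutation. *)
Lemma Laplace_expansion (K : comNzRingType) k l (W : 'M[K]_(k + l)) :
  \sum_(s : 'S_(k + l)) (-1) ^+ s *
    (\det (\matrix_(i, j) W (lshift l i) (s (lshift l j))) *
     \det (\matrix_(i, j) W (rshift k i) (s (rshift k j)))) =
  (k`! * l`!)%:R * \det W.
Proof.
transitivity (\sum_(p : 'S_k * 'S_l) \sum_(s : 'S_(k + l))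
    (-1) ^+ (block_perm p.1 p.2 * s)%g * \prod_i W i ((block_perm p.1 p.2 * s)%g i)).
  rewrite exchange_big; apply: eq_bigr => s _.
  rewrite big_distrlr /= pair_big mulr_sumr; apply: eq_bigr => -[p q] _ /=.
  rewrite odd_permM signr_addb sign_block_perm big_split_ord /=.
  rewrite [in RHS](eq_bigr (fun i => (\matrix_(i, j) W (lshift l i) (s (lshift l j))) i (p i))); last first.
    by move=> i _; rewrite mxE permM block_permL.
  rewrite [X in _ = _ * (_ * X)](eq_bigr (fun i => (\matrix_(i, j) W (rshift k i) (s (rshift k j))) i (q i))); last first.
    by move=> i _; rewrite mxE permM block_permR.
  have regroup (a b c d e : K) : a * ((b * c) * (d * e)) = b * d * a * (c * e) by ring.
  exact: regroup.
transitivity (\sum_(p : 'S_k * 'S_l) \det W).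
  apply: eq_bigr => -[p q] _ /=.
  by rewrite /determinant [RHS](reindex_inj (mulgI (block_perm p q))).
by rewrite sumr_const card_prod -!(card_Sn) mulr_natl.
Qed.

Section Interleave.
Variable n : nat.

Lemma xidx_inj : injective (@xidx n).
Proof. by move=> i j [/eqP]; rewrite eqn_mul2r => /eqP /val_inj. Qed.
Lemma yidx_inj : injective (@yidx n).
Proof. by move=> i j [/eqP]; rewrite eqn_mul2r => /eqP /val_inj. Qed.
Lemma xy_neq i j : xidx i != yidx j :> 'I_(n * 2).
Proof. by apply/eqP => -[/(congr1 odd)]; rewrite /= !oddM !andbF. Qed.

Definition interleave (i : 'I_(n + n)) : 'I_(n * 2) :=
  match fintype.split i with inl a => xidx a | inr b => yidx b end.

Lemma interleaveL a : interleave (lshift n a) = xidx a.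
Proof. by rewrite /interleave; case: split_ordP => b /eqP; rewrite ?eq_lshift ?eq_lrshift// => /eqP <-. Qed.
Lemma interleaveR a : interleave (rshift n a) = yidx a.
Proof. by rewrite /interleave; case: split_ordP => b /eqP; rewrite ?eq_rshift ?eq_rlshift// => /eqP <-. Qed.

Lemma interleave_inj : injective interleave.
Proof.
move=> i j; case: (split_ordP i) => a ->; case: (split_ordP j) => b ->;
  rewrite ?interleaveL ?interleaveR.
- by move=> /xidx_inj ->.
- by move/eqP; rewrite (negPf (xy_neq _ _)).
- by move/eqP; rewrite eq_sym (negPf (xy_neq _ _)).
- by move=> /yidx_inj ->.
Qed.
End Interleave.

Lemma det_reindex (K : comNzRingType) a b (e : a = b) (h : 'I_a -> 'I_b)
    (A : 'M[K]_b) : injective h -> \det (\matrix_(i, j) A (h i) (h j)) = \det A.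
Proof.
case: b / e h A => h A hi; pose p := perm hi.
have -> : \matrix_(i, j) A (h i) (h j) = row_perm p (col_perm p A).
  by apply/matrixP => i j; rewrite !mxE !permE.
rewrite row_permE col_permE !det_mulmx !det_perm mulrCA mulrA.
by rewrite odd_permV -mulrA -signr_addb addbb mulr1.
Qed.

Section InterleaveSign.
Variable K : comNzRingType.

(** Position, in the ordering x_1, y_1, ..., x_n, y_n, of the i-th element of
    the ordering x_1, ..., x_n, y_1, ..., y_n. *)
Definition shuffle (n i : nat) : nat :=
  if (i < n)%N then (i * 2)%N else ((i - n) * 2).+1.

Definition shuffle_mx n : 'M[K]_(n * 2) :=
  \matrix_(i, j) ((j : nat) == shuffle n i)%:R.

(** Expanding twice, along the rows of x_1 and of y_1, moves y_1 across
    x_2, ..., x_n; hence the binomial coefficient. *)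
Lemma det_shuffle n : \det (shuffle_mx n) = (-1) ^+ 'C(n, 2).
Proof.
elim: n => [|n IH]; first by rewrite [LHS]det_mx00.
rewrite (expand_det_row _ (ord0 : 'I_(n.+1 * 2))) (bigD1 ord0)//= big1 => [|j j0]; last first.
  by rewrite mxE /shuffle /= mul0n; case: eqP => [jj|_]; rewrite ?mul0r//; case/eqP: j0; exact: val_inj.
rewrite mxE eqxx mul1r addr0 /cofactor addn0 expr0 mul1r.
have hr : (n < (n * 2).+1)%N by rewrite ltnS leq_pmulr.
rewrite (expand_det_row _ (Ordinal hr)) (bigD1 ord0)//= big1 => [|j j0]; last first.
  rewrite !mxE /shuffle /= /bump /= add1n ltnn subnn mul0n.
  by case: eqP => [[jj]|_]; rewrite ?mul0r//; case/eqP: j0; exact: val_inj.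
rewrite !mxE /shuffle /= /bump /= add1n ltnn subnn mul0n eqxx mul1r addr0.
rewrite /cofactor /= addn0 binS bin1 addnC exprD -IH; congr (_ * \det _).
apply/matrixP => i j; rewrite !mxE /shuffle /= /bump /= !add1n ltnS.
congr (_%:R); congr (nat_of_bool _).
have [ni|ni] := leqP n i; rewrite /= ?add1n ?add0n.
  by rewrite ltnNge (leq_trans ni)//= subSn// mulSn eqSS.
by rewrite ni mulSn.
Qed.
End InterleaveSign.

Section Halves.
Variable n : nat.
Lemma half_lt (i : 'I_(n * 2)) : (i./2 < n)%N.
Proof. by rewrite -divn2 ltn_divLR. Qed.
Definition half (i : 'I_(n * 2)) : 'I_n := Ordinal (half_lt i).
Lemma half_x j : half (xidx j) = j.
Proof. by apply: val_inj; rewrite /= muln2 doubleK. Qed.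
Lemma half_y j : half (yidx j) = j.
Proof. by apply: val_inj; rewrite /= muln2 uphalf_double. Qed.
Lemma odd_x (j : 'I_n) : odd (xidx j) = false.
Proof. by rewrite /= oddM andbF. Qed.
Lemma odd_y (j : 'I_n) : odd (yidx j) = true.
Proof. by rewrite /= oddM andbF. Qed.

Lemma xy_half (i : 'I_(n * 2)) : i = if odd i then yidx (half i) else xidx (half i).
Proof.
have := odd_double_half i.
case: ifP => oi E0; apply: val_inj; apply: (etrans (esym E0)).
  exact: (congr1 S (esym (muln2 _))).
exact: (esym (muln2 _)).
Qed.

Lemma sum_xy (K : nmodType) (F : 'I_(n * 2) -> K) :
  \sum_i F i = \sum_a F (xidx a) + \sum_a F (yidx a).
Proof.
have ib : bijective (@interleave n).
  by apply: inj_card_bij; [exact: interleave_inj|rewrite !card_ord muln2 addnn].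
rewrite (reindex (@interleave n)) /=; last by apply: onW_bij.
rewrite big_split_ord /=.
by congr (_ + _); apply: eq_bigr => a _; rewrite ?interleaveL ?interleaveR.
Qed.

Lemma eq_xy (a b : 'I_n) : ((xidx a == xidx b) = (a == b)) * ((yidx a == yidx b) = (a == b))
  * ((xidx a == yidx b) = false) * ((yidx a == xidx b) = false).
Proof.
rewrite (inj_eq (@xidx_inj n)) (inj_eq (@yidx_inj n)) (negPf (xy_neq a b)).
by rewrite [yidx a == _]eq_sym (negPf (xy_neq b a)).
Qed.
End Halves.

(** Rows and columns are reordered by the same permutation, so that no sign
    appears. *)
Lemma det_interleaved_block (K : comNzRingType) n (A : 'M[K]_(n * 2)) :
  \det A = \det (block_mx (\matrix_(a, b) A (xidx a) (xidx b)) (\matrix_(a, b) A (xidx a) (yidx b))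
                          (\matrix_(a, b) A (yidx a) (xidx b)) (\matrix_(a, b) A (yidx a) (yidx b))).
Proof.
rewrite -(det_reindex _ A (@interleave_inj n)); last by rewrite muln2 addnn.
congr (\det _); apply/matrixP => i j; rewrite !mxE.
case: split_ordP => a ->; rewrite !mxE; case: split_ordP => b ->;
  by rewrite !mxE ?interleaveL ?interleaveR.
Qed.

Section Conjugation.
Variable R : realType.
Implicit Types x y : R[i].
Lemma conjcM x y : conjc (x * y) = conjc x * conjc y. Proof. exact: rmorphM. Qed.
Lemma conjcD x y : conjc (x + y) = conjc x + conjc y. Proof. exact: rmorphD. Qed.
Lemma conjc_sum (I : Type) (r : seq I) (P : pred I) (F : I -> R[i]) :
  conjc (\sum_(i <- r | P i) F i) = \sum_(i <- r | P i) conjc (F i).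
Proof. exact: rmorph_sum. Qed.
Lemma conjci : conjc ('i%C : R[i]) = - 'i%C.
Proof. by apply/eqP; rewrite eq_complex /= oppr0 !eqxx. Qed.
Lemma sqri : ('i%C : R[i]) * 'i%C = -1.
Proof. by rewrite -expr2 sqr_i. Qed.
End Conjugation.

Section Forms.
Variables (R : realType) (n : nat).
Local Notation C := R[i].
Local Notation E := 'rV[R]_(n * 2).
Local Notation cform := (@cform R n).

Lemma form_wedgeE k l (a a' : cform k) (b b' : cform l) v :
  (forall u, a u = a' u) -> (forall u, b u = b' u) -> form_wedge a b v = form_wedge a' b' v.
Proof. by move=> /funext -> /funext ->. Qed.

Lemma form_wedge_sum k l (I J : finType) (a : I -> cform k) (b : J -> cform l) (c d : C) v :
  form_wedge (fun u => c * \sum_i a i u) (fun u => d * \sum_j b j u) v =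
  (c * d) * \sum_i \sum_j form_wedge (a i) (b j) v.
Proof.
rewrite /form_wedge.
transitivity ((k`! * l`!)%:R^-1 * \sum_(s : 'S_(k + l)) \sum_i \sum_j (c * d) * ((-1) ^+ odd_perm s *
      (a i (fun i => v (s (lshift l i))) * b j (fun j => v (s (rshift k j)))))).
  congr (_ * _); apply: eq_bigr => s _.
  rewrite mulrACA big_distrlr /= mulrCA mulr_sumr mulr_sumr; apply: eq_bigr => i _.
  by rewrite mulr_sumr mulr_sumr; apply: eq_bigr => j _.
rewrite exchange_big mulr_sumr mulr_sumr; apply: eq_bigr => i _ /=.
rewrite exchange_big mulr_sumr mulr_sumr; apply: eq_bigr => j _ /=.
by rewrite -mulr_sumr mulrCA.
Qed.

(** With the normalization of the wedge product by 1 / (k! l!), this is the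
    Laplace expansion along the first k rows. *)
Lemma wedge_det k l (A : 'I_k -> E -> C) (B : 'I_l -> E -> C) (v : 'I_(k + l) -> E) :
  form_wedge (fun u => \det (\matrix_(i, j) A i (u j)))
             (fun u => \det (\matrix_(i, j) B i (u j))) v =
  \det (\matrix_(i, j) (match fintype.split i with inl a => A a | inr b => B b end) (v j)).
Proof.
set W := \matrix_(i, j) _.
rewrite /form_wedge; under eq_bigr => s _.
  have -> : \matrix_(i, j) A i (v (s (lshift l j))) = \matrix_(i, j) W (lshift l i) (s (lshift l j)).
    apply/matrixP => i j; rewrite !mxE.
    by case: split_ordP => b /eqP; rewrite ?eq_lshift ?eq_lrshift// => /eqP ->.
  have -> : \matrix_(i, j) B i (v (s (rshift k j))) = \matrix_(i, j) W (rshift k i) (s (rshift k j)).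
    apply/matrixP => i j; rewrite !mxE.
    by case: split_ordP => b /eqP; rewrite ?eq_rshift ?eq_rlshift// => /eqP ->.
  over.
rewrite (@Laplace_expansion C k l W) mulrA mulVf ?mul1r//.
Qed.

Definition vec_mx2 (v : 'I_(n * 2) -> E) : 'M[R]_(n * 2) := \matrix_(i, k) v i 0 k.

(** The covectors dz^1, dzbar^1, ..., dz^n, dzbar^n. *)
Definition zrow (i : 'I_(n * 2)) (u : E) : C :=
  if odd i then conjc (zc (half i) u) else zc (half i) u.

Lemma zrow_x a u : zrow (xidx a) u = zc a u.
Proof. by rewrite /zrow odd_x half_x. Qed.
Lemma zrow_y a u : zrow (yidx a) u = conjc (zc a u).
Proof. by rewrite /zrow odd_y half_y. Qed.

Definition zmx : 'M[C]_(n * 2) := \matrix_(i, k) zrow i (evec R k).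

Lemma zc_evec (a b : 'I_n) : (zc a (evec R (xidx b)) = (a == b)%:R) *
  (zc a (evec R (yidx b)) = (a == b)%:R * 'i%C).
Proof.
rewrite /zc /evec !mxE /= !eq_xy; case: (a == b); split; rewrite ?mul1r ?mul0r//.
Qed.

Lemma zc_expand a (u : E) :
  zc a u = \sum_k zc a (evec R k) * real_complex R (u 0 k).
Proof.
rewrite sum_xy (bigD1 a)//= big1 => [|b ba]; last first.
  by rewrite zc_evec eq_sym (negPf ba) mul0r.
rewrite [X in _ + X](bigD1 a)//= big1 => [|b ba]; last first.
  by rewrite zc_evec eq_sym (negPf ba) !mul0r.
rewrite !zc_evec eqxx !mul1r !addr0; apply/eqP; rewrite eq_complex /=.
by rewrite !(mul0r, mulr0, mul1r, subr0, addr0, add0r) !eqxx.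
Qed.

Lemma zrow_expand i (u : E) :
  zrow i u = \sum_k zmx i k * real_complex R (u 0 k).
Proof.
rewrite {1}/zrow zc_expand conjc_sum.
case oi : (odd i); apply: eq_bigr => k _; rewrite mxE /zrow oi//.
by rewrite conjcM conjc_real.
Qed.

Lemma zmxE (a b : 'I_n) :
  (zmx (xidx a) (xidx b) = (a == b)%:R) * (zmx (xidx a) (yidx b) = (a == b)%:R * 'i%C) *
  (zmx (yidx a) (xidx b) = (a == b)%:R) * (zmx (yidx a) (yidx b) = - ((a == b)%:R * 'i%C)).
Proof.
rewrite /zmx !mxE !zrow_x !zrow_y !zc_evec.
by rewrite conjcM !conjc_nat conjci mulrN.
Qed.

(** Each of the n blocks (1, i; 1, -i) contributes - 2 i. *)
Lemma det_zmx : \det zmx = (- (2 * 'i%C)) ^+ n.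
Proof.
rewrite det_interleaved_block.
have -> : \matrix_(a, b) zmx (xidx a) (xidx b) = 1%:M.
  by apply/matrixP => a b; rewrite mxE zmxE mxE.
have -> : \matrix_(a, b) zmx (xidx a) (yidx b) = ('i%C)%:M.
  by apply/matrixP => a b; rewrite mxE zmxE mxE mulr_natl.
have -> : \matrix_(a, b) zmx (yidx a) (xidx b) = 1%:M.
  by apply/matrixP => a b; rewrite mxE zmxE mxE.
have -> : \matrix_(a, b) zmx (yidx a) (yidx b) = (- 'i%C)%:M.
  by apply/matrixP => a b; rewrite mxE zmxE mxE mulr_natl mulNrn.
have -> : block_mx (1%:M : 'M[C]_n) ('i%C)%:M 1%:M (- 'i%C)%:M
  = block_mx 1%:M 0 1%:M 1%:M *m block_mx (1%:M : 'M[C]_n) ('i%C)%:M 0 (- (2 * 'i%C))%:M.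
  rewrite mulmx_block !mul1mx !mul0mx !addr0; congr block_mx.
  rewrite -raddfD /=; congr (_%:M).
  by rewrite mulr2n mulrDl mul1r opprD addrA subrr add0r.
by rewrite det_mulmx det_lblock det_ublock !det1 !mul1r det_scalar.
Qed.

Lemma det_zrows (v : 'I_(n * 2) -> E) :
  \det (\matrix_(i, j) zrow i (v j)) = (- (2 * 'i%C)) ^+ n * real_complex R (\det (vec_mx2 v)).
Proof.
rewrite -det_zmx -[X in real_complex R X]det_tr -det_map_mx -det_mulmx; congr (\det _).
apply/matrixP => i j; rewrite !mxE zrow_expand; apply: eq_bigr => k _.
by rewrite !mxE.
Qed.
End Forms.

(** * Volume forms in a chart *)

Section VolumeForms.
Variables (R : realType) (n : nat).
Local Notation C := R[i].
Local Notation E := 'rV[R]_(n * 2).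

(** All powers of i combine to the exponent 4 C(n+1, 2). *)
Lemma normalizing_constant :
  ('i%C ^+ n / 2) ^+ n * ((-1) ^+ 'C(n, 2) * (- (2 * 'i%C)) ^+ n) = 1 :> C.
Proof.
have -> : (-1 : C) ^+ 'C(n, 2) = 'i%C ^+ (n * n.-1).
  rewrite -(sqr_i R) -exprM; congr (_ ^+ _).
  by rewrite bin2 mul2n halfK oddM; case: (n) => //= m; rewrite andNb subn0.
rewrite expr_div_n -exprM -[- (2 * _)]mulrN exprMn.
have -> : (- 'i%C : C) ^+ n = 'i%C ^+ (n * 3).
  rewrite mulnC exprM; congr (_ ^+ _).
  by rewrite exprS sqr_i mulrN1.
have two : (2 : C) ^+ n != 0 by rewrite expf_neq0// pnatr_eq0.
transitivity ('i%C ^+ (n * n + n * n.-1 + n * 3) : C).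
  by rewrite !exprD; field.
have -> : (n * n + n * n.-1 + n * 3 = 4 * 'C(n.+1, 2))%N.
  have E2 : ('C(n.+1, 2) * 2 = n.+1 * n)%N.
    by rewrite bin2 muln2 halfK oddM /= andNb subn0.
  by case: (n) E2 => [|m] /= E2; nia.
rewrite exprM; have -> : ('i%C : C) ^+ 4 = 1 by rewrite (exprM _ 2 2) sqr_i sqrrN expr1n.
by rewrite expr1n.
Qed.

(** The sign is the one of the shuffle from dz^1, ..., dz^n, dzbar^1, ..., dzbar^n
    to dz^1, dzbar^1, ..., dz^n, dzbar^n. *)
Lemma dz_top_wedge (F : C) (v : 'I_(n * 2) -> E) :
  form_cast (addn_mul2 n)
    (form_wedge (fun u => F * @dz_top R n u) (form_conj (fun u => F * @dz_top R n u))) v =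
  F * conjc F * ((-1) ^+ 'C(n, 2) * (- (2 * 'i%C)) ^+ n * real_complex R (\det (vec_mx2 v))).
Proof.
rewrite /form_cast -[X in _ = _ * X]mulrA -det_zrows.
set e := addn_mul2 n; set v' := fun i => _.
(* The sums over a single index have the shape of [form_wedge_sum]. *)
rewrite (@form_wedgeE _ _ _ _ _ (fun u => F * \sum_(i < 1) \det (\matrix_(i, j) zc i (u j)))
   _ (fun u => conjc F * \sum_(i < 1) \det (\matrix_(i, j) conjc (zc i (u j))))); last 2 first.
- by move=> u; rewrite big_ord1.
- move=> u; rewrite big_ord1 /form_conj conjcM /dz_top -det_map_mx; congr (_ * \det _).
  by apply/matrixP => i j; rewrite !mxE.
rewrite form_wedge_sum !big_ord1; congr (_ * _).
rewrite (wedge_det (fun i => zc i) (fun i u => conjc (zc i u))) -det_shuffle -det_mulmx.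
rewrite -(det_reindex e _ (@cast_ord_inj _ _ e)); congr (\det _).
apply/matrixP => i j; rewrite !mxE.
case: split_ordP => a ->.
  rewrite (bigD1 (xidx a))//= big1 => [|k ka]; last first.
    rewrite [shuffle_mx _ _ _ _]mxE /shuffle /= ltn_ord.
    case: eqP => [ke|]; last by rewrite mul0r.
    by case/eqP: ka; apply: val_inj.
  by rewrite !mxE /shuffle /= ltn_ord eqxx mul1r addr0 zrow_x.
rewrite (bigD1 (yidx a))//= big1 => [|k ka]; last first.
  rewrite [shuffle_mx _ _ _ _]mxE /shuffle /= ltnNge leq_addr /= addKn.
  case: eqP => [ke|]; last by rewrite mul0r.
  by case/eqP: ka; apply: val_inj.
by rewrite !mxE /shuffle /= ltnNge leq_addr /= addKn eqxx mul1r addr0 zrow_y.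
Qed.

Variable H : 'M[C]_n.

Definition eta (a : 'I_n) (u : E) : C := \sum_b H a b * conjc (zc b u).

(** The rows of the determinant that is the product of the two-forms
    dz^a /\ eta_a, for a in s. *)
Definition hrow m (s : m.-tuple 'I_n) (i : 'I_(m * 2)) (u : E) : C :=
  if odd i then eta (tnth s (half i)) u else zc (tnth s (half i)) u.

Lemma det_two_rows (f g : E -> C) (v : 'I_2 -> E) :
  \det (\matrix_(i < 2, j < 2) (if odd i then f else g) (v j)) =
  g (v ord0) * f (v ord_max) - g (v ord_max) * f (v ord0).
Proof.
rewrite (expand_det_row _ ord0) !big_ord_recl big_ord0 /cofactor !det_mx11 !mxE /= addr0.
rewrite expr0 expr1 mul1r mulN1r mulrN.
by congr (_ * f (v _) - g (v _) * f (v _)); exact: val_inj.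
Qed.

(** Omega = (i/2) sum_a dz^a /\ eta_a, each summand being a 2 x 2 determinant. *)
Lemma kahler_formE (v : 'I_2 -> E) :
  kahler_form H v = 'i%C / 2 * \sum_a \det (\matrix_(i < 2, j < 2)
     (if odd i then eta a else zc a) (v j)).
Proof.
rewrite /kahler_form; congr (_ * _); apply: eq_bigr => a _.
have W b : form_wedge (dz_form a) (form_conj (dz_form b)) v =
   \det (\matrix_(i < 2, j < 2) (if odd i then (fun u => conjc (zc b u)) else zc a) (v j)).
  rewrite (@form_wedgeE _ _ _ _ _ (fun u => \det (\matrix_(i < 1, j < 1) zc a (u j)))
     _ (fun u => \det (\matrix_(i < 1, j < 1) conjc (zc b (u j))))); last 2 first.
  - by move=> u; rewrite det_mx11 mxE.
  - by move=> u; rewrite det_mx11 mxE.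
  rewrite (wedge_det (fun i : 'I_1 => zc a) (fun (i : 'I_1) u => conjc (zc b u))).
  congr (\det _); apply/matrixP => i j; rewrite !mxE.
  by case: (split_ordP i) => c ->; rewrite (ord1 c).
under eq_bigr => b _ do rewrite W.
rewrite det_two_rows; under eq_bigr => b _ do rewrite det_two_rows.
rewrite /eta !mulr_sumr -sumrB; apply: eq_bigr => b _; ring.
Qed.

Lemma big_tuple_cons m (F : m.+1.-tuple 'I_n -> C) :
  \sum_s F s = \sum_a \sum_(s : m.-tuple 'I_n) F [tuple of a :: s].
Proof.
rewrite pair_big /= (reindex (fun p : 'I_n * m.-tuple 'I_n => [tuple of p.1 :: p.2]))//=.
exists (fun t => (thead t, [tuple of behead t])) => [[a s]|t] _ /=.
  by congr pair; apply: val_inj.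
by rewrite [RHS]tuple_eta.
Qed.

Lemma form_powE m (v : 'I_(m * 2) -> E) :
  form_pow (kahler_form H) m v = ('i%C / 2) ^+ m *
    \sum_(s : m.-tuple 'I_n) \det (\matrix_(i, j) hrow s i (v j)).
Proof.
elim: m v => [|m IH] v.
  rewrite expr0 mul1r (eq_bigr (fun=> 1)) => [|s _]; last by rewrite [LHS]det_mx00.
  by rewrite sumr_const card_tuple expn0.
rewrite [LHS](@form_wedgeE _ _ _ _ _ _ _ _ _ kahler_formE IH) form_wedge_sum -exprS.
congr (_ * _); rewrite big_tuple_cons; apply: eq_bigr => a _; apply: eq_bigr => s _.
rewrite (wedge_det (fun i : 'I_2 => if odd i then eta a else zc a) (hrow s)).
congr (\det _); apply/matrixP => i j; rewrite !mxE.
case: (split_ordP i) => b ->.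
  rewrite /hrow /=; have -> : half (lshift (m * 2) b : 'I_(m.+1 * 2)) = ord0.
    by apply: val_inj => /=; case: b => -[|[|]].
  by rewrite !(tnth_nth a) /=; case: (odd b).
rewrite /hrow /= !negbK; have -> : half (rshift 2 b : 'I_(m.+1 * 2)) = lift ord0 (half b).
  exact: val_inj.
by rewrite !(tnth_nth a) /=.
Qed.

(** The determinant is the sign of s if s is a permutation, and 0 otherwise. *)
Lemma sum_sqr_det :
  \sum_(s : n.-tuple 'I_n) (\det (\matrix_(k, j) (tnth s k == j)%:R : 'M[C]_n)) ^+ 2 = n`!%:R.
Proof.
rewrite (bigID (fun s : n.-tuple 'I_n => uniq s)) /= [X in _ + X]big1 ?addr0.
  rewrite (eq_bigr (fun=> 1)) => [|s us].
    rewrite sumr_const -[n in (n`!)%N]card_ord -(ffactnn #|'I_n|) -card_uniq_tuples.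
    congr (_%:R); rewrite [in RHS]card_ord; apply: eq_card => s; rewrite !inE.
    by rewrite unfold_in andbC; apply/esym/andb_idr => _; apply/allP.
  have ti : injective (tnth s) by apply/tuple_uniqP.
  have -> : \matrix_(k, j) (tnth s k == j)%:R = perm_mx (perm ti) :> 'M[C]_n.
    by apply/matrixP => k j; rewrite !mxE permE.
  by rewrite det_perm sqrr_sign.
move=> s; rewrite -(negbK (uniq s)) negbK => /tuple_uniqP ns.
have [i [j [ij tij]]] : exists i j, i != j /\ tnth s i = tnth s j.
  apply: contrapT => H0; apply: ns => i j tij; apply/eqP/negPn/negP => ij.
  by apply: H0; exists i, j.
rewrite (determinant_alternate (i1 := i) (i2 := j)) ?expr0n// => k.
by rewrite !mxE tij.
Qed.

(** In [form_powE] the permutations s all contribute equally, and the other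
    tuples do not contribute: reordering by s acts on the dz^a and on the eta_a,
    whence the square in [sum_sqr_det]. Replacing eta_a by dzbar^a costs
    det H. *)
Lemma form_pow_top (v : 'I_(n * 2) -> E) :
  (n`!)%:R^-1 * form_pow (kahler_form H) n v =
  \det H * real_complex R (\det (vec_mx2 v)).
Proof.
pose M : 'M[C]_(n * 2) := \matrix_(i, j) (if odd i then eta (half i) else zc (half i)) (v j).
have K (s : n.-tuple 'I_n) : \det (\matrix_(i, j) hrow s i (v j)) =
   (\det (\matrix_(k, j) (tnth s k == j)%:R : 'M[C]_n)) ^+ 2 * \det M.
  pose L : 'M[C]_(n * 2) := \matrix_(i, j) ((odd i == odd j) && (tnth s (half i) == half j))%:R.
  have -> : \matrix_(i, j) hrow s i (v j) = L *m M.
    apply/matrixP => i j; rewrite !mxE sum_xy.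
    under eq_bigr => a _ do rewrite !mxE odd_x half_x.
    under [X in _ = _ + X]eq_bigr => a _ do rewrite !mxE odd_y half_y.
    rewrite /hrow; case: (odd i) => /=.
      rewrite big1 ?add0r => [|a _]; last by rewrite mul0r.
      rewrite (bigD1 (tnth s (half i)))//= eqxx mul1r big1 ?addr0// => a.
      by rewrite eq_sym => /negPf ->; rewrite mul0r.
    rewrite [X in _ = _ + X]big1 ?addr0 => [|a _]; last by rewrite mul0r.
    rewrite (bigD1 (tnth s (half i)))//= eqxx mul1r big1 ?addr0// => a.
    by rewrite eq_sym => /negPf ->; rewrite mul0r.
  rewrite det_mulmx; congr (_ * _); rewrite det_interleaved_block.
  set P := \matrix_(k, j) (tnth s k == j)%:R.
  have -> : \matrix_(a, b) L (xidx a) (xidx b) = P.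
    by apply/matrixP => a b; rewrite !mxE !odd_x !half_x.
  have -> : \matrix_(a, b) L (xidx a) (yidx b) = 0.
    by apply/matrixP => a b; rewrite !mxE odd_x odd_y.
  have -> : \matrix_(a, b) L (yidx a) (yidx b) = P.
    by apply/matrixP => a b; rewrite !mxE !odd_y !half_y.
  by rewrite det_lblock expr2.
rewrite form_powE (eq_bigr _ (fun s _ => K s)) -mulr_suml sum_sqr_det.
pose L : 'M[C]_(n * 2) := \matrix_(i, j) (if odd i then (if odd j then H (half i) (half j) else 0)
  else (i == j)%:R).
have -> : M = L *m (\matrix_(i, j) zrow i (v j)).
  apply/matrixP => i j; rewrite !mxE sum_xy.
  under eq_bigr => a _ do rewrite !mxE odd_x zrow_x.
  under [X in _ = _ + X]eq_bigr => a _ do rewrite !mxE odd_y half_y zrow_y.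
  case oi : (odd i) => /=; first by rewrite big1 ?add0r// => a _; rewrite mul0r.
  have ei := xy_half i; rewrite oi in ei.
  have ix a : (i == xidx a) = (half i == a) by rewrite {1}ei eq_xy.
  have iy a : (i == yidx a) = false by rewrite ei eq_xy.
  rewrite (bigD1 (half i))//= ix eqxx mul1r big1 => [|a]; last first.
    by rewrite ix eq_sym => /negPf ->; rewrite mul0r.
  by rewrite big1 ?addr0// => a _; rewrite iy mul0r.
rewrite det_mulmx det_zrows.
have -> : \det L = \det H.
  rewrite det_interleaved_block.
  have -> : \matrix_(a, b) L (xidx a) (xidx b) = 1%:M.
    by apply/matrixP => a b; rewrite !mxE !odd_x eq_xy.
  have -> : \matrix_(a, b) L (yidx a) (xidx b) = 0.
    by apply/matrixP => a b; rewrite !mxE odd_x odd_y.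
  have -> : \matrix_(a, b) L (yidx a) (yidx b) = H.
    by apply/matrixP => a b; rewrite !mxE !odd_y !half_y.
  by rewrite det_ublock det1 mul1r.
have nf : (n`!)%:R != 0 :> C by rewrite pnatr_eq0 -lt0n fact_gt0.
have -> : ('i%C / 2) ^+ n * ((n`!)%:R * (\det H * ((- (2 * 'i%C)) ^+ n * real_complex R (\det (vec_mx2 v)))))
  = (n`!)%:R * (('i%C / 2 * (- (2 * 'i%C))) ^+ n * (\det H * real_complex R (\det (vec_mx2 v)))) :> C.
  rewrite [('i%C / 2 * _) ^+ n]exprMn.
  have regroup (a b c d e : C) : a * (c * (d * (b * e))) = c * ((a * b) * (d * e)) by ring.
  exact: regroup.
rewrite mulKf//.
have -> : 'i%C / 2 * (- (2 * 'i%C)) = 1 :> C.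
  by rewrite mulrN mulrA divfK ?pnatr_eq0// sqri opprK.
by rewrite expr1n mul1r.
Qed.

Lemma herm_metric_zrow (k l : 'I_(n * 2)) :
  herm_metric H (evec R k) (evec R l) = 2^-1 *
  \sum_a \sum_b H a b * (zmx R n (xidx a) k * zmx R n (yidx b) l
                       + zmx R n (yidx b) k * zmx R n (xidx a) l).
Proof.
rewrite /herm_metric mulr_sumr; apply: eq_bigr => a _; rewrite mulr_sumr.
by apply: eq_bigr => b _; rewrite !mxE !zrow_x !zrow_y mulrCA.
Qed.

(** In the basis dz, dzbar the metric has the blocks H and H^T off the diagonal
    and 0 on it. *)
Lemma det_herm_metric :
  \det (\matrix_(k, l) herm_metric H (evec R k) (evec R l)) = \det H ^+ 2.
Proof.
pose S : 'M[C]_(n * 2) := \matrix_(i, j) (if odd i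
  then (if odd j then 0 else H (half j) (half i))
  else (if odd j then H (half i) (half j) else 0)).
have -> : \matrix_(k, l) herm_metric H (evec R k) (evec R l) =
    2^-1 *: ((zmx R n)^T *m S *m zmx R n).
  apply/matrixP => k l; rewrite !mxE herm_metric_zrow; congr (_ * _).
  have Sx b : ((zmx R n)^T *m S) k (xidx b) = \sum_a zmx R n (yidx a) k * H b a.
    rewrite mxE sum_xy big1 ?add0r => [|a _]; last by rewrite !mxE !odd_x mulr0.
    by apply: eq_bigr => a _; rewrite [_^T _ _]mxE [S _ _]mxE odd_y odd_x half_x half_y.
  have Sy b : ((zmx R n)^T *m S) k (yidx b) = \sum_a zmx R n (xidx a) k * H a b.
    rewrite mxE sum_xy [X in _ + X]big1 ?addr0 => [|a _]; last by rewrite !mxE !odd_y mulr0.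
    by apply: eq_bigr => a _; rewrite [_^T _ _]mxE [S _ _]mxE odd_y odd_x half_x half_y.
  rewrite sum_xy; under [X in _ = X + _]eq_bigr => b _ do rewrite Sx mulr_suml.
  under [X in _ = _ + X]eq_bigr => b _ do rewrite Sy mulr_suml.
  rewrite [X in _ = _ + X]exchange_big -big_split; apply: eq_bigr => a _ /=.
  by rewrite -big_split; apply: eq_bigr => b _ /=; ring.
rewrite detZ !det_mulmx det_tr det_zmx.
have -> : \det S = (-1) ^+ n * \det H ^+ 2.
  rewrite det_interleaved_block.
  have -> : \matrix_(a, b) S (xidx a) (xidx b) = 0.
    by apply/matrixP => a b; rewrite !mxE !odd_x.
  have -> : \matrix_(a, b) S (yidx a) (yidx b) = 0.
    by apply/matrixP => a b; rewrite !mxE !odd_y.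
  have -> : \matrix_(a, b) S (xidx a) (yidx b) = H.
    by apply/matrixP => a b; rewrite !mxE odd_x odd_y half_x half_y.
  have -> : \matrix_(a, b) S (yidx a) (xidx b) = H^T.
    by apply/matrixP => a b; rewrite !mxE odd_x odd_y half_x half_y.
  have -> : block_mx 0 H H^T 0 = block_mx 0 1%:M 1%:M 0 *m block_mx H^T 0 0 H.
    by rewrite mulmx_block !mul1mx !mul0mx !addr0 !add0r.
  rewrite det_mulmx det_ublock det_tr expr2; congr (_ * _).
  have : block_mx 1%:M 0 (- 1%:M) 1%:M *m (block_mx 1%:M 1%:M 0 1%:M *m block_mx 0 1%:M 1%:M 0)
    = block_mx 1%:M 1%:M 0 (- 1%:M) :> 'M[C]_(n + n).
    by rewrite !(mulmx_block, mul1mx, mul0mx, mulmx1, mulmx0, addr0, add0r, mulNmx, addNr).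
  move=> /(congr1 determinant); rewrite !det_mulmx det_lblock !det_ublock !det1 !mul1r => ->.
  by rewrite -scaleN1r detZ det1 mulr1.
have E7 (a b d : C) : a * (b * (d * \det H ^+ 2) * b) = (a * (b * b) * d) * \det H ^+ 2 by ring.
rewrite E7 mulnC exprM -!exprMn.
have -> : 2^-1 ^+ 2 * (- (2 * 'i%C) * - (2 * 'i%C)) * -1 = 1 :> C.
  have E8 (h t i : C) : h ^+ 2 * (- (t * i) * - (t * i)) * -1 = - ((h * t) ^+ 2 * (i * i)) by ring.
  by rewrite E8 sqri mulVf ?pnatr_eq0// expr1n mul1r opprK.
by rewrite expr1n mul1r.
Qed.

Hypothesis Hherm : forall i j, H j i = conjc (H i j).
Hypothesis Hpos : forall u : E, u != 0 -> 0 < herm_metric H u u.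

Lemma herm_metric_real u v : conjc (herm_metric H u v) = herm_metric H u v.
Proof.
rewrite /herm_metric conjc_sum; under eq_bigr => i _ do rewrite conjc_sum.
rewrite exchange_big; apply: eq_bigr => i _; apply: eq_bigr => j _.
rewrite conjcM -Hherm; congr (_ * _).
rewrite conjcM conjcD !conjcM !conjcK [_ + zc i u * _]addrC; congr (_ * _).
by rewrite conjc_inv conjc_nat.
Qed.

Lemma real_metric_herm k l :
  real_complex R (real_metric H k l) = herm_metric H (evec R k) (evec R l).
Proof.
rewrite mxE; have := herm_metric_real (evec R k) (evec R l).
case: (herm_metric _ _ _) => a b /eqP; rewrite eq_complex /= => /andP[_ /eqP b0].
by have -> : b = 0 by lra.
Qed.

Lemma det_real_metric : real_complex R (\det (real_metric H)) = \det H ^+ 2.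
Proof.
rewrite -det_herm_metric -det_map_mx; congr (\det _).
by apply/matrixP => k l; rewrite mxE; apply: (etrans (real_metric_herm k l)); rewrite mxE.
Qed.

(** Diagonalize by a unitary matrix: each eigenvalue is the value of the
    metric on a (conjugated) eigenvector. *)
Lemma det_herm_gt0 : 0 < \det H.
Proof.
have Hh : H \is hermsymmx.
  apply/is_hermitianmxP; rewrite expr0 scale1r; apply/matrixP => i j.
  by rewrite !mxE; exact: Hherm.
have /orthomx_spectralP HE := hermitian_normalmx Hh.
set P := spectralmx H in HE; set D := spectral_diag H in HE.
have Pu : P \is unitarymx by exact: spectral_unitarymx.
have PP : P *m (P^T ^ Num.conj)%sesqui = 1%:M by apply/unitarymxP.
have Pi : P \in unitmx by exact: spectral_unit.
have PD : P *m H *m (P^T ^ Num.conj)%sesqui = diag_mx D.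
  by rewrite HE !mulmxA mulmxV// mul1mx -mulmxA PP mulmx1.
have -> : \det H = \prod_k D 0 k.
  by rewrite HE !det_mulmx det_diag mulrAC -det_mulmx mulVmx// det1 mul1r.
apply: prodr_gt0 => k _.
pose u : E := \row_l (if odd l then complex.Im (P k (half l)) else complex.Re (P k (half l))).
have zu i : zc i u = P k i.
  by rewrite /zc !mxE odd_x odd_y half_x half_y; case: (P k i).
have -> : D 0 k = herm_metric H u u.
  have -> : D 0 k = (P *m H *m (P^T ^ Num.conj)%sesqui) k k by rewrite PD mxE eqxx mulr1n.
  rewrite mxE /herm_metric exchange_big; apply: eq_bigr => j _.
  have Pt : (P^T ^ Num.conj)%sesqui j k = conjc (P k j) by rewrite !mxE.
  rewrite mxE mulr_suml; apply: eq_bigr => i _; rewrite !zu Pt.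
  have E9 (h p q : C) : p * h * q = h * (2^-1 * (p * q + q * p)).
    have -> : 2^-1 * (p * q + q * p) = p * q.
      by field.
    by ring.
  exact: E9.
apply: Hpos; apply/eqP => u0.
have : (P *m (P^T ^ Num.conj)%sesqui) k k = 0.
  rewrite mxE big1// => i _; rewrite -zu u0.
  by rewrite (_ : zc i 0 = 0) ?mul0r// /zc !mxE.
by rewrite PP mxE eqxx => /eqP; rewrite oner_eq0.
Qed.

Lemma sqrt_det_real_metric : real_complex R (Num.sqrt (\det (real_metric H))) = \det H.
Proof.
have H0 := det_herm_gt0; have := det_real_metric.
have [r Hr] : exists r, \det H = real_complex R r.
  by apply/complex_realP; rewrite realE (ltW H0).
rewrite Hr -rmorphXn => /complexI ->; rewrite sqrtr_sqr ger0_norm//.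
by rewrite -ler0c -Hr ltW.
Qed.

Lemma det_real_metric_gt0 : 0 < \det (real_metric H).
Proof. by rewrite -(ltcR 0) det_real_metric exprn_gt0// det_herm_gt0. Qed.

End VolumeForms.

(** * Derivatives of determinants *)

Section Derivations.
Variables (R : realType) (V : normedModType R).

Lemma derive_cstM (c : R) (f : V -> R) x v : derivable f x v ->
  'D_v (fun y => c * f y) x = c * 'D_v f x.
Proof. by move=> fd; exact: (@deriveZ _ _ _ f c x v fd). Qed.

Lemma derive_add (f g : V -> R) x v : derivable f x v -> derivable g x v ->
  'D_v (fun y => f y + g y) x = 'D_v f x + 'D_v g x.
Proof. by move=> fd gd; exact: (@deriveD _ _ _ f g x v fd gd). Qed.

Lemma derive_bigsum m (f : 'I_m -> V -> R) x v : (forall i, derivable (f i) x v) ->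
  'D_v (fun y => \sum_i f i y) x = \sum_i 'D_v (f i) x.
Proof.
move=> fd; rewrite -derive_sum//; congr ('D_v _ x).
by apply/funext => y; rewrite fct_sumE.
Qed.

Lemma is_derive_prod (I : eqType) (r : seq I) (F : I -> V -> R) (dF : I -> R) x v :
  uniq r -> (forall i, is_derive x v (F i) (dF i)) ->
  is_derive x v (fun y => \prod_(i <- r) F i y)
    (\sum_(i <- r) dF i * \prod_(j <- r | j != i) F j x).
Proof.
move=> + HF; elim: r => [_|a r IH /= /andP[ar ur]].
  under eq_fun do rewrite big_nil; rewrite big_nil; exact: is_derive_cst.
have -> : (fun y => \prod_(i <- a :: r) F i y) = F a * (fun y => \prod_(i <- r) F i y).
  by apply/funext => y; rewrite big_cons.
have K := is_deriveM (HF a) (IH ur); apply: is_derive_eq K _.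
rewrite big_cons addrC big_cons eqxx /=; congr (_ + _).
  rewrite [LHS]mulrC; congr (_ * _); rewrite [RHS]big_seq_cond [LHS]big_seq.
  by apply: eq_bigl => i; case ir : (i \in r) => //=; apply/esym; apply: contraNneq ar => <-.
rewrite [LHS]mulr_sumr [LHS]big_seq [RHS]big_seq; apply: eq_bigr => i ir.
rewrite big_cons ifT; last by apply: contraNneq ar => ->.
by rewrite mulrCA.
Qed.

(** Jacobi's formula for the derivative of a determinant. *)
Lemma is_derive_det m (A : V -> 'M[R]_m) (dA : 'M[R]_m) x v :
  (forall i j, is_derive x v (fun y => A y i j) (dA i j)) ->
  is_derive x v (fun y => \det (A y)) (\sum_i \sum_j dA i j * cofactor (A x) i j).
Proof.
move=> HA.
pose B (i : 'I_m) : 'M[R]_m := \matrix_(k, j) (if k == i then dA k j else A x k j).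
have -> : \sum_i \sum_j dA i j * cofactor (A x) i j = \sum_i \det (B i).
  apply: eq_bigr => i _; rewrite (expand_det_row _ i); apply: eq_bigr => j _.
  rewrite mxE eqxx; congr (_ * (_ * \det _)); apply/matrixP => k l; rewrite !mxE.
  by rewrite eq_sym (negPf (neq_lift _ _)).
have H (s : 'S_m) : is_derive x v (fun y => (-1) ^+ s * \prod_i A y i (s i))
    ((-1) ^+ s * \sum_i dA i (s i) * \prod_(j | j != i) A x j (s j)).
  have := is_derive_prod (index_enum_uniq _) (fun i => HA i (s i)).
  by move=> /(@is_deriveZ _ _ _ _ ((-1) ^+ s)).
have -> : (fun y => \det (A y)) = \sum_(s : 'S_m) (fun y => (-1) ^+ s * \prod_i A y i (s i)).
  by apply/funext => y; rewrite fct_sumE.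
have -> : \sum_i \det (B i) = \sum_(s : 'S_m) ((-1) ^+ s * \sum_i dA i (s i) * \prod_(j | j != i) A x j (s j)).
  rewrite exchange_big; apply: eq_bigr => s _; rewrite mulr_sumr; apply: eq_bigr => i _.
  congr (_ * _); rewrite (bigD1 i)//= mxE eqxx; congr (_ * _).
  by apply: eq_bigr => j /negPf ji; rewrite mxE ji.
elim/big_ind2 : _ => //; first exact: is_derive_cst.
by move=> f1 d1 f2 d2; exact: is_deriveD.
Qed.
End Derivations.

(** * The complex structure in real coordinates *)

Section ComplexStructure.
Variables (R : realType) (n : nat).
Local Notation C := R[i].
Local Notation E := 'rV[R]_(n * 2).

(** The complex structure J maps e_k to Jsign k *: e_(Jidx k). *)
Definition Jidx (k : 'I_(n * 2)) : 'I_(n * 2) := if odd k then xidx (half k) else yidx (half k).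
Definition Jsign (k : 'I_(n * 2)) : R := if odd k then -1 else 1.

Lemma odd_J k : odd (Jidx k) = ~~ odd k.
Proof. by rewrite /Jidx; case: (odd k); rewrite ?odd_x ?odd_y. Qed.
Lemma half_J k : half (Jidx k) = half k.
Proof. by rewrite /Jidx; case: (odd k); rewrite ?half_x ?half_y. Qed.
Lemma JidxK : involutive Jidx.
Proof. by move=> k; rewrite {1}/Jidx odd_J half_J [RHS]xy_half; case: (odd k). Qed.
Lemma Jsign_J k : Jsign (Jidx k) = - Jsign k.
Proof. by rewrite /Jsign odd_J; case: (odd k); rewrite /= ?opprK. Qed.
Lemma Jsign_sq k : Jsign k * Jsign k = 1.
Proof. by rewrite /Jsign; case: (odd k); rewrite ?mulr1// mulrNN mulr1. Qed.

Lemma sum_J (F : 'I_(n * 2) -> R) : \sum_k F k = \sum_k F (Jidx k).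
Proof. exact: (reindex_inj (inv_inj JidxK)). Qed.

Lemma zc_J a k : real_complex R (Jsign k) * zc a (evec R (Jidx k)) = 'i%C * zc a (evec R k).
Proof.
rewrite /Jsign /Jidx; have := xy_half k; case: (odd k) => ->; rewrite ?half_x ?half_y !zc_evec.
  rewrite mulrCA sqri mulrN1 -[RHS]mulN1r; congr (_ * _).
  by rewrite rmorphN rmorph1.
by rewrite rmorph1 mul1r mulrC.
Qed.

Section Pointwise.
Variable H : 'M[C]_n.
Let G := real_metric H.

Lemma real_metricC k l : G k l = G l k.
Proof.
rewrite !mxE /herm_metric; congr complex.Re.
apply: eq_bigr => i _; apply: eq_bigr => j _.
by rewrite [X in _ * (_ * X)]addrC mulrC [in RHS]mulrC; congr (_ * _ * _); congr (_ + _); rewrite mulrC.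
Qed.

Lemma herm_metric_J k l :
  real_complex R (Jsign k * Jsign l) * herm_metric H (evec R (Jidx k)) (evec R (Jidx l)) =
  herm_metric H (evec R k) (evec R l).
Proof.
have cJ b m : real_complex R (Jsign m) * conjc (zc b (evec R (Jidx m))) = - 'i%C * conjc (zc b (evec R m)).
  by rewrite -conjc_real -conjcM zc_J conjcM conjci.
rewrite /herm_metric mulr_sumr; apply: eq_bigr => a _; rewrite mulr_sumr.
apply: eq_bigr => b _; rewrite rmorphM.
set s := real_complex R (Jsign k); set t := real_complex R (Jsign l).
set zk := zc a _; set zl' := conjc (zc b _); set zk' := conjc (zc b _); set zl := zc a _.
have -> : s * t * (H a b * (2^-1 * (zk * zl' + zk' * zl))) =
  H a b * (2^-1 * ((s * zk) * (t * zl') + (s * zk') * (t * zl))) by ring.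
rewrite /s /t /zk /zl' /zk' /zl !zc_J !cJ; congr (_ * (_ * _)).
have Ei (p q r w i : C) : i * p * (- i * q) + - i * r * (i * w) = - (i * i) * (p * q + r * w) by ring.
by rewrite Ei sqri opprK mul1r.
Qed.

Lemma Re_realM (c : R) (z : C) : complex.Re (real_complex R c * z) = c * complex.Re z.
Proof. by case: z => a b /=; rewrite mul0r subr0. Qed.

Lemma real_metric_J k l : Jsign k * Jsign l * G (Jidx k) (Jidx l) = G k l.
Proof. by rewrite !mxE -Re_realM herm_metric_J. Qed.

(** Omega(X, Y) = G(JX, Y). *)
Lemma kahler_form_evec k l (v : 'I_2 -> E) : v ord0 = evec R k -> v ord_max = evec R l ->
  complex.Re (kahler_form H v) = Jsign k * G (Jidx k) l.
Proof.
move=> v0 v1; rewrite mxE -Re_realM; congr complex.Re.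
rewrite kahler_formE /herm_metric mulr_sumr mulr_sumr; apply: eq_bigr => a _.
rewrite det_two_rows v1 v0 /eta !mulr_sumr -sumrB !mulr_sumr; apply: eq_bigr => b _.
have cJ : real_complex R (Jsign k) * conjc (zc b (evec R (Jidx k))) = - 'i%C * conjc (zc b (evec R k)).
  by rewrite -conjc_real -conjcM zc_J conjcM conjci.
set s := real_complex R (Jsign k).
have -> (p q r w : C) : s * (H a b * (2^-1 * (p * q + r * w))) =
   H a b * (2^-1 * ((s * p) * q + (s * r) * w)) by ring.
rewrite /s zc_J cJ; ring.
Qed.
End Pointwise.
End ComplexStructure.

(** * Ricci curvature of a Kahler metric *)

Lemma smooth_Re_linear (R : realType) (n : nat) (U : set 'rV[R]_(n * 2))
    (F : 'rV[R]_(n * 2) -> R[i]) (c : R[i]) : open U -> csmooth_on U F ->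
  smooth_on U (fun x => complex.Re (F x * c)).
Proof.
move=> oU [sr si].
have S1 := smoothM oU sr (smooth_cst (complex.Re c)).
have S2 := smoothM oU si (smooth_cst (complex.Im c)).
apply: (smooth_eq oU _ (smoothB oU S1 S2)) => x _.
by case: (F x) => a b; case: c {S1 S2} => p q.
Qed.

Lemma alternating_sum3 (K : pzRingType) (F : 'I_3 -> K) :
  \sum_(i < 3) (-1) ^+ i * F i = F ord0 - F (lift ord0 ord0) + F ord_max.
Proof.
rewrite !big_ord_recl big_ord0 addr0.
rewrite (_ : lift ord0 (lift ord0 ord0) = ord_max); last exact: val_inj.
have -> : (-1) ^+ (@ord0 2) = 1 :> K by exact: expr0.
have -> : (-1) ^+ (lift ord0 ord0 : 'I_3) = -1 :> K by exact: expr1.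
have -> : (-1) ^+ (@ord_max 2) = 1 :> K by rewrite [LHS]sqrrN expr1n.
by rewrite !mul1r mulN1r addrA.
Qed.

(** With g k i j the e_k-component of g(e_i, e_j), the hypothesis gJ says that
    g(X, JY) = J g(X, Y). By symmetry g is complex bilinear, so that g(JX, JY)
    and the trace of Z |-> g(g(X, Z), Y) are odd under (X, Y) |-> (JX, JY). *)
Section ComplexBilinear.
Variables (R : realType) (n : nat) (g : 'I_(n * 2) -> 'I_(n * 2) -> 'I_(n * 2) -> R).
Local Notation J := Jidx.
Local Notation js := (Jsign R).
Hypothesis gC : forall k i j, g k i j = g k j i.
Hypothesis gJ : forall k i j, js j * g k i (J j) = - (js k * g (J k) i j).

Lemma bilinear_JJ k i j : js i * js j * g k (J i) (J j) = - g k i j.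
Proof.
have -> : js i * js j * g k (J i) (J j) = js i * (js j * g k (J i) (J j)) by ring.
rewrite gJ [g (J k) _ _]gC.
have -> : js i * - (js k * g (J k) j (J i)) = - (js k * (js i * g (J k) j (J i))) by ring.
rewrite gJ JidxK Jsign_J gC.
have := Jsign_sq R k; set s := js k => ss.
have -> : - (s * - (- s * g k i j)) = - ((s * s) * g k i j) by ring.
by rewrite ss mul1r.
Qed.

Lemma bilinear_contract_J j k :
  js j * js k * (\sum_i \sum_m g m i (J k) * g i (J j) m) = - \sum_i \sum_m g m i k * g i j m.
Proof.
rewrite mulr_sumr -sumrN; apply: eq_bigr => i _; rewrite mulr_sumr -sumrN [LHS]sum_J.
apply: eq_bigr => m _.
have -> : js j * js k * (g (J m) i (J k) * g i (J j) (J m)) =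
   (js k * g (J m) i (J k)) * (js j * g i (J m) (J j)).
  by rewrite [g i (J m) _]gC; ring.
rewrite !gJ JidxK Jsign_J [g (J i) _ _]gC.
have -> : - (- js m * g m i k) * - (js i * g (J i) j (J m)) =
  - (g m i k * js i * (js m * g (J i) j (J m))) by ring.
rewrite gJ JidxK Jsign_J.
have := Jsign_sq R i; set s := js i => ss.
have -> : - (g m i k * s * - (- s * g i j m)) = - ((s * s) * (g m i k * g i j m)) by ring.
by rewrite ss mul1r.
Qed.
End ComplexBilinear.

Section KahlerChart.
Variables (R : realType) (n : nat).
Local Notation C := R[i].
Local Notation E := 'rV[R]_(n * 2).
Local Notation J := Jidx.
Local Notation js := (Jsign R).
Variables (U : set E) (Hm : E -> 'M[C]_n).
Hypothesis oU : open U.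
Hypothesis Hsmooth : forall i j, csmooth_on U (fun x => Hm x i j).
Hypothesis Hherm : forall x, U x -> forall i j, Hm x j i = conjc (Hm x i j).
Hypothesis Hpos : forall x, U x -> forall u : E, u != 0 -> 0 < herm_metric (Hm x) u u.
Hypothesis Hclosed : forall x, U x -> forall v, ext_deriv (fun y => kahler_form (Hm y)) x v = 0.

Local Notation G := (fun y => real_metric (Hm y)).
Local Notation Gam := (christoffel G).

Lemma metric_smooth k l : smooth_on U (fun y => G y k l).
Proof.
pose c a b : C := 2^-1 * (zc a (evec R k) * conjc (zc b (evec R l)) + conjc (zc b (evec R k)) * zc a (evec R l)).
have S : smooth_on U (fun x => \sum_a \sum_b complex.Re (Hm x a b * c a b)).
  apply: (@smooth_sum R n U 'I_n _ _ _ oU) => a; apply: (@smooth_sum R n U 'I_n _ _ _ oU) => b.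
  exact: smooth_Re_linear.
apply: (smooth_eq oU _ S) => x _; rewrite mxE /herm_metric.
rewrite (raddf_sum (@complex.Re R : Rcomplex R -> R)); apply: eq_bigr => a _.
by rewrite (raddf_sum (@complex.Re R : Rcomplex R -> R)).
Qed.

Lemma det_metric_gt0 x : U x -> 0 < \det (G x).
Proof. by move=> Ux; apply: det_real_metric_gt0; [exact: Hherm|exact: Hpos]. Qed.

Lemma metric_unit x : U x -> G x \in unitmx.
Proof. by move=> /det_metric_gt0 /lt0r_neq0; rewrite unitmxE unitfE. Qed.

Lemma metricC x k l : G x k l = G x l k.
Proof. exact: real_metricC. Qed.

Lemma metricT x : (G x)^T = G x.
Proof. by apply/matrixP => k l; rewrite mxE metricC. Qed.

Lemma inverse_metric_smooth k l : smooth_on U (fun y => invmx (G y) k l).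
Proof.
have dn0 x : U x -> \det (G x) != 0 by move=> /det_metric_gt0 /lt0r_neq0.
have sd := smooth_det oU metric_smooth.
have sc : smooth_on U (fun y => cofactor (G y) l k).
  rewrite /cofactor; apply: (smoothM oU (smooth_cst _)); apply: (smooth_det oU) => i j.
  by apply: (smooth_eq oU _ (metric_smooth (lift l i) (lift k j))) => x _; rewrite !mxE.
apply: (smooth_eq oU _ (smoothM oU (smoothV oU dn0 sd) sc)) => x Ux.
by rewrite /invmx metric_unit// !mxE.
Qed.

Definition dG i j k (x : E) : R := 'D_(evec R i) (fun y => G y j k) x.

Lemma christoffel_smooth k i j : smooth_on U (Gam k i j).
Proof.
apply: (smoothM oU (smooth_cst _)); apply: (@smooth_sum R n U _ _ _ _ oU) => l.
apply: (smoothM oU (inverse_metric_smooth k l)).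
apply: (smoothB oU); last exact: (smooth_derive l (metric_smooth i j)).
exact: (smoothD oU (smooth_derive i (metric_smooth j l)) (smooth_derive j (metric_smooth i l))).
Qed.

Section AtPoint.
Variable x : E.
Hypothesis Ux : U x.

Lemma dGC i j k : dG i j k x = dG i k j x.
Proof. by congr ('D_ _ _ x); apply/funext => y; exact: metricC. Qed.

Lemma dG_JJ i j k : js j * js k * dG i (J j) (J k) x = dG i j k x.
Proof.
rewrite -derive_cstM; last exact: smooth_derivable i (metric_smooth _ _) Ux.
by congr ('D_ _ _ x); apply/funext => y; exact: real_metric_J.
Qed.

(** The derivative of G(X, JY) = - G(JX, Y). *)
Lemma dG_skew i j k : js k * dG i j (J k) x = - (js j * dG i (J j) k x).
Proof.
rewrite -[dG i (J j) k x]dG_JJ JidxK Jsign_J.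
have := Jsign_sq R j; set s := js j; set t := js k; set d := dG _ _ _ _ => ss.
have -> : - (s * (- s * t * d)) = (s * s) * (t * d) by ring.
by rewrite ss mul1r.
Qed.

(** d Omega = 0, evaluated on e_i, e_j, e_k. *)
Lemma kahler_closed i j k :
  js j * dG i (J j) k x - js i * dG j (J i) k x + js i * dG k (J i) j x = 0.
Proof.
pose v : 'I_3 -> E := fun m => nth 0 [:: evec R i; evec R j; evec R k] m.
have K (p q r : 'I_(n * 2)) (w : 'I_2 -> E) : w ord0 = evec R q -> w ord_max = evec R r ->
   complex.Re (cderive (evec R p) (fun y => kahler_form (Hm y) w) x) = js q * dG p (J q) r x.
  move=> w0 w1; rewrite -derive_cstM; last exact: smooth_derivable p (metric_smooth _ _) Ux.
  rewrite /cderive [LHS]/=.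
  rewrite (_ : (fun y => complex.Re (kahler_form (Hm y) w)) = (fun y => js q * G y (J q) r))//.
  by apply/funext => y; exact: kahler_form_evec.
have := Hclosed Ux v; rewrite /ext_deriv (alternating_sum3
  (fun m => cderive (v m) (fun y => kahler_form (Hm y) (fun p => v (lift m p))) x)).
move=> /(congr1 (@complex.Re R)).
rewrite (raddfD (@complex.Re R : Rcomplex R -> R)) (raddfB (@complex.Re R : Rcomplex R -> R)).
rewrite -(K i j k (fun p => v (lift ord0 p)) erefl erefl).
rewrite -(K j i k (fun p => v (lift (lift ord0 ord0) p)) erefl erefl).
rewrite -(K k i j (fun p => v (lift ord_max p)) erefl erefl).
exact.
Qed.

Lemma lower_christoffel m i j :
  \sum_k G x m k * Gam k i j x = 2^-1 * (dG i j m x + dG j i m x - dG m i j x).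
Proof.
rewrite /christoffel.
have -> : \sum_k G x m k * (2^-1 * \sum_l invmx (G x) k l * (dG i j l x + dG j i l x - dG l i j x))
  = 2^-1 * \sum_l (G x *m invmx (G x)) m l * (dG i j l x + dG j i l x - dG l i j x).
  rewrite !mulr_sumr.
  under [RHS]eq_bigr => l _ do rewrite mxE mulr_suml mulr_sumr.
  rewrite exchange_big; apply: eq_bigr => k _; rewrite !mulr_sumr; apply: eq_bigr => l _.
  by rewrite mulrCA; congr (_ * _); exact: mulrA.
congr (_ * _); rewrite mulmxV ?metric_unit// (bigD1 m)//= big1 ?addr0 => [|l lm].
  by rewrite mxE eqxx mul1r.
by rewrite mxE eq_sym (negPf lm) mul0r.
Qed.

Lemma christoffelC k i j : Gam k i j x = Gam k j i x.
Proof.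
rewrite /christoffel; congr (_ * _); apply: eq_bigr => l _; congr (_ * _).
by rewrite [X in _ - X]dGC [X in X - _]addrC.
Qed.

(** The complex structure is parallel. Once the upper index is lowered, this
    combines the closedness equations on (X, Y, Z) and on (X, JY, JZ). *)
Lemma christoffel_J k i j : js j * Gam k i (J j) x = - (js k * Gam (J k) i j x).
Proof.
pose X : 'cV[R]_(n * 2) := \col_k (js k * Gam (J k) i j x + js j * Gam k i (J j) x).
suff X0 : X = 0.
  have /matrixP/(_ k 0) := X0; rewrite !mxE => /eqP; rewrite addrC addr_eq0 => /eqP //.
suff GX : G x *m X = 0.
  by rewrite -[X](mulKmx (metric_unit Ux)) GX mulmx0.
apply/matrixP => m z; rewrite !mxE.
have -> : \sum_k G x m k * X k z =
   js m * (\sum_k G x (J m) k * Gam k i j x) + js j * (\sum_k G x m k * Gam k i (J j) x).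
  under eq_bigr => l _ do rewrite [X _ _]mxE mulrDr.
  rewrite big_split /=; congr (_ + _); last first.
    by rewrite mulr_sumr; apply: eq_bigr => l _; rewrite mulrCA.
  rewrite sum_J mulr_sumr; apply: eq_bigr => l _; rewrite JidxK Jsign_J.
  rewrite -[G x (J m) l]real_metric_J JidxK Jsign_J.
  have E (s t a b : R) : s * s = 1 -> a * (- t * b) = s * ((- s * t * a) * b).
    by move=> ss; transitivity (- (s * s) * (t * a * b)); [rewrite ss|]; ring.
  exact: E (Jsign_sq R m).
rewrite !lower_christoffel.
have := kahler_closed i j m; have := kahler_closed i (J j) (J m).
rewrite !JidxK !Jsign_J => K2 K1.
have {}K2 : - (js m * dG i j (J m) x) - js j * dG (J j) i m x + js m * dG (J m) i j x = 0.
  rewrite -[dG (J j) i m x]dG_JJ -[dG (J m) i j x]dG_JJ.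
  transitivity (js j * js m * (- js j * dG i j (J m) x - js i * dG (J j) (J i) (J m) x
      + js i * dG (J m) (J i) (J j) x)); last by rewrite K2 mulr0.
  have := Jsign_sq R j; set s := js j; set t := js m => ss; have := Jsign_sq R m; rewrite -/t => tt.
  set d1 := dG _ _ _ _; set d2 := dG _ _ _ _; set d3 := dG _ _ _ _.
  have -> : s * t * (- s * d1 - js i * d2 + js i * d3) =
    - ((s * s) * (t * d1)) - s * (js i * t * d2) + t * (js i * s * d3) by ring.
  by rewrite ss mul1r.
have E1 := dG_skew i j m; have E2 := dG_skew j m i; have E3 := dG_skew m j i.
rewrite [dG j m (J i) x]dGC in E2; rewrite [dG j (J m) i x]dGC in E2.
rewrite [dG m j (J i) x]dGC in E3; rewrite [dG m (J j) i x]dGC in E3.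
rewrite E2 in K1; rewrite E3 in K1.
move: K1 K2 E1.
set a1 := js j * dG i (J j) m x; set a2 := js m * dG j i (J m) x; set a3 := js j * dG m i (J j) x.
set a4 := js m * dG i j (J m) x; set a5 := js j * dG (J j) i m x; set a6 := js m * dG (J m) i j x => K1 K2 E1.
transitivity (2^-1 * (a4 + a2 - a6 + a1 + a5 - a3)); last by lra.
rewrite /a1 /a2 /a3 /a4 /a5 /a6; ring.
Qed.

Lemma christoffel_JJ k i j : js i * js j * Gam k (J i) (J j) x = - Gam k i j x.
Proof. exact: (bilinear_JJ (g := fun k i j => Gam k i j x) christoffelC christoffel_J). Qed.

(** The logarithm of det H, in real terms. *)
Definition log_density (y : E) : R := 2^-1 * ln (\det (G y)).

(** Jacobi's formula; the terms that are not of the form d_k G cancel, by the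
    symmetry of the metric. *)
Lemma trace_christoffel k : \sum_i Gam i i k x = 'D_(evec R k) log_density x.
Proof.
have dd : derivable (fun y => \det (G y)) x (evec R k).
  exact: smooth_derivable k (smooth_det oU metric_smooth) Ux.
have dl : is_derive (\det (G x)) (1 : R) (@ln R) (\det (G x))^-1 by exact: is_derive1_ln (det_metric_gt0 Ux).
have sl : smooth_on U (fun y => ln (\det (G y))).
  exact: (smooth_ln oU det_metric_gt0 (smooth_det oU metric_smooth)).
rewrite /log_density derive_cstM; last exact: smooth_derivable k sl Ux.
rewrite (derive_comp_real dd dl).
have [_ ->] := @is_derive_det R _ _ G (\matrix_(i, j) dG k i j x) x (evec R k)
  (fun i j => ltac:(rewrite mxE; apply: derivableP; exact: smooth_derivable k (metric_smooth i j) Ux)).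
rewrite /christoffel -mulr_sumr; congr (_ * _).
have IT i l : invmx (G x) i l = invmx (G x) l i.
  by rewrite -[in LHS](metricT x) -trmx_inv mxE.
transitivity (\sum_i \sum_l invmx (G x) i l * dG k i l x); last first.
  rewrite mulr_sumr exchange_big; apply: eq_bigr => l _; rewrite mulr_sumr; apply: eq_bigr => i _.
  have -> : invmx (G x) i l = (\det (G x))^-1 * cofactor (G x) l i.
    by rewrite /invmx metric_unit// !mxE.
  by rewrite [dG k i l x]dGC mxE -mulrA [cofactor _ _ _ * _]mulrC.
transitivity (\sum_i \sum_l invmx (G x) i l * dG k i l x +
   (\sum_i \sum_l invmx (G x) i l * dG i k l x - \sum_i \sum_l invmx (G x) i l * dG l i k x)).
  rewrite -sumrB -big_split; apply: eq_bigr => i _ /=.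
  by rewrite -sumrB -big_split; apply: eq_bigr => l _ /=; rewrite -/(dG _ _ _ _) -/(dG _ _ _ _) -/(dG _ _ _ _); ring.
rewrite [X in _ - X]exchange_big [X in _ + X](_ : _ = 0) ?addr0//.
rewrite -sumrB big1// => i _; rewrite -sumrB big1// => l _.
by rewrite IT dGC subrr.
Qed.
End AtPoint.

Lemma log_density_smooth : smooth_on U log_density.
Proof.
apply: (smoothM oU (smooth_cst _)).
exact: (smooth_ln oU det_metric_gt0 (smooth_det oU metric_smooth)).
Qed.

(** The J-invariant part of the Ricci tensor: in Ric(X, Y) + Ric(JX, JY) all
    the terms containing Christoffel symbols cancel, because these are complex
    bilinear, and only second derivatives of the density remain. *)
Lemma ricci_J_average x j k : U x ->
  ricci G j k x + js j * js k * ricci G (J j) (J k) x =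
  - ('D_(evec R j) ('D_(evec R k) log_density) x
     + js j * js k * 'D_(evec R (J j)) ('D_(evec R (J k)) log_density) x).
Proof.
move=> Ux.
pose T1 p q := \sum_i 'D_(evec R i) (Gam i p q) x.
pose T3 p q := \sum_i \sum_m Gam m p q x * Gam i i m x.
pose T4 p q := \sum_i \sum_m Gam m i q x * Gam i p m x.
have split_ricci p q : ricci G p q x =
    T1 p q - 'D_(evec R p) ('D_(evec R q) log_density) x + T3 p q - T4 p q.
  rewrite /ricci /curvature.
  have -> : 'D_(evec R p) ('D_(evec R q) log_density) x = \sum_i 'D_(evec R p) (Gam i i q) x.
    rewrite -derive_bigsum; last by move=> i; exact: smooth_derivable p (christoffel_smooth i i q) Ux.
    apply: near_eq_derive; apply: (near_open oU Ux) => y Uy.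
    by rewrite trace_christoffel.
  rewrite /T1 /T3 /T4 -sumrB -big_split -sumrB; apply: eq_bigr => i _ /=.
  by rewrite sumrB addrA.
have GJJ i : js j * js k * 'D_(evec R i) (Gam i (J j) (J k)) x = - 'D_(evec R i) (Gam i j k) x.
  rewrite -derive_cstM; last exact: smooth_derivable i (christoffel_smooth _ _ _) Ux.
  rewrite -[RHS]mulN1r -derive_cstM; last exact: smooth_derivable i (christoffel_smooth _ _ _) Ux.
  apply: near_eq_derive; apply: (near_open oU Ux) => y Uy.
  by rewrite mulN1r christoffel_JJ.
have E1 : js j * js k * T1 (J j) (J k) = - T1 j k.
  by rewrite mulr_sumr -sumrN; apply: eq_bigr => i _; exact: GJJ.
have E3 : js j * js k * T3 (J j) (J k) = - T3 j k.
  rewrite mulr_sumr -sumrN; apply: eq_bigr => i _; rewrite mulr_sumr -sumrN; apply: eq_bigr => m _.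
  by rewrite mulrA christoffel_JJ// mulNr.
have E4 : js j * js k * T4 (J j) (J k) = - T4 j k.
  exact: (bilinear_contract_J (g := fun k i j => Gam k i j x) (christoffelC x) (christoffel_J Ux)).
rewrite (split_ricci j k) (split_ricci (J j) (J k)).
have Er (c t1 d t3 t4 t1' d' t3' t4' : R) : c * t1' = - t1 -> c * t3' = - t3 -> c * t4' = - t4 ->
    t1 - d + t3 - t4 + c * (t1' - d' + t3' - t4') = - (d + c * d').
  move=> e1 e3 e4; transitivity (t1 - d + t3 - t4 + (c * t1' - c * d' + c * t3' - c * t4')); first by ring.
  by rewrite e1 e3 e4; ring.
exact: (Er _ _ _ _ _ _ _ _ _ E1 E3 E4).
Qed.

Lemma hessian_J_average f x j k : U x ->
  hessian G f j k x + js j * js k * hessian G f (J j) (J k) x =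
  'D_(evec R j) ('D_(evec R k) f) x
     + js j * js k * 'D_(evec R (J j)) ('D_(evec R (J k)) f) x.
Proof.
move=> Ux; rewrite /hessian.
pose S p q := \sum_m Gam m p q x * 'D_(evec R m) f x.
have ES : js j * js k * S (J j) (J k) = - S j k.
  by rewrite mulr_sumr -sumrN; apply: eq_bigr => m _; rewrite mulrA christoffel_JJ// mulNr.
rewrite -/(S j k) -/(S (J j) (J k)).
by rewrite mulrBr ES opprK addrACA addNr addr0.
Qed.

(** The soliton equation on (X, Y) plus the one on (JX, JY). *)
Lemma soliton_pluriharmonic f x j k : smooth_on U f ->
  (forall y, U y -> forall p q, ricci G p q y = hessian G f p q y) -> U x ->
  let u := fun y => log_density y + f y in
  'D_(evec R j) ('D_(evec R k) u) x
     + js j * js k * 'D_(evec R (J j)) ('D_(evec R (J k)) u) x = 0.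
Proof.
move=> sf soliton Ux u.
have Du p q : 'D_(evec R p) ('D_(evec R q) u) x =
    'D_(evec R p) ('D_(evec R q) log_density) x + 'D_(evec R p) ('D_(evec R q) f) x.
  have sl := log_density_smooth.
  rewrite -derive_add; first last.
  - exact: smooth_derivable p (smooth_derive q sf) Ux.
  - exact: smooth_derivable p (smooth_derive q sl) Ux.
  apply: near_eq_derive; apply: (near_open oU Ux) => y Uy.
  by rewrite derive_add//; [exact: smooth_derivable q sl Uy|exact: smooth_derivable q sf Uy].
have E := ricci_J_average j k Ux.
rewrite (soliton x Ux j k) (soliton x Ux (J j) (J k)) (hessian_J_average f j k Ux) in E.
rewrite (Du j k) (Du (J j) (J k)).
have Er (p q r t w : R) : p + w * q = - (r + w * t) -> r + p + w * (t + q) = 0.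
  move=> e; transitivity ((p + w * q) + (r + w * t)); first by ring.
  by rewrite e addNr.
exact: Er E.
Qed.
End KahlerChart.

(** * Holomorphic functions *)

Section ComplexDerivative.
Variables (R : realType) (n : nat).
Local Notation C := R[i].
Local Notation E := 'rV[R]_(n * 2).
Local Notation rc := (real_complex R).
Implicit Types (F W : E -> C) (x v : E).

Definition is_cderive x v F (d : C) : Prop :=
  is_derive x v (fun y => complex.Re (F y)) (complex.Re d) /\
  is_derive x v (fun y => complex.Im (F y)) (complex.Im d).

Lemma is_cderiveE x v F d : is_cderive x v F d -> cderive v F x = d.
Proof. by rewrite /cderive; case=> -[_ ->] [_ ->]; case: d. Qed.

Lemma is_cderive_cst x v (c : C) : is_cderive x v (fun=> c) 0.
Proof. by split; exact: is_derive_cst. Qed.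

Lemma is_cderiveD x v F W d e : is_cderive x v F d -> is_cderive x v W e ->
  is_cderive x v (fun y => F y + W y) (d + e).
Proof.
move=> [Fr Fi] [Wr Wi]; split.
  have -> : (fun y => complex.Re (F y + W y)) = (fun y => complex.Re (F y)) + (fun y => complex.Re (W y)).
    by apply/funext => y; rewrite fctE; case: (F y); case: (W y).
  by have := is_deriveD Fr Wr; case: (d); case: (e).
have -> : (fun y => complex.Im (F y + W y)) = (fun y => complex.Im (F y)) + (fun y => complex.Im (W y)).
  by apply/funext => y; rewrite fctE; case: (F y); case: (W y).
by have := is_deriveD Fi Wi; case: (d); case: (e).
Qed.

Lemma is_cderiveM x v F W d e : is_cderive x v F d -> is_cderive x v W e ->
  is_cderive x v (fun y => F y * W y) (d * W x + F x * e).
Proof.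
move=> [Fr Fi] [Wr Wi]; split.
  have -> : (fun y => complex.Re (F y * W y)) = (fun y => complex.Re (F y)) * (fun y => complex.Re (W y))
     - (fun y => complex.Im (F y)) * (fun y => complex.Im (W y)).
    by apply/funext => y; rewrite !fctE; case: (F y); case: (W y).
  apply: is_derive_eq (is_deriveB (is_deriveM Fr Wr) (is_deriveM Fi Wi)) _.
  case: (F x) => a b; case: (W x) => p q; case: (d) => s t; case: (e) => k l.
  rewrite /GRing.scale /=; ring.
have -> : (fun y => complex.Im (F y * W y)) = (fun y => complex.Re (F y)) * (fun y => complex.Im (W y))
   + (fun y => complex.Im (F y)) * (fun y => complex.Re (W y)).
  by apply/funext => y; rewrite !fctE; case: (F y); case: (W y).
apply: is_derive_eq (is_deriveD (is_deriveM Fr Wi) (is_deriveM Fi Wr)) _.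
case: (F x) => a b; case: (W x) => p q; case: (d) => s t; case: (e) => k l.
rewrite /GRing.scale /=; ring.
Qed.

Lemma is_cderive_conj x v F d : is_cderive x v F d ->
  is_cderive x v (fun y => conjc (F y)) (conjc d).
Proof.
move=> [Fr Fi]; split.
  have -> : (fun y => complex.Re (conjc (F y))) = (fun y => complex.Re (F y)).
    by apply/funext => y; case: (F y).
  by case: (d) Fr.
have -> : (fun y => complex.Im (conjc (F y))) = - (fun y => complex.Im (F y)).
  by apply/funext => y; rewrite fctE; case: (F y).
by have := is_deriveN Fi; case: (d).
Qed.

Lemma is_cderive_real x v (g : E -> R) d : is_derive x v g d ->
  is_cderive x v (fun y => rc (g y)) (rc d).
Proof. by move=> gd; split=> //=; exact: is_derive_cst. Qed.

Lemma is_cderive_near x v F W d : (\forall y \near x, F y = W y) ->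
  is_cderive x v F d -> is_cderive x v W d.
Proof.
move=> FW [Fr Fi]; split.
  by apply: near_eq_is_derive Fr; apply: (@filterS _ (nbhs x) (nbhs_filter x) _ _ _ FW) => y ->.
by apply: near_eq_is_derive Fi; apply: (@filterS _ (nbhs x) (nbhs_filter x) _ _ _ FW) => y ->.
Qed.

Definition sqnormc (z : C) : R := complex.Re z ^+ 2 + complex.Im z ^+ 2.

Lemma mul_conjc (z : C) : z * conjc z = rc (sqnormc z).
Proof. by case: z => a b; apply/eqP; rewrite eq_complex /sqnormc /=; apply/andP; split; apply/eqP; ring. Qed.

Lemma sqnormc_neq0 (z : C) : z != 0 -> sqnormc z != 0.
Proof.
move=> z0; apply/eqP => s0; have := mul_conjc z; rewrite s0 => /eqP.
by rewrite mulf_eq0 conjc_eq0 orbb (negPf z0).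
Qed.

(** 1 / F = conj F / |F|^2 reduces this to the inverse of a real function. *)
Lemma is_cderiveV x v F d : F x != 0 -> is_cderive x v F d ->
  is_cderive x v (fun y => (F y)^-1) (- d / F x ^+ 2).
Proof.
move=> F0 Fd; pose N y := sqnormc (F y).
have N0 : N x != 0 := sqnormc_neq0 F0.
have [Nd Nd'] := is_cderiveM Fd (is_cderive_conj Fd).
set e := _ + _ in Nd Nd'.
have {Nd'} ei : rc (complex.Re e) = e.
  have -> : complex.Im e = 0 :> R -> rc (complex.Re e) = e by case: (e) => a b /= ->.
  by [].
  have [_ <-] := Nd'.
  by rewrite (_ : (fun y => _) = cst 0) ?derive_cst//; apply/funext => y; rewrite mul_conjc.
have {}Nd : is_derive x v N (complex.Re e).
  by rewrite (_ : N = (fun y => complex.Re (F y * conjc (F y))))//; apply/funext => y; rewrite mul_conjc.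
have Vd : is_derive x v (fun y => (N y)^-1) (- (N x) ^- 2 * complex.Re e).
  apply: DeriveDef; first by apply: derivableV => //; case: Nd.
  by rewrite deriveV//; case: Nd => _ ->.
have FE y : (F y)^-1 = conjc (F y) * rc ((N y)^-1).
  have [F0'|F0'] := eqVneq (F y) 0.
    by rewrite F0' invr0 conjc0 mul0r.
  apply: (mulfI F0'); rewrite mulfV// mulrA mul_conjc -rmorphM mulfV ?rmorph1//.
  exact: sqnormc_neq0.
have -> : (fun y => (F y)^-1) = (fun y => conjc (F y) * rc ((N y)^-1)) by apply/funext.
have K := is_cderiveM (is_cderive_conj Fd) (is_cderive_real Vd).
move: K; set d' := _ + _; suff -> : d' = - d / F x ^+ 2 by [].
rewrite /d' rmorphM rmorphN !fmorphV rmorphXn /= ei /e -mul_conjc.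
have c0 : conjc (F x) != 0 by rewrite conjc_eq0.
by field; rewrite F0 c0.
Qed.

(** The differential of F at x is the complex linear form sum_a dF a dz^a. *)
Definition hol_at x F (dF : 'I_n -> C) : Prop :=
  forall k, is_cderive x (evec R k) F (\sum_a dF a * zc a (evec R k)).

Lemma sum_zc (dF : 'I_n -> C) (a : 'I_n) :
  (\sum_b dF b * zc b (evec R (xidx a)) = dF a) *
  (\sum_b dF b * zc b (evec R (yidx a)) = dF a * 'i%C).
Proof.
split; (rewrite (bigD1 a)//= big1 ?addr0 => [|b /negPf ba];
  by rewrite zc_evec ?eqxx ?mul1r ?mulr1 ?ba ?mul0r ?mulr0).
Qed.

Lemma hol_at_dz x F dF : hol_at x F dF -> forall a, dz a F x = dF a /\ dzbar a F x = 0.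
Proof.
move=> HF a; rewrite /dz /dzbar (is_cderiveE (HF (xidx a))) (is_cderiveE (HF (yidx a))) !sum_zc.
have -> : 'i%C * (dF a * 'i%C) = - dF a :> C by rewrite mulrCA sqri mulrN1.
rewrite subrr mulr0; split=> //; rewrite opprK -mulr2n -[dF a *+ 2]mulr_natl mulKf// pnatr_eq0//.
Qed.

Lemma holomorphic_hol_at U F x : holomorphic_on U F -> U x -> hol_at x F (fun a => dz a F x).
Proof.
move=> [[sr si] db] Ux k.
have D m : is_cderive x (evec R m) F (cderive (evec R m) F x).
  by split; apply: derivableP; [exact: smooth_derivable m sr Ux|exact: smooth_derivable m si Ux].
suff <- : cderive (evec R k) F x = \sum_a dz a F x * zc a (evec R k) by [].
have := xy_half k; set a := half k.
have := db x Ux a; rewrite /dzbar => /eqP; rewrite mulf_eq0 invr_eq0 pnatr_eq0 /= => /eqP.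
set p := cderive (evec R (xidx a)) F x; set q := cderive (evec R (yidx a)) F x => pq.
have pE : p = - ('i%C * q) by apply/eqP; rewrite -addr_eq0 pq.
have dzE : dz a F x = p.
  by rewrite /dz -/p -/q pE -opprD -mulr2n -mulNrn -[X in _ * X]mulr_natl mulKf// pnatr_eq0.
case: (odd k) => ->; rewrite sum_zc dzE //.
by rewrite pE mulNr mulrAC sqri mulN1r opprK.
Qed.

Lemma hol_at_cst x (c : C) : hol_at x (fun=> c) (fun=> 0).
Proof. by move=> k; rewrite big1 => [|a _]; [exact: is_cderive_cst|rewrite mul0r]. Qed.

Lemma hol_atD x F W dF dW : hol_at x F dF -> hol_at x W dW ->
  hol_at x (fun y => F y + W y) (fun a => dF a + dW a).
Proof.
move=> HF HW k; have := is_cderiveD (HF k) (HW k).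
by rewrite -big_split /=; under eq_bigr do rewrite -mulrDl.
Qed.

Lemma hol_atM x F W dF dW : hol_at x F dF -> hol_at x W dW ->
  hol_at x (fun y => F y * W y) (fun a => dF a * W x + F x * dW a).
Proof.
move=> HF HW k; have := is_cderiveM (HF k) (HW k).
rewrite mulr_suml mulr_sumr -big_split /=.
have -> : \sum_i (dF i * zc i (evec R k) * W x + F x * (dW i * zc i (evec R k))) =
  \sum_a (dF a * W x + F x * dW a) * zc a (evec R k) by apply: eq_bigr => a _; ring.
by [].
Qed.

Lemma hol_atV x F dF : F x != 0 -> hol_at x F dF ->
  hol_at x (fun y => (F y)^-1) (fun a => - dF a / F x ^+ 2).
Proof.
move=> F0 HF k; have := is_cderiveV F0 (HF k).
rewrite -sumrN mulr_suml.
by under eq_bigr do rewrite -mulNr mulrAC.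
Qed.

Lemma hol_at_near x F W dF : (\forall y \near x, F y = W y) -> hol_at x F dF -> hol_at x W dF.
Proof. by move=> FW HF k; exact: is_cderive_near FW (HF k). Qed.

Lemma hol_at_det x m (A : E -> 'M[C]_m) : (forall i j, exists d, hol_at x (fun y => A y i j) d) ->
  exists d, hol_at x (fun y => \det (A y)) d.
Proof.
move=> HA.
have HS (I : finType) (s : seq I) (F : I -> E -> C) : (forall i, exists d, hol_at x (F i) d) ->
    (exists d, hol_at x (fun y => \sum_(i <- s) F i y) d) /\ (exists d, hol_at x (fun y => \prod_(i <- s) F i y) d).
  move=> HF; elim: s => [|i s [[d1 IH1] [d2 IH2]]].
    split; exists (fun=> 0).
      have -> : (fun y => \sum_(i <- [::]) F i y) = (fun=> 0) by apply/funext => y; rewrite big_nil.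
      exact: hol_at_cst.
    have -> : (fun y => \prod_(i <- [::]) F i y) = (fun=> 1) by apply/funext => y; rewrite big_nil.
    exact: hol_at_cst.
  have [e He] := HF i; split.
    have -> : (fun y => \sum_(j <- i :: s) F j y) = (fun y => F i y + \sum_(j <- s) F j y).
      by apply/funext => y; rewrite big_cons.
    by eexists; exact: hol_atD He IH1.
  have -> : (fun y => \prod_(j <- i :: s) F j y) = (fun y => F i y * \prod_(j <- s) F j y).
    by apply/funext => y; rewrite big_cons.
  by eexists; exact: hol_atM He IH2.
rewrite /determinant; apply: (HS _ _ _ _).1 => s.
have [d Hd] := (HS _ (index_enum 'I_m) (fun i y => A y i (s i)) (fun i => HA i (s i))).2.
by eexists; exact: hol_atM (hol_at_cst _ _) Hd.
Qed.

(** Let d = dq/dz_a. The derivatives of q conj q = 1 along x_a and y_a are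
    d conj q + q conj d = 0 and i (d conj q - q conj d) = 0, whence d = 0. *)
Lemma hol_norm1_cst (q : E -> C) (x : E) (r : R) :
  (forall y, ball x r y -> exists d, hol_at y q d) ->
  (forall y, ball x r y -> q y * conjc (q y) = 1) ->
  forall y, ball x r y -> q y = q x.
Proof.
move=> Hq q1.
have D0 y : ball x r y -> forall k, is_cderive y (evec R k) q 0.
  move=> By k; have [d Hd] := Hq y By.
  suff d0 a : d a = 0 by have := Hd k; rewrite big1// => a _; rewrite d0 mul0r.
  have q0 : q y != 0.
    by apply/eqP => q0; have := q1 y By; rewrite q0 mul0r => /eqP; rewrite eq_sym oner_eq0.
  have K m : (\sum_b d b * zc b (evec R m)) * conjc (q y) + q y * conjc (\sum_b d b * zc b (evec R m)) = 0.
    have := is_cderiveE (is_cderiveM (Hd m) (is_cderive_conj (Hd m))) => <-.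
    apply: is_cderiveE; apply: is_cderive_near (is_cderive_cst y (evec R m) 1).
    by apply: (near_open (ball_open _ _) By) => z Bz; rewrite q1.
  have := K (xidx a); have := K (yidx a); rewrite !sum_zc conjcM conjci => Ky Kx.
  have : (d a * conjc (q y)) * 2 = 0.
    transitivity ((d a * conjc (q y) + q y * conjc (d a)) +
       - 'i%C * (d a * 'i%C * conjc (q y) + q y * (conjc (d a) * - 'i%C))); last by rewrite Kx Ky mulr0 addr0.
    have Ei (p s i : C) : - i * (p * i * conjc (q y) + q y * (s * - i)) =
       - (i * i) * (p * conjc (q y) - q y * s) by ring.
    rewrite Ei sqri; ring.
  by move=> /eqP; rewrite !mulf_eq0 conjc_eq0 (negPf q0) pnatr_eq0 !orbF => /eqP.
move=> y By; apply/eqP; rewrite eq_complex; apply/andP; split; apply/eqP.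
  apply: (@partials0_cst R (n * 2) (fun y => complex.Re (q y)) x r) => // z Bz k.
  by case: (D0 z Bz k).
apply: (@partials0_cst R (n * 2) (fun y => complex.Im (q y)) x r) => // z Bz k.
by case: (D0 z Bz k).
Qed.

(** phi maps the coordinate lines to curves, along which F is differentiated. *)
Lemma hol_at_comp V F x (phi : E -> E) (dphi : 'I_n -> 'I_n -> C) :
  open V -> holomorphic_on V F -> V (phi x) ->
  (forall a, hol_at x (fun y => zc a (phi y)) (dphi a)) ->
  hol_at x (fun y => F (phi y)) (fun b => \sum_a dz a F (phi x) * dphi a b).
Proof.
move=> oV HF Vx Hphi k.
have [[sr si] _] := HF.
pose c (t : R) := phi (x + t *: evec R k).
have c0 : c 0 = phi x by rewrite /c scale0r addr0.
pose c' : E := \row_m (if odd m then complex.Im (\sum_b dphi (half m) b * zc b (evec R k))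
                       else complex.Re (\sum_b dphi (half m) b * zc b (evec R k))).
have zc' a : zc a c' = \sum_b dphi a b * zc b (evec R k).
  by rewrite /zc !mxE odd_x odd_y half_x half_y; case: (\sum_b _).
have cd m : is_derive (0 : R) (1 : R) (fun t => c t 0 m) (c' 0 m).
  have [hr hi] := Hphi (half m) k.
  have := xy_half m; rewrite mxE; case: (odd m) => mE.
    have -> : (fun t => c t 0 m) = (fun t => complex.Im (zc (half m) (phi (x + t *: evec R k)))).
      by apply/funext => t; rewrite {1}mE.
    exact: (is_derive_lineP _ _ _ _).1 hi.
  have -> : (fun t => c t 0 m) = (fun t => complex.Re (zc (half m) (phi (x + t *: evec R k)))).
    by apply/funext => t; rewrite {1}mE.
  exact: (is_derive_lineP _ _ _ _).1 hr.
have Vc : V (c 0) by rewrite c0.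
have Dr := smooth_is_derive_curve oV sr Vc cd.
have Di := smooth_is_derive_curve oV si Vc cd.
have DE : \sum_m cderive (evec R m) F (phi x) * rc (c' 0 m) = \sum_b (\sum_a dz a F (phi x) * dphi a b) * zc b (evec R k).
  transitivity (\sum_a dz a F (phi x) * zc a c').
    under eq_bigr => m _ do rewrite (is_cderiveE (holomorphic_hol_at HF Vx m)) mulr_suml.
    rewrite exchange_big; apply: eq_bigr => a _; rewrite zc_expand mulr_sumr.
    by apply: eq_bigr => m _; rewrite mulrA.
  under eq_bigr => a _ do rewrite zc' mulr_sumr.
  rewrite exchange_big; apply: eq_bigr => b _; rewrite mulr_suml.
  by apply: eq_bigr => a _; rewrite mulrA.
split; rewrite -DE; apply/is_derive_lineP.
  apply: is_derive_eq Dr _; rewrite c0 (raddf_sum (@complex.Re R : Rcomplex R -> R)).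
  by apply: eq_bigr => m _; rewrite /cderive /= mulr0 subr0 mulrC.
apply: is_derive_eq Di _; rewrite c0 (raddf_sum (@complex.Im R : Rcomplex R -> R)).
by apply: eq_bigr => m _; rewrite /cderive /= mulr0 add0r mulrC.
Qed.
End ComplexDerivative.

(** * Local solutions of the volume equation *)

Section LocalSolution.
Variables (R : realType) (n : nat).
Local Notation C := R[i].
Local Notation E := 'rV[R]_(n * 2).
Local Notation rc := (real_complex R).

(** A pluriharmonic function on a cube is the logarithm of the squared modulus
    of a holomorphic function: -d^c u is closed, and exp ((u + i v) / 2) is
    holomorphic for any potential v of it. *)
Lemma exp_pluriharmonic (c : E) (r : R) (u : E -> R) :
  smooth_on (ball c r) u ->
  (forall x j k, ball c r x -> 'D_(evec R j) ('D_(evec R k) u) x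
     + Jsign R j * Jsign R k * 'D_(evec R (Jidx j)) ('D_(evec R (Jidx k)) u) x = 0) ->
  exists F : E -> C, holomorphic_on (ball c r) F /\
    forall x, F x * conjc (F x) = rc (expR (u x)).
Proof.
move=> su ph; have oU : open (ball c r) by exact: ball_open.
pose a k x := - Jsign R k * 'D_(evec R (Jidx k)) u x.
have sa k : smooth_on (ball c r) (a k).
  exact: (smoothM oU (smooth_cst _) (smooth_derive (Jidx k) su)).
have ca i j x : ball c r x -> 'D_(evec R i) (a j) x = 'D_(evec R j) (a i) x.
  move=> Bx; rewrite !derive_cstM; first last.
  - exact: smooth_derivable i (smooth_derive (Jidx j) su) Bx.
  - exact: smooth_derivable j (smooth_derive (Jidx i) su) Bx.
  have := ph x i (Jidx j) Bx; rewrite JidxK Jsign_J (smooth_Schwarz (Jidx i) j oU su Bx).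
  have := Jsign_sq R j; set s := Jsign R j; set t := Jsign R i.
  set p := 'D_(evec R i) _ x; set q := 'D_(evec R (Jidx i)) _ x => ss /eqP.
  rewrite addr_eq0 => /eqP ->.
  by transitivity (- (s * s) * (t * q)); [ring|rewrite ss; ring].
have [v [sv dv]] := closed_has_potential sa ca.
pose e y := expR (2^-1 * u y); pose co y := cos (2^-1 * v y); pose si y := sin (2^-1 * v y).
pose F y := Complex (e y * co y) (e y * si y).
have sh g : smooth_on (ball c r) g -> smooth_on (ball c r) (fun y => 2^-1 * g y).
  by move=> sg; exact: (smoothM oU (smooth_cst _) sg).
have se : smooth_on (ball c r) e by exact: (smooth_expR oU (sh _ su)).
have [sco ssi] : smooth_on (ball c r) co /\ smooth_on (ball c r) si.
  exact: (smooth_trig oU (sh _ sv)).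
exists F; split; last first.
  move=> x; rewrite mul_conjc /sqnormc /F /=; congr (rc _).
  rewrite !exprMn -mulrDr cos2Dsin2 mulr1 /e -expRM_natl.
  by rewrite mulVKf// pnatr_eq0.
split; first by split; [exact: (smoothM oU se sco)|exact: (smoothM oU se ssi)].
move=> x Bx j.
have D k : is_cderive x (evec R k) F (F x * Complex (2^-1 * 'D_(evec R k) u x) (2^-1 * a k x)).
  have du : is_derive x (evec R k) (fun y => 2^-1 * u y) (2^-1 * 'D_(evec R k) u x).
    rewrite -derive_cstM; last exact: smooth_derivable k su Bx.
    by apply: derivableP; exact: (sh u su [::] x Bx).2.
  have dv' : is_derive x (evec R k) (fun y => 2^-1 * v y) (2^-1 * a k x).
    rewrite -dv// -derive_cstM; last exact: smooth_derivable k sv Bx.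
    by apply: derivableP; exact: (sh v sv [::] x Bx).2.
  have de : is_derive x (evec R k) e (e x * (2^-1 * 'D_(evec R k) u x)).
    exact: (is_derive_comp_real du (is_derive_expR _)).
  have dc : is_derive x (evec R k) co (- si x * (2^-1 * a k x)).
    exact: (is_derive_comp_real dv' (is_derive_cos _)).
  have ds : is_derive x (evec R k) si (co x * (2^-1 * a k x)).
    exact: (is_derive_comp_real dv' (is_derive_sin _)).
  split.
    apply: is_derive_eq (is_deriveM de dc) _; rewrite /F /GRing.scale /=.
    have Er (p q s t w : R) : p * (- q * s) + w * (p * t) = p * w * t - p * q * s by ring.
    exact: Er.
  apply: is_derive_eq (is_deriveM de ds) _; rewrite /F /GRing.scale /=.
  have Er (p q s t w : R) : p * (q * s) + w * (p * t) = p * q * s + p * w * t by ring.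
  exact: Er.
rewrite /dzbar (is_cderiveE (D (xidx j))) (is_cderiveE (D (yidx j))).
have -> : a (xidx j) x = - 'D_(evec R (yidx j)) u x.
  by rewrite /a /Jsign /Jidx odd_x half_x mulN1r.
have -> : a (yidx j) x = 'D_(evec R (xidx j)) u x.
  by rewrite /a /Jsign /Jidx odd_y half_y opprK mul1r.
set p := 'D_(evec R (xidx j)) u x; set q := 'D_(evec R (yidx j)) u x.
have -> : Complex (2^-1 * p) (2^-1 * - q) = - ('i%C * Complex (2^-1 * q) (2^-1 * p)).
  apply/eqP; rewrite eq_complex /=; apply/andP; split; apply/eqP; ring.
by rewrite mulrN mulrCA addNr mulr0.
Qed.
End LocalSolution.

Section LocalVolume.
Variables (R : realType) (n : nat).
Local Notation C := R[i].
Local Notation E := 'rV[R]_(n * 2).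
Local Notation rc := (real_complex R).
Variables (U : set E) (Hm : E -> 'M[C]_n) (f : E -> R).
Hypothesis oU : open U.
Hypothesis Hsmooth : forall i j, csmooth_on U (fun x => Hm x i j).
Hypothesis Hherm : forall x, U x -> forall i j, Hm x j i = conjc (Hm x i j).
Hypothesis Hpos : forall x, U x -> forall u : E, u != 0 -> 0 < herm_metric (Hm x) u u.
Hypothesis Hclosed : forall x, U x -> forall v, ext_deriv (fun y => kahler_form (Hm y)) x v = 0.
Hypothesis sf : smooth_on U f.
Hypothesis soliton : forall y, U y -> forall p q,
  ricci (fun y => real_metric (Hm y)) p q y = hessian (fun y => real_metric (Hm y)) f p q y.

Lemma smooth_onS (V : set E) (g : E -> R) : V `<=` U -> smooth_on U g -> smooth_on V g.
Proof. by move=> VU sg s x /VU Ux; exact: sg. Qed.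

(** The right-hand side is exp of a pluriharmonic function. *)
Lemma local_solution (c : E) (r : R) : ball c r `<=` U ->
  exists F : E -> C, holomorphic_on (ball c r) F /\
    forall y, ball c r y -> F y * conjc (F y) = \det (Hm y) * rc (expR (f y)).
Proof.
move=> BU; have sl := log_density_smooth oU Hsmooth Hherm Hpos.
pose u y := log_density Hm y + f y.
have su : smooth_on (ball c r) u by apply: (smooth_onS BU); exact: (smoothD oU sl sf).
have [|F [hF nF]] := @exp_pluriharmonic R n c r u su.
  move=> x j k Bx.
  exact: (soliton_pluriharmonic oU Hsmooth Hherm Hpos Hclosed j k sf soliton (BU _ Bx)).
exists F; split=> // y /BU Uy; rewrite nF /u expRD rmorphM; congr (_ * _).
rewrite -(sqrt_det_real_metric (Hherm Uy) (Hpos Uy)); congr (rc _).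
have d0 : 0 < \det (real_metric (Hm y)) by exact: det_metric_gt0 Uy.
have dE : \det (real_metric (Hm y)) = expR (2^-1 * ln (\det (real_metric (Hm y)))) ^+ 2.
  by rewrite -expRM_natl mulVKf ?pnatr_eq0// lnK.
by rewrite [in RHS]dE sqrtr_sqr ger0_norm// expR_ge0.
Qed.
End LocalVolume.

(** * Sections of a flat line bundle *)

Section IntervalInduction.
Variable R : realType.

(** The supremum of the t for which P a t holds is attained, and it is b. *)
Lemma interval_induction (P : R -> R -> Prop) (a b : R) : a <= b ->
  (forall c d e, a <= c -> c <= d -> d <= e -> e <= b -> P c d -> P d e -> P c e) ->
  (forall x, a <= x <= b -> exists2 dl : R, 0 < dl &
     forall c d, a <= c -> c <= x -> x <= d -> d <= b -> x - c < dl -> d - x < dl -> P c d) ->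
  P a b.
Proof.
move=> ab glue loc.
pose S : set R := [set t | a <= t <= b /\ P a t].
have Sa : S a.
  split; first by rewrite lexx ab.
  have [|dl dl0 H] := loc a; first by rewrite lexx ab.
  by apply: H => //; rewrite subrr.
have Sb : ubound S b by move=> t [/andP[_ tb] _].
have Ssup : has_sup S by split; [exists a|exists b].
pose s := sup S.
have as_ : a <= s by exact: sup_upper_bound Sa.
have sb : s <= b by apply: ge_sup => //; exists a.
have [|dl dl0 H] := loc s; first by rewrite as_ sb.
have [t [/andP[at_ tb] Pt] st] := sup_adherent dl0 Ssup.
have ts : t <= s by apply: sup_upper_bound => //; split=> //; rewrite at_ tb.
pose s' := Num.min b (s + dl / 2).
have ss' : s <= s' by rewrite le_min sb lerDl; lra.
have s'b : s' <= b by rewrite ge_min lexx.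
have s'd : s' - s < dl.
  have : s' <= s + dl / 2 by rewrite ge_min lexx orbT.
  by lra.
have Ps' : P a s'.
  apply: (glue a t s') => //; first exact: le_trans ts ss'.
  by apply: H => //; rewrite /s in st *; lra.
have s's : s' <= s.
  by apply: sup_upper_bound => //; split=> //; rewrite (le_trans as_ ss') s'b.
suff <- : s' = b by [].
move: s's; rewrite /s'; case: (leP b (s + dl / 2)) => // h1 h2.
by exfalso; lra.
Qed.
End IntervalInduction.

Lemma locally_constant_connected (T : topologicalType) (A : set T) (K : Type) (g : T -> K) :
  connected A -> (forall q, A q -> nbhs q (fun q' => A q' -> g q' = g q)) ->
  forall p q, A p -> A q -> g p = g q.
Proof.
move=> cA lg p q Ap Aq.
pose B : set T := [set x | A x /\ g x = g p].
suff BA : B = A by have [] : B q by rewrite BA.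
apply: cA; first by exists p.
- exists (interior [set x | A x -> g x = g p]); first exact: open_interior.
  apply/seteqP; split=> x [Ax gx]; split=> //.
    rewrite /interior /=; apply: filterS (lg x Ax) => y H Ay.
    by rewrite H.
  by have := interior_subset gx; apply.
- exists (~` (interior [set x | A x -> g x <> g p])).
    by apply: open_closedC; exact: open_interior.
  apply/seteqP; split=> x [Ax gx]; split=> //.
    by move=> /interior_subset/(_ Ax).
  apply: contrapT => gpx; apply: gx; rewrite /interior /=.
  by apply: filterS (lg x Ax) => y H Ay; rewrite H.
Qed.

Lemma within_nbhs (T X : topologicalType) (D : set T) (h : T -> X) q (A : set X) :
  {within D, continuous h} -> D q -> nbhs (h q) A ->
  nbhs q (fun q' => D q' -> A (h q')).
Proof. by move=> /subspace_continuousP ch Dq hA; exact: (ch q Dq A hA). Qed.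

Lemma within_comp (T X Y : topologicalType) (D : set T) (D' : set X) (e : T -> X) (g : X -> Y) :
  {within D, continuous e} -> {within D', continuous g} -> (forall q, D q -> D' (e q)) ->
  {within D, continuous (g \o e)}.
Proof.
move=> ce cg De; apply/subspace_continuousP => x Dx A hA.
apply: filterS (within_nbhs ce Dx (within_nbhs cg (De x Dx) hA)) => y H Dy.
by apply: H => //; exact: De.
Qed.

Section LocalSystem.
Variables (R : realType) (X : topologicalType) (K : fieldType) (I : Type).
Variables (B : I -> set X) (F : I -> X -> K).
Hypothesis Bopen : forall i, open (B i).
Hypothesis Bcover : forall p, exists i, B i p.
Hypothesis F0 : forall i p, B i p -> F i p != 0.
Hypothesis Fratio : forall i j p, B i p -> B j p ->
  nbhs p (fun q => F i q / F j q = F i p / F j p).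

(** The functions F i have locally constant ratios, hence they are the local
    frames of a flat line bundle. [flat h D s] says that s is a flat, nowhere
    vanishing section over D of its pull-back by h. *)
Definition flat (T : topologicalType) (h : T -> X) (D : set T) (s : T -> K) : Prop :=
  forall q, D q -> s q != 0 /\ forall i, B i (h q) ->
    nbhs q (fun q' => D q' -> s q' / F i (h q') = s q / F i (h q)).

Section Flat.
Variable T : topologicalType.
Implicit Types (h : T -> X) (D : set T) (s : T -> K).

(** One frame at each point is enough, as all frames are locally proportional. *)
Lemma flat_of_some h D s : {within D, continuous h} ->
  (forall q, D q -> s q != 0 /\ exists2 i, B i (h q) &
    nbhs q (fun q' => D q' -> s q' / F i (h q') = s q / F i (h q))) -> flat h D s.
Proof.
move=> ch H q Dq; have [s0 [i Bi Hi]] := H q Dq; split=> // j Bj.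
have Nij := within_nbhs ch Dq (Fratio Bi Bj).
have Ni := within_nbhs ch Dq (open_nbhs_nbhs (conj (Bopen i) Bi)).
apply: filterS3 Hi Nij Ni => q' e1 e2 Bi' Dq'.
have {}e1 := e1 Dq'; have {}e2 := e2 Dq'; have {}Bi' := F0 (Bi' Dq').
have Fi := F0 Bi.
have -> : s q' / F j (h q') = (s q' / F i (h q')) * (F i (h q') / F j (h q')).
  by rewrite mulrA divfK.
by rewrite e1 e2 mulrA divfK.
Qed.

Lemma flat_local h D i : {within D, continuous h} ->
  (forall q, D q -> B i (h q)) -> flat h D (fun q => F i (h q)).
Proof.
move=> ch Di; apply: flat_of_some => // q Dq; split; first exact: F0 (Di q Dq).
exists i; first exact: Di.
by apply: filterE => q' Dq'; rewrite !divff ?F0//; exact: Di.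
Qed.

Lemma flat_scale h D s (c : K) : c != 0 -> flat h D s -> flat h D (fun q => c * s q).
Proof.
move=> c0 fs q Dq; have [s0 Hs] := fs q Dq; split; first by rewrite mulf_neq0.
move=> i Bi; apply: filterS (Hs i Bi) => q' e /e {}e.
by rewrite -!mulrA e.
Qed.

Lemma flat_sub h D D' s : D' `<=` D -> flat h D s -> flat h D' s.
Proof.
move=> DD fs q D'q; have [s0 Hs] := fs q (DD q D'q); split=> // i Bi.
by apply: filterS (Hs i Bi) => q' e D'q'; apply: e; exact: DD.
Qed.

Lemma flat_eq h h' D s s' : (forall q, D q -> h q = h' q) -> (forall q, D q -> s q = s' q) ->
  flat h D s -> flat h' D s'.
Proof.
move=> hh ss fs q Dq; have [s0 Hs] := fs q Dq; split; first by rewrite -ss.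
move=> i; rewrite -hh// => Bi; apply: filterS (Hs i Bi) => q' e Dq'.
by rewrite -!hh// -!ss//; exact: e.
Qed.

Lemma flat_ratio_cst h D s s' : connected D -> flat h D s -> flat h D s' ->
  forall p q, D p -> D q -> s p / s' p = s q / s' q.
Proof.
move=> cD fs fs'; apply: locally_constant_connected => // q Dq.
have [s0 Hs] := fs q Dq; have [s'0 Hs'] := fs' q Dq; have [i Bi] := Bcover (h q).
apply: filterS2 (Hs i Bi) (Hs' i Bi) => q' e e' Dq'.
have {}e := e Dq'; have {}e' := e' Dq'.
have [s0' _] := fs q' Dq'; have [s'0' _] := fs' q' Dq'.
have Fi := F0 Bi.
have Fq : F i (h q') != 0.
  by apply/eqP => Fq; move: e; rewrite Fq invr0 mulr0 => /eqP; rewrite eq_sym mulf_eq0 invr_eq0 (negPf s0) (negPf Fi).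
have -> : s q' / s' q' = (s q' / F i (h q')) / (s' q' / F i (h q')).
  by rewrite invf_div mulrA divfK.
by rewrite e e' invf_div mulrA divfK.
Qed.

Lemma flat_glue h D1 D2 s1 s2 : closed D1 -> closed D2 ->
  flat h D1 s1 -> flat h D2 s2 -> (forall q, D1 q -> D2 q -> s1 q = s2 q) ->
  flat h (D1 `|` D2) (fun q => if q \in D1 then s1 q else s2 q).
Proof.
move=> cD1 cD2 f1 f2 s12.
have away D q : closed D -> ~ D q -> nbhs q (fun q' => ~ D q').
  by move=> cD nD; apply: open_nbhs_nbhs; split=> //; exact: closed_openC.
have val1 q : D1 q -> (if q \in D1 then s1 q else s2 q) = s1 q by move=> /mem_set ->.
have val2 q : D2 q -> (if q \in D1 then s1 q else s2 q) = s2 q.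
  by move=> D2q; case: ifPn => // /set_mem D1q; exact: s12.
move=> q Dq; have [D1q|nD1q] := pselect (D1 q).
  have [s0 H1] := f1 q D1q; rewrite val1//; split=> // i Bi.
  have [D2q|nD2q] := pselect (D2 q).
    have [_ H2] := f2 q D2q; apply: filterS2 (H1 i Bi) (H2 i Bi) => q' e1 e2 [D1'|D2'].
      by rewrite val1//; exact: e1.
    by rewrite val2// s12//; exact: e2.
  apply: filterS2 (H1 i Bi) (away _ _ cD2 nD2q) => q' e1 nD2' [D1'|//].
  by rewrite val1//; exact: e1.
have D2q : D2 q by case: Dq.
have [s0 H2] := f2 q D2q; rewrite val2//; split=> // i Bi.
apply: filterS2 (H2 i Bi) (away _ _ cD1 nD1q) => q' e2 nD1' [//|D2'].
by rewrite val2//; exact: e2.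
Qed.

(** On the connected intersection the two sections are proportional, so that a
    multiple of the second one agrees with the first. *)
Lemma flat_exists_glue h D1 D2 : closed D1 -> closed D2 -> connected (D1 `&` D2) ->
  (exists s, flat h D1 s) -> (exists s, flat h D2 s) -> exists s, flat h (D1 `|` D2) s.
Proof.
move=> cD1 cD2 c12 [s1 f1] [s2 f2].
have [[p [D1p D2p]]|no] := pselect (exists p, D1 p /\ D2 p); last first.
  exists (fun q => if q \in D1 then s1 q else s2 q); apply: flat_glue => // q D1q D2q.
  by case: no; exists q.
have [s1p _] := f1 p D1p; have [s2p _] := f2 p D2p.
exists (fun q => if q \in D1 then s1 q else (s1 p / s2 p) * s2 q).
apply: flat_glue => //.
  by apply: flat_scale => //; rewrite mulf_neq0// invr_eq0.
move=> q D1q D2q; have [s2q _] := f2 q D2q.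
rewrite (@flat_ratio_cst h (D1 `&` D2) s1 s2 c12 _ _ p q)//; first by rewrite divfK.
- by apply: flat_sub f1 => ? [].
- by apply: flat_sub f2 => ? [].
Qed.
End Flat.

Lemma flat_comp (T T' : topologicalType) (h : T -> X) (D : set T) s (e : T' -> T) (D' : set T') :
  {within D', continuous e} -> (forall q, D' q -> D (e q)) -> flat h D s ->
  flat (h \o e) D' (s \o e).
Proof.
move=> ce De fs q D'q; have [s0 Hs] := fs _ (De q D'q); split=> // i Bi.
by apply: filterS (within_nbhs ce D'q (Hs i Bi)) => q' H D'q'; apply: H => //; exact: De.
Qed.

Lemma flat_near (T : topologicalType) (h : T -> X) (D : set T) q : {within D, continuous h} -> D q ->
  exists2 A, nbhs q A & exists s, flat h (D `&` A) s.
Proof.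
move=> ch Dq; have [i Bi] := Bcover (h q).
exists (fun q' => D q' -> B i (h q')).
  exact: within_nbhs ch Dq (open_nbhs_nbhs (conj (Bopen i) Bi)).
exists (fun q => F i (h q)); apply: flat_local.
  by apply: continuous_subspaceW ch => ? [].
by move=> q' [Dq' /(_ Dq')].
Qed.

Lemma rect_closed (a b c d : R) : closed (`[a, b]%classic `*` `[c, d]%classic).
Proof.
have -> : `[a, b]%classic `*` `[c, d]%classic =
    (@fst R R @^-1` `[a, b]%classic) `&` (@snd R R @^-1` `[c, d]%classic) by [].
apply: closedI; (apply: preimage_closed; last exact: interval_closed) => x _.
  exact: cvg_fst.
exact: cvg_snd.
Qed.

Lemma segment_connected_hor (a b d : R) : connected (`[a, b]%classic `*` `[d, d]%classic).
Proof.
have -> : `[a, b]%classic `*` `[d, d]%classic = (fun t : R => (t, d)) @` `[a, b]%classic.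
  apply/seteqP; split=> [[t e] [/= tab]|_ [t tab <-]] /=; rewrite !in_itv /= -eq_le.
    by move=> /eqP <-; exists t.
  by split; rewrite // in_itv.
apply: connected_continuous_connected; first exact: segment_connected.
apply: continuous_subspaceT => t; exact: cvg_pair cvg_id (cvg_cst d).
Qed.

Lemma segment_connected_ver (a b d : R) : connected (`[d, d]%classic `*` `[a, b]%classic).
Proof.
have -> : `[d, d]%classic `*` `[a, b]%classic = (fun t : R => (d, t)) @` `[a, b]%classic.
  apply/seteqP; split=> [[e t] [/=]|_ [t tab <-]] /=; rewrite !in_itv /= -eq_le.
    by move=> /eqP <- tab; exists t.
  by split.
apply: connected_continuous_connected; first exact: segment_connected.
apply: continuous_subspaceT => t; exact: cvg_pair (cvg_cst d) cvg_id.
Qed.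

Lemma itv_split (c d e : R) : c <= d -> d <= e ->
  `[c, e]%classic = `[c, d]%classic `|` `[d, e]%classic.
Proof.
move=> cd de; apply/seteqP; split=> x /=; rewrite !in_itv /=.
  by move=> /andP[cx xe]; have [xd|/ltW dx] := leP x d; [left|right]; rewrite ?cx ?xd ?dx ?xe.
by case=> /andP[h1 h2]; rewrite ?h1 ?h2 ?(le_trans h2 de) ?(le_trans cd h1).
Qed.

Lemma itv_meet (c d e : R) : c <= d -> d <= e ->
  `[c, d]%classic `&` `[d, e]%classic = `[d, d]%classic.
Proof.
move=> cd de; apply/seteqP; split=> x /=; rewrite !in_itv /=.
  by move=> [/andP[_ xd] /andP[dx _]]; rewrite xd dx.
by move=> /andP[dx xd]; rewrite dx xd (le_trans cd dx) (le_trans xd de).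
Qed.

(** For fixed x, creeping along y gives a section over some strip
    [a, b] x [0, 1] around x; then one creeps along x. *)
Lemma flat_square_exists (h : R * R -> X) :
  {within `[0, 1]%classic `*` `[0, 1]%classic, continuous h} ->
  exists s, flat h (`[0, 1]%classic `*` `[0, 1]%classic) s.
Proof.
move=> ch; apply: (@interval_induction R (fun a b => exists s, flat h (`[a, b]%classic `*` `[0, 1]%classic) s)) => //.
  move=> c d e c0 cd de e1 f1 f2; rewrite (itv_split cd de).
  have -> : forall A B C : set R, (A `|` B) `*` C = (A `*` C) `|` (B `*` C).
    by move=> A B' C; apply/seteqP; split=> -[u v] /=; tauto.
  apply: flat_exists_glue => //; try exact: rect_closed.
  have -> : forall A B C : set R, (A `*` C) `&` (B `*` C) = (A `&` B) `*` C.
    by move=> A B' C; apply/seteqP; split=> -[u v] /=; tauto.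
  by rewrite (itv_meet cd de); exact: segment_connected_ver.
move=> x x01.
have : exists2 dl : R, 0 < dl & forall a b, 0 <= a -> a <= x -> x <= b -> b <= 1 -> x - a < dl -> b - x < dl ->
    exists s, flat h (`[a, b]%classic `*` `[0, 1]%classic) s.
  pose P (c d : R) := exists2 dl : R, 0 < dl & forall a b, 0 <= a -> a <= x -> x <= b -> b <= 1 -> x - a < dl -> b - x < dl ->
    exists s, flat h (`[a, b]%classic `*` `[c, d]%classic) s.
  apply: (@interval_induction R P) => //.
    move=> c d e c0 cd de e1 [d1 d10 H1] [d2 d20 H2]; exists (Num.min d1 d2); first by rewrite lt_min d10 d20.
    move=> a b a0 ax xb b1; rewrite !lt_min => /andP[h1 h2] /andP[h3 h4].
    rewrite (itv_split cd de).
    have -> : forall A B C : set R, C `*` (A `|` B) = (C `*` A) `|` (C `*` B).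
      by move=> A B' C; apply/seteqP; split=> -[u v] /=; tauto.
    apply: flat_exists_glue; try exact: rect_closed.
    - have -> : forall A B C : set R, (C `*` A) `&` (C `*` B) = C `*` (A `&` B).
        by move=> A B' C; apply/seteqP; split=> -[u v] /=; tauto.
      by rewrite (itv_meet cd de); exact: segment_connected_hor.
    - exact: H1.
    - exact: H2.
  move=> y y01.
  have Dxy : (`[0, 1]%classic `*` `[0, 1]%classic) (x, y) by split; rewrite /= in_itv.
  have [A /nbhs_ballP[dl /= dl0 HA] [s fs]] := flat_near ch Dxy.
  exists dl => // c d c0 cy yd d1 yc dy; exists dl => // a b a0 ax xb b1 xa bx.
  exists s; apply: flat_sub fs => -[p q] [] /=; rewrite !in_itv /= => /andP[h1 h2] /andP[h3 h4].
  split; first by split; apply/andP; split; lra.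
  by apply: HA; split; rewrite /ball /= ltr_norml; apply/andP; split; lra.
by [].
Qed.
End LocalSystem.

(** * Monodromy *)

Section Monodromy.
Variables (R : realType) (X : topologicalType) (K : fieldType) (I : Type).
Variables (B : I -> set X) (F : I -> X -> K).
Hypothesis Bopen : forall i, open (B i).
Hypothesis Bcover : forall p, exists i, B i p.
Hypothesis F0 : forall i p, B i p -> F i p != 0.
Hypothesis Fratio : forall i j p, B i p -> B j p ->
  nbhs p (fun q => F i q / F j q = F i p / F j p).
Local Notation flat := (flat B F).
Local Notation unit_itv := (`[0, 1]%classic : set R).

Lemma flat_cst (T : topologicalType) (h : T -> X) (D : set T) s p : connected D ->
  (forall q, D q -> h q = p) -> flat h D s -> forall q q', D q -> D q' -> s q = s q'.
Proof.
move=> cD hp fs q q' Dq Dq'.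
have f1 : flat h D (fun=> 1).
  move=> x Dx; split; first exact: oner_neq0.
  by move=> i _; apply: filterE => y Dy; rewrite !hp.
by have := flat_ratio_cst Bcover F0 cD fs f1 Dq Dq'; rewrite !divr1.
Qed.

(** Continuation along some path of the value a at p to the value b at q. *)
Definition transport p a q b := exists g : R -> X, exists s : R -> K,
  [/\ {within unit_itv, continuous g}, flat g unit_itv s,
      g 0 = p /\ g 1 = q & s 0 = a /\ s 1 = b].

Lemma in01 (t : R) : unit_itv t <-> 0 <= t <= 1.
Proof. by rewrite /= in_itv. Qed.

Lemma transport_neq0 p a q b : transport p a q b -> b != 0.
Proof.
move=> [g [s [_ fs _ [_ <-]]]].
by have [] := fs 1 _; first by apply/in01; rewrite lexx ler01.
Qed.

Lemma transport_sym p a q b : transport p a q b -> transport q b p a.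
Proof.
move=> [g [s [cg fs [g0 g1] [s0 s1]]]].
have ce : {within unit_itv, continuous (fun t : R => 1 - t)}.
  by apply: continuous_subspaceT => t; apply: cvgB; [exact: cvg_cst|exact: cvg_id].
have De (t : R) : unit_itv t -> unit_itv (1 - t).
  by move=> /in01 ?; apply/in01; apply/andP; split; lra.
exists (g \o (fun t => 1 - t)), (s \o (fun t => 1 - t)); split => /=.
- exact: within_comp ce cg De.
- exact: flat_comp ce De fs.
- by rewrite subr0 subrr.
- by rewrite subr0 subrr.
Qed.

Lemma transport_trans q b p a r c : transport p a q b -> transport q b r c -> transport p a r c.
Proof.
move=> [g [s [cg fs [g0 g1] [s0 s1]]]] [g' [s' [cg' fs' [g'0 g'1] [s'0 s'1]]]].
pose D1 : set R := `[0, 2^-1]%classic; pose D2 : set R := `[2^-1, 1]%classic.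
have cD1 : closed D1 by exact: interval_closed.
have cD2 : closed D2 by exact: interval_closed.
have D12 : unit_itv = D1 `|` D2 by apply: itv_split; lra.
have ce1 : {within D1, continuous (fun t : R => 2 * t)}.
  by apply: continuous_subspaceT => t; apply: cvgM; [exact: cvg_cst|exact: cvg_id].
have ce2 : {within D2, continuous (fun t : R => 2 * t - 1)}.
  apply: continuous_subspaceT => t; apply: cvgB; last exact: cvg_cst.
  by apply: cvgM; [exact: cvg_cst|exact: cvg_id].
have De1 (t : R) : D1 t -> unit_itv (2 * t).
  by rewrite /D1 /= !in_itv /= => ?; apply/andP; split; lra.
have De2 (t : R) : D2 t -> unit_itv (2 * t - 1).
  by rewrite /D2 /= !in_itv /= => ?; apply/andP; split; lra.
pose G (t : R) := if t \in D1 then g (2 * t) else g' (2 * t - 1).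
have half_eq t : D1 t -> D2 t -> t = 2^-1.
  by rewrite /D1 /D2 /= !in_itv /= => /andP[_ h1] /andP[h2 _]; apply/eqP; rewrite eq_le h1 h2.
have v1 : 2 * 2^-1 = 1 :> R by rewrite mulfV// pnatr_eq0.
have G1 t : D1 t -> g (2 * t) = G t by move=> /mem_set D1t; rewrite /G D1t.
have G2 t : D2 t -> g' (2 * t - 1) = G t.
  rewrite /G; case: ifPn => // /set_mem D1t D2t.
  by rewrite (half_eq t D1t D2t) v1 subrr g1 g'0.
have D10 : (0 : R) \in D1 by apply/mem_set; rewrite /D1 /= in_itv /= lexx invr_ge0 ler0n.
have D11 : ((1 : R) \in D1) = false.
  apply/negP => /set_mem; rewrite /D1 /= in_itv /= ler01 /=.
  by apply/negP; rewrite -ltNge invf_lt1 ?ltr1n ?ltr0n.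
exists G, (fun t => if t \in D1 then s (2 * t) else s' (2 * t - 1)); split.
- rewrite D12; apply: withinU_continuous => //.
    apply: (@subspace_eq_continuous _ _ _ (g \o (fun t => 2 * t))).
      by move=> t /set_mem; exact: G1.
    exact: within_comp ce1 cg De1.
  apply: (@subspace_eq_continuous _ _ _ (g' \o (fun t => 2 * t - 1))).
    by move=> t /set_mem; exact: G2.
  exact: within_comp ce2 cg' De2.
- rewrite D12; apply: (@flat_glue _ _ _ _ _ _ G D1 D2 (s \o (fun t => 2 * t)) (s' \o (fun t => 2 * t - 1))) => //.
  + exact: flat_eq G1 _ (flat_comp ce1 De1 fs).
  + exact: flat_eq G2 _ (flat_comp ce2 De2 fs').
  + by move=> t D1t D2t /=; rewrite (half_eq t D1t D2t) v1 subrr s1 s'0.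
- rewrite /G D10 D11 mulr0; split=> //.
  by rewrite mulr1 (_ : 2 - 1 = 1 :> R)//; ring.
- rewrite D10 D11 mulr0; split=> //.
  by rewrite mulr1 (_ : 2 - 1 = 1 :> R)//; ring.
Qed.

Hypothesis Bpath : forall i p q, B i p -> B i q -> exists g : R -> X,
  [/\ {within unit_itv, continuous g}, g 0 = p, g 1 = q & forall t, unit_itv t -> B i (g t)].

Lemma transport_in i p q a : B i p -> B i q -> a != 0 -> transport p a q (a / F i p * F i q).
Proof.
move=> Bp Bq a0; have [g [cg g0 g1 Bg]] := Bpath Bp Bq.
exists g, (fun t => a / F i p * F i (g t)); split=> //.
  apply: flat_scale; first by rewrite mulf_neq0// invr_eq0 F0.
  exact: (flat_local Bopen F0 Fratio cg Bg).
by rewrite g0 g1 divfK// F0.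
Qed.

Hypothesis loops : forall g : R -> X, {within unit_itv, continuous g} -> g 0 = g 1 ->
  exists H : R * R -> X,
    [/\ {within `[0, 1]%classic `*` `[0, 1]%classic, continuous H},
        forall t : R, 0 <= t <= 1 -> H (0, t) = g t /\ H (1, t) = g 0 &
        forall s : R, 0 <= s <= 1 -> H (s, 0) = g 0 /\ H (s, 1) = g 0].

(** Continuation along a null-homotopic loop is trivial, because the
    homotopy carries a section, and this section is constant on the three sides
    of the square that are sent to the base point. *)
Lemma transport_loop p a b : transport p a p b -> a = b.
Proof.
move=> [g [s [cg fs [g0 g1] [s0 s1]]]].
have g01 : g 0 = g 1 by rewrite g0 g1.
have [H [cH Hv Hh]] := loops cg g01.
have [S fS] := flat_square_exists Bopen Bcover F0 Fratio cH.
have c01 : connected unit_itv by exact: segment_connected.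
have i0 : unit_itv 0 by apply/in01; rewrite lexx ler01.
have i1 : unit_itv 1 by apply/in01; rewrite lexx ler01.
have chor (d : R) : {within unit_itv, continuous (fun t : R => (d, t))}.
  by apply: continuous_subspaceT => t; exact: cvg_pair (cvg_cst d) cvg_id.
have cver (d : R) : {within unit_itv, continuous (fun t : R => (t, d))}.
  by apply: continuous_subspaceT => t; exact: cvg_pair cvg_id (cvg_cst d).
have fh d : unit_itv d -> flat (H \o (fun t => (d, t))) unit_itv (S \o (fun t => (d, t))).
  by move=> id_; apply: flat_comp fS => // t it.
have fv d : unit_itv d -> flat (H \o (fun t => (t, d))) unit_itv (S \o (fun t => (t, d))).
  by move=> id_; apply: flat_comp fS => // t it.
have e1 : S (0, 0) = S (1, 0).
  by apply: (flat_cst c01 (p := g 0) _ (fv 0 i0) i0 i1) => t /in01 /Hh [].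
have e2 : S (1, 0) = S (1, 1).
  by apply: (flat_cst c01 (p := g 0) _ (fh 1 i1) i0 i1) => t /in01 /Hv [].
have e3 : S (0, 1) = S (1, 1).
  by apply: (flat_cst c01 (p := g 0) _ (fv 1 i1) i0 i1) => t /in01 /Hh [].
have fg : flat g unit_itv (S \o (fun t => (0, t))).
  by apply: flat_eq (fh 0 i0) => // t /in01 /Hv [].
have := flat_ratio_cst Bcover F0 c01 fs fg i0 i1; rewrite /= s0 s1 e1 e2 -e3.
have [S1 _] := fg 1 i1; move=> /(congr1 (fun z => z * S (0, 1))).
by rewrite !divfK.
Qed.

Hypothesis Xconnected : connected [set: X].

(** The value of s at q is the continuation to q of the value 1 at a base point;
    by [transport_loop] it does not depend on the path. *)
Theorem monodromy : exists s : X -> K, forall p, s p != 0 /\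
  forall i q, B i p -> B i q -> s q / F i q = s p / F i p.
Proof.
have [[p0 _]|noX] := pselect (exists p : X, True); last first.
  by exists (fun=> 1) => p; case: noX; exists p.
have tr p q i a : B i p -> B i q -> transport p0 1 p a -> transport p0 1 q (a / F i p * F i q).
  move=> Bp Bq tpa; apply: (transport_trans tpa); apply: transport_in => //.
  exact: transport_neq0 tpa.
have reach q : exists b, transport p0 1 q b.
  pose P q := `[< exists b, transport p0 1 q b >].
  suff : P p0 = P q.
    have -> : P p0 = true.
      have [i Bi] := Bcover p0; apply/asboolP; exists (1 / F i p0 * F i p0).
      by apply: transport_in => //; exact: oner_neq0.
    by move=> /esym /asboolP.
  apply: (locally_constant_connected Xconnected) => // x _.
  have [i Bi] := Bcover x.
  apply: filterS (open_nbhs_nbhs (conj (Bopen i) Bi)) => y By _.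
  apply/asbool_equiv_eq; split=> -[b tb].
    by exists (b / F i y * F i x); exact: tr tb.
  by exists (b / F i x * F i y); exact: tr tb.
have [s hs] := choice reach; exists s => p.
have uniq q b b' : transport p0 1 q b -> transport p0 1 q b' -> b = b'.
  by move=> t1 t2; apply: (@transport_loop q); exact: transport_trans (transport_sym t1) t2.
split.
  exact: transport_neq0 (hs p).
move=> i q Bp Bq; rewrite (uniq _ _ _ (hs q) (tr p q i (s p) Bp Bq (hs p))).
by rewrite mulfK// F0.
Qed.
End Monodromy.

(** * Holomorphic functions on open sets *)

Section HolomorphicOn.
Variables (R : realType) (n : nat).
Local Notation C := R[i].
Local Notation E := 'rV[R]_(n * 2).
Implicit Types (F G : E -> C) (U V : set E) (x : E).

Lemma hol_at_zc x (k : 'I_n) : hol_at x (fun y => zc k y) (fun a => (a == k)%:R).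
Proof.
move=> m.
have -> : \sum_a (a == k)%:R * zc a (evec R m) = zc k (evec R m).
  by rewrite (bigD1 k)//= eqxx mul1r big1 ?addr0// => a /negPf ->; rewrite mul0r.
have D (l : 'I_(n * 2)) : is_derive x (evec R m) (fun y : E => y 0 l) (evec R m 0 l).
  apply/is_derive_lineP.
  have -> : (fun t : R => (x + t *: evec R m) 0 l) = (fun t => x 0 l + t * evec R m 0 l).
    by apply/funext => t; rewrite !mxE.
  exact: is_derive_affine.
by split; exact: D.
Qed.

Lemma hol_at_scale x F dF (c : C) : hol_at x F dF -> hol_at x (fun y => c * F y) (fun a => c * dF a).
Proof.
move=> HF m; have := hol_atM (hol_at_cst x c) HF m.
by under eq_bigr do rewrite mul0r add0r.
Qed.

Lemma holomorphic_on_local U G :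
  (forall x, U x -> exists V F, [/\ open V, V x, holomorphic_on V F & forall y, V y -> F y = G y]) ->
  holomorphic_on U G.
Proof.
move=> H; split; [split|] => [s x Ux|s x Ux|x Ux j].
- have [V [F [oV Vx [[sr _] _] FG]]] := H x Ux.
  by apply: (smooth_eq oV _ sr) => // y Vy; rewrite FG.
- have [V [F [oV Vx [[_ si] _] FG]]] := H x Ux.
  by apply: (smooth_eq oV _ si) => // y Vy; rewrite FG.
- have [V [F [oV Vx hF FG]]] := H x Ux.
  have N : \forall y \near x, F y = G y by exact: near_open oV Vx FG.
  exact: (hol_at_dz (hol_at_near N (holomorphic_hol_at hF Vx)) j).2.
Qed.

Lemma holomorphic_scale U F (c : C) : open U -> holomorphic_on U F ->
  holomorphic_on U (fun y => c * F y).
Proof.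
move=> oU hF; have [[sr si] _] := hF; split; last first.
  by move=> x Ux j; exact: (hol_at_dz (hol_at_scale c (holomorphic_hol_at hF Ux)) j).2.
split.
  apply: (smooth_eq oU _ (smoothB oU (smoothM oU (smooth_cst (complex.Re c)) sr)
                                     (smoothM oU (smooth_cst (complex.Im c)) si))).
  by move=> y _; case: c => p q; case: (F y).
apply: (smooth_eq oU _ (smoothD oU (smoothM oU (smooth_cst (complex.Re c)) si)
                                   (smoothM oU (smooth_cst (complex.Im c)) sr))).
by move=> y _; case: c => p q; case: (F y) => s t /=.
Qed.

(** The partial derivative along x_i is the complex derivative d/dz_i, and it
    commutes with dbar. *)
Lemma holomorphic_cderive U F (i : 'I_n) : open U -> holomorphic_on U F ->
  holomorphic_on U (cderive (evec R (xidx i)) F).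
Proof.
move=> oU hF; have [[sr si] db] := hF.
set e := evec R (xidx i).
pose u y := complex.Re (F y); pose w y := complex.Im (F y).
have CR y j : U y -> 'D_(evec R (xidx j)) u y = 'D_(evec R (yidx j)) w y /\
    'D_(evec R (xidx j)) w y = - 'D_(evec R (yidx j)) u y.
  move=> Uy; have := db y Uy j; rewrite /dzbar => /eqP.
  rewrite mulf_eq0 invr_eq0 pnatr_eq0 /= /cderive -/u -/w.
  set p := 'D_(evec R (xidx j)) u y; set q := 'D_(evec R (xidx j)) w y.
  set s := 'D_(evec R (yidx j)) u y; set t := 'D_(evec R (yidx j)) w y.
  by rewrite eq_complex /= => /andP[/eqP h1 /eqP h2]; split; lra.
split; first by split; [exact: (smooth_derive _ sr)|exact: (smooth_derive _ si)].
move=> x Ux j; rewrite /dzbar.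
suff -> : cderive (evec R (xidx j)) (cderive e F) x + 'i%C * cderive (evec R (yidx j)) (cderive e F) x = 0.
  by rewrite mulr0.
rewrite /cderive /= -/u -/w.
have S (g : E -> R) k : smooth_on U g -> 'D_(evec R k) ('D_e g) x = 'D_e ('D_(evec R k) g) x.
  by move=> sg; exact: (smooth_Schwarz _ _ oU sg Ux).
have su : smooth_on U u := sr.
have sw : smooth_on U w := si.
have ur : 'D_e ('D_(evec R (xidx j)) u) x = 'D_e ('D_(evec R (yidx j)) w) x.
  have N : \forall y \near x, 'D_(evec R (xidx j)) u y = 'D_(evec R (yidx j)) w y.
    by apply: (near_open oU Ux) => y Uy; have [] := CR y j Uy.
  exact: near_eq_derive N.
have wr : 'D_e ('D_(evec R (xidx j)) w) x = - 'D_e ('D_(evec R (yidx j)) u) x.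
  transitivity ('D_e (- ('D_(evec R (yidx j)) u)) x).
    have N : \forall y \near x, 'D_(evec R (xidx j)) w y = (- ('D_(evec R (yidx j)) u)) y.
      by apply: (near_open oU Ux) => y Uy; have [_ ->] := CR y j Uy.
    exact: near_eq_derive N.
  have sdu := smooth_derive (yidx j) su.
  have du := (sdu [::] x Ux).2 (xidx i).
  exact: (deriveN du).
have G (a b c d : R) : a = d -> b = - c -> Complex a b + 'i%C * Complex c d = 0.
  by move=> -> ->; apply/eqP; rewrite eq_complex /=; apply/andP; split; apply/eqP; ring.
apply: G; first exact: (etrans (S u _ su) (etrans ur (esym (S w _ sw)))).
exact: (etrans (S w _ sw) (etrans wr (congr1 -%R (esym (S u _ su))))).
Qed.

Lemma hol_at_dz_on U F (i : 'I_n) x : open U -> holomorphic_on U F -> U x ->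
  exists d, hol_at x (fun y => dz i F y) d.
Proof.
move=> oU hF Ux; eexists.
apply: hol_at_near (holomorphic_hol_at (holomorphic_cderive i oU hF) Ux).
apply: (near_open oU Ux) => y Uy.
by rewrite (is_cderiveE (holomorphic_hol_at hF Uy (xidx i))) (sum_zc _ i).1.
Qed.

Lemma hol_norm1_near (V : set E) (q : E -> C) x : open V -> V x ->
  (forall y, V y -> exists d, hol_at y q d) ->
  (forall y, V y -> q y * conjc (q y) = 1) ->
  nbhs x (fun y => q y = q x).
Proof.
move=> oV Vx Hq q1.
have /nbhs_ballP[r /= r0 rV] : nbhs x V by exact: open_nbhs_nbhs.
have K := @hol_norm1_cst R n q x r (fun y By => Hq y (rV y By)) (fun y By => q1 y (rV y By)).
by apply: (@filterS _ (nbhs x) (nbhs_filter x) _ _ K); exact: nbhsx_ballx.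
Qed.
End HolomorphicOn.

Import Defs.

(** * Charts and the canonical bundle *)

Lemma norm_quotient (R : realType) (f g : R[i]) : g != 0 ->
  f * conjc f = g * conjc g -> f / g * conjc (f / g) = 1.
Proof.
move=> g0 e; have cg0 : conjc g != 0 by rewrite conjc_eq0.
have -> : conjc (f / g) = conjc f / conjc g by rewrite conjcM; congr (_ * _); exact: fmorphV.
by rewrite mulrACA e -invfM mulfV// mulf_neq0.
Qed.

Section Charts.
Variables (R : realType) (n : nat) (M : cxManifold R n).
Local Notation C := R[i].
Local Notation E := 'rV[R]_(n * 2).
Implicit Types (a b c : chart M) (x y : E) (p : M).

Lemma chart_imP a x : chart_im a x -> dom M a (point M a x) /\ coord M a (point M a x) = x.
Proof. by move=> [p dp <-]; rewrite coordK. Qed.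

Lemma chart_im_open a : open (chart_im a).
Proof. exact: im_open. Qed.

Lemma chart_im_coord a p : dom M a p -> chart_im a (coord M a p).
Proof. by move=> dp; exists p. Qed.

Lemma overlapP a b x : overlap a b x <-> chart_im a x /\ dom M b (point M a x).
Proof.
split=> [[p [dp dbp] <-]|[/chart_imP[dp px] dbp]]; first by rewrite coordK//; split=> //; exists p.
by exists (point M a x).
Qed.

Lemma overlap_coord a b p : dom M a p -> dom M b p -> overlap a b (coord M a p).
Proof. by move=> da db; exists p. Qed.

Lemma transition_coord a b p : dom M a p -> transition a b (coord M a p) = coord M b p.
Proof. by move=> da; rewrite /transition coordK. Qed.

Lemma open_nbhsP (T : topologicalType) (A : set T) : (forall t, A t -> nbhs t A) -> open A.
Proof. by move=> H; rewrite openE. Qed.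

Lemma coord_preimage_open a (V : set E) : open V -> open (fun p => dom M a p /\ V (coord M a p)).
Proof.
move=> oV; apply: open_nbhsP => p [dp Vp].
have N := within_nbhs (@coord_continuous _ _ M a) dp (open_nbhs_nbhs (conj oV Vp)).
by apply: filterS2 (open_nbhs_nbhs (conj (dom_open a) dp)) N => q dq /(_ dq).
Qed.

Lemma point_preimage_open a (A : set M) : open A -> open (fun x => chart_im a x /\ A (point M a x)).
Proof.
move=> oA; apply: open_nbhsP => x [Ux Ax].
have N := within_nbhs (@point_continuous _ _ M a) Ux (open_nbhs_nbhs (conj oA Ax)).
have N' := open_nbhs_nbhs (conj (chart_im_open (a := a)) Ux).
by apply: (@filterS2 _ (nbhs x) (nbhs_filter x) _ _ _ _ N' N) => y Uy /(_ Uy).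
Qed.

Lemma overlap_open a b : open (overlap a b).
Proof.
have -> : overlap a b = (fun x => chart_im a x /\ dom M b (point M a x)).
  by apply/funext => x; apply/propext; exact: overlapP.
exact: point_preimage_open (dom_open b).
Qed.

Lemma near_chart a p (A : set E) : dom M a p -> nbhs (coord M a p) A ->
  nbhs p (fun q => dom M a q /\ A (coord M a q)).
Proof.
move=> dp hA; have N := within_nbhs (@coord_continuous _ _ M a) dp hA.
by apply: filterS2 (open_nbhs_nbhs (conj (dom_open a) dp)) N => q dq /(_ dq).
Qed.

Lemma transition_hol_at a b x k : overlap a b x ->
  hol_at x (fun y => zc k (transition a b y)) (fun i => transition_jac a b x i k).
Proof.
move=> ox m; have := holomorphic_hol_at (transition_holomorphic (c := M) a b k) ox m.
suff -> : \sum_i transition_jac a b x i k * zc i (evec R m) =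
  \sum_i dz i (fun y => zc k (coord M b (point M a y))) x * zc i (evec R m) by [].
by apply: eq_bigr => i _; rewrite mxE.
Qed.

(** The chain rule. *)
Lemma transition_jac_comp a b c p : dom M a p -> dom M b p -> dom M c p ->
  transition_jac a c (coord M a p) =
  transition_jac a b (coord M a p) *m transition_jac b c (coord M b p).
Proof.
move=> da db dc; set x := coord M a p.
have oab : overlap a b x by exact: overlap_coord.
have obc : overlap b c (transition a b x) by rewrite transition_coord//; exact: overlap_coord.
apply/matrixP => i k; rewrite [in RHS]mxE [in LHS]mxE.
have H := hol_at_comp (overlap_open (a := b) (b := c)) (transition_holomorphic (c := M) b c k) obc (fun m => transition_hol_at m oab).
rewrite (hol_at_dz (hol_at_near _ H) i).1.
  apply: eq_bigr => m _; rewrite mulrC; congr (_ * _).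
  by rewrite [in RHS]mxE transition_coord.
apply: (near_open (overlap_open (a := a) (b := b)) oab) => y /overlapP[Uy dby].
by rewrite /transition coordK.
Qed.

Lemma transition_jac_id a p : dom M a p -> transition_jac a a (coord M a p) = 1%:M.
Proof.
move=> da; apply/matrixP => i k; rewrite !mxE.
rewrite (hol_at_dz (hol_at_near _ (hol_at_zc (coord M a p) k)) i).1//.
apply: (near_open (chart_im_open (a := a)) (chart_im_coord da)) => y /chart_imP[dy yE].
by rewrite /transition yE.
Qed.

(** The determinants of the Jacobians are the transition functions of the
    canonical line bundle. *)
Definition jacobian a b p : C := \det (transition_jac a b (coord M a p)).

Lemma jacobian_comp a b c p : dom M a p -> dom M b p -> dom M c p ->
  jacobian a c p = jacobian a b p * jacobian b c p.
Proof. by move=> da db dc; rewrite /jacobian (transition_jac_comp da db dc) det_mulmx. Qed.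

Lemma jacobian_id a p : dom M a p -> jacobian a a p = 1.
Proof. by move=> da; rewrite /jacobian transition_jac_id// det1. Qed.

Lemma jacobianV a b p : dom M a p -> dom M b p -> jacobian a b p * jacobian b a p = 1.
Proof. by move=> da db; rewrite -jacobian_comp// jacobian_id. Qed.

Lemma jacobian_neq0 a b p : dom M a p -> dom M b p -> jacobian a b p != 0.
Proof.
move=> da db; apply/eqP => j0; have := jacobianV da db.
by rewrite j0 mul0r => /eqP; rewrite eq_sym oner_eq0.
Qed.

Lemma jacobian_hol_at a b x : overlap a b x ->
  exists d, hol_at x (fun y => \det (transition_jac a b y)) d.
Proof.
move=> ox; apply: hol_at_det => i k.
have [d Hd] := hol_at_dz_on i (overlap_open (a := a) (b := b)) (transition_holomorphic (c := M) a b k) ox.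
exists d; apply: hol_at_near Hd; apply: (near_open (overlap_open (a := a) (b := b)) ox) => y _.
by rewrite mxE.
Qed.

(** In the chart a, the quotient of F dz by the pull-back of G dw is holomorphic
    of modulus 1. *)
Lemma same_norm_ratio a b (V W : set E) (F G : E -> C) p : open V -> open W ->
  holomorphic_on V F -> holomorphic_on W G ->
  dom M a p -> dom M b p -> V (coord M a p) -> W (coord M b p) ->
  (forall q, dom M a q -> V (coord M a q) -> F (coord M a q) != 0) ->
  (forall q, dom M b q -> W (coord M b q) -> G (coord M b q) != 0) ->
  (forall q, dom M a q -> dom M b q -> V (coord M a q) -> W (coord M b q) ->
     F (coord M a q) * conjc (F (coord M a q)) =
     (G (coord M b q) * jacobian a b q) * conjc (G (coord M b q) * jacobian a b q)) ->
  nbhs p (fun q => F (coord M a q) / (G (coord M b q) * jacobian a b q) =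
                   F (coord M a p) / (G (coord M b p) * jacobian a b p)).
Proof.
move=> oV oW hF hG da db Vp Wp F0 G0 FG.
pose Q y := F y / (G (transition a b y) * \det (transition_jac a b y)).
pose O : set E := V `&` (fun y => chart_im a y /\ (fun q => dom M b q /\ W (coord M b q)) (point M a y)).
have oO : open O by apply: (openI oV); have oA := @coord_preimage_open b W oW; exact: (@point_preimage_open a _ oA).
have OxE q : dom M a q -> O (coord M a q) <-> [/\ V (coord M a q), dom M b q & W (coord M b q)].
  move=> dq; split=> [[Vq [_ []]]|[Vq dbq Wq]]; first by rewrite coordK.
  by split=> //; split; [exact: chart_im_coord|rewrite coordK].
have QE q : dom M a q -> Q (coord M a q) = F (coord M a q) / (G (coord M b q) * jacobian a b q).
  by move=> dq; rewrite /Q transition_coord.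
have Qx : nbhs (coord M a p) (fun y => Q y = Q (coord M a p)).
  apply: (@hol_norm1_near R n O) => //.
  - exact/OxE.
  - move=> y Oy; have [Vy [Uy [dby Wy]]] := Oy.
    have oy : overlap a b y by apply/overlapP.
    have H1 := holomorphic_hol_at hF Vy.
    have H2 := hol_at_comp oW hG Wy (fun m => transition_hol_at m oy).
    have [d H3] := jacobian_hol_at oy.
    have [dy yE] := chart_imP Uy.
    eexists; apply: (hol_atM H1); apply: hol_atV; last exact: hol_atM H2 H3.
    rewrite mulf_neq0//; first exact: G0.
    by have := jacobian_neq0 dy dby; rewrite /jacobian yE.
  - move=> y [Vy [Uy [dby Wy]]]; have [dy yE] := chart_imP Uy.
    rewrite -yE QE//; have := FG _ dy dby; rewrite yE => /(_ Vy Wy).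
    have g0 : G (coord M b (point M a y)) * jacobian a b (point M a y) != 0.
      by rewrite mulf_neq0 ?jacobian_neq0 ?G0.
    exact: norm_quotient g0.
apply: filterS (near_chart da (filterI Qx (open_nbhs_nbhs (conj oO ((OxE p da).2 (And3 Vp db Wp)))))).
by move=> q [dq [e _]]; rewrite -!QE.
Qed.
End Charts.

(** * Global volume forms *)

Section Global.
Variables (R : realType) (n : nat) (M : cxManifold R n) (g : kahlerMetric M) (f : M -> R).
Hypothesis hf : ricci_potential g f.
Local Notation C := R[i].
Local Notation E := 'rV[R]_(n * 2).
Local Notation rc := (real_complex R).
Local Notation H := (gcoef g).

(** The value of |F|^2 prescribed by the volume condition on
    F dz^1 /\ ... /\ dz^n. *)
Definition density (a : chart M) (x : E) : C := \det (H a x) * rc (expR (f (point M a x))).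

Lemma density_gt0 a x : chart_im a x -> 0 < density a x.
Proof.
move=> Ux; apply: mulr_gt0; last by rewrite ltcR expR_gt0.
exact: (det_herm_gt0 (gcoef_herm g Ux) (gcoef_pos g Ux)).
Qed.

Lemma density_change a b (p : M) : dom M a p -> dom M b p ->
  density a (coord M a p) =
  density b (coord M b p) * (jacobian a b p * conjc (jacobian a b p)).
Proof.
move=> da db; rewrite /density !coordK// [RHS]mulrAC; congr (_ * _).
set J := transition_jac a b (coord M a p).
have -> : H a (coord M a p) = J *m H b (coord M b p) *m (map_mx conjc J)^T.
  apply/matrixP => i j; rewrite (gcoef_change g (overlap_coord da db)) transition_coord// mxE.
  rewrite exchange_big; apply: eq_bigr => l _ /=; rewrite [(_ *m _) _ _]mxE mulr_suml; apply: eq_bigr => k _.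
  by rewrite !mxE mulrCA mulrA.
rewrite !det_mulmx det_tr (det_map_mx (@conjc R)) /jacobian -/J.
by rewrite mulrAC [RHS]mulrC.
Qed.

(** Each of the three 2n-forms is a multiple of the determinant of the real
    coordinates, and they are compared on the standard basis. *)
Lemma volume_normalizedP (V : holVolumeForm M) : volume_normalized g f V <->
  forall a x, chart_im a x -> vcoef V a x * conjc (vcoef V a x) = density a x.
Proof.
pose k : C := (-1) ^+ 'C(n, 2) * (- (2 * 'i%C)) ^+ n.
have kE : ('i%C ^+ n / 2) ^+ n * k = 1 := normalizing_constant R n.
have ef x a : rc (expR (- f (point M a x))) * rc (expR (f (point M a x))) = 1.
  by rewrite -rmorphM -expRD addNr expR0.
have wedgeE a x v : ('i%C ^+ n / 2) ^+ n * rc (expR (- f (point M a x))) *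
    form_cast (addn_mul2 n) (form_wedge (hol_form V a x) (form_conj (hol_form V a x))) v =
  rc (expR (- f (point M a x))) * (vcoef V a x * conjc (vcoef V a x)) * rc (\det (vec_mx2 v)).
  rewrite dz_top_wedge -/k; set e := rc _; set F := _ * conjc _; set d := rc _.
  transitivity ((('i%C ^+ n / 2) ^+ n * k) * (e * F * d)); first ring.
  by rewrite kE mul1r.
split=> [N a x Ux|N a x Ux v /=].
  have [_] := N a x Ux (fun i => evec R i).
  rewrite form_pow_top wedgeE.
  have -> : vec_mx2 (fun i => evec R i) = 1%:M :> 'M[R]_(n * 2).
    by apply/matrixP => i j; rewrite !mxE eqxx eq_sym.
  by rewrite det1 !mulr1 /density => ->; rewrite mulrAC ef mul1r.
rewrite form_pow_top wedgeE N// /density [_ * (_ * rc _)]mulrCA ef mulr1; split=> //.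
by rewrite -(sqrt_det_real_metric (gcoef_herm g Ux) (gcoef_pos g Ux)) -rmorphM.
Qed.

(** The frames of the flat line bundle: local solutions, each on a cube of some
    chart, so that their domains are path-connected. *)
Record local_form := LocalForm {
  lchart : chart M;
  lcenter : E;
  lradius : R;
  lcoef : E -> C;
  lball : ball lcenter lradius `<=` chart_im lchart;
  lholo : holomorphic_on (ball lcenter lradius) lcoef;
  lnorm : forall y, ball lcenter lradius y -> lcoef y * conjc (lcoef y) = density lchart y
}.

Definition ldom (i : local_form) : set M :=
  fun p => dom M (lchart i) p /\ ball (lcenter i) (lradius i) (coord M (lchart i) p).

Lemma ldom_open i : open (ldom i).
Proof. exact: coord_preimage_open (ball_open _ _). Qed.

Lemma ldom_at a p : dom M a p -> exists i, lchart i = a /\ ldom i p.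
Proof.
move=> da; set x := coord M a p.
have /nbhs_ballP[r /= r0 rU] : nbhs x (chart_im a).
  by apply: open_nbhs_nbhs; split; [exact: chart_im_open|exact: chart_im_coord].
have [sf sol] := hf.
have [F [hF nF]] := local_solution (chart_im_open (a := a)) (fun i j => gcoef_smooth g a i j)
  (fun x Ux => gcoef_herm g Ux) (fun x Ux => gcoef_pos g Ux) (fun x Ux => gcoef_closed g Ux)
  (sf a) (fun x Ux i j => sol a x Ux i j) rU.
by exists (LocalForm rU hF nF); split=> //; split=> //=; exact: ballxx.
Qed.

Lemma ldom_cover p : exists i, ldom i p.
Proof. by have [a /ldom_at[i [_ Bi]]] := dom_cover p; exists i. Qed.

Lemma lcoef_neq0 i y : ball (lcenter i) (lradius i) y -> lcoef i y != 0.
Proof.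
move=> By; apply/eqP => F0; have := lnorm By; rewrite F0 mul0r => e.
by have := density_gt0 (lball By); rewrite -e ltxx.
Qed.

(** A straight segment in the cube. *)
Lemma ldom_path i p q : ldom i p -> ldom i q -> exists h : R -> M,
  [/\ {within `[0, 1]%classic, continuous h}, h 0 = p, h 1 = q &
      forall t, (`[0, 1]%classic : set R) t -> ldom i (h t)].
Proof.
move=> [dp Bp] [dq Bq]; set a := lchart i in dp dq Bp Bq *.
set x := coord M a p; set y := coord M a q.
pose l (t : R) : E := x + t *: (y - x).
have Bl t : (`[0, 1]%classic : set R) t -> ball (lcenter i) (lradius i) (l t).
  rewrite /= in_itv /= => /andP[t0 t1].
  move: Bp Bq => /ballE[r0 Bx] /ballE[_ By]; apply/ballE; split=> // k.
  have := Bx k; have := By k; rewrite -/x -/y !mxE !ltr_norml.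
  set u := lcenter i 0 k; set v := x 0 k; set w := y 0 k; set r := lradius i.
  move=> /andP[h1 h2] /andP[h3 h4].
  have [t1'|t1'] := ltP t 1; last by apply/andP; split; nra.
  have k1 : 0 <= t * (r - (u - w)) by apply: mulr_ge0 => //; lra.
  have k2 : 0 <= t * (r + (u - w)) by apply: mulr_ge0 => //; lra.
  have k3 : 0 < (1 - t) * (r - (u - v)) by apply: mulr_gt0; lra.
  have k4 : 0 < (1 - t) * (r + (u - v)) by apply: mulr_gt0; lra.
  by apply/andP; split; nra.
have cl : {within `[0, 1]%classic, continuous l}.
  apply: continuous_subspaceT => t; apply: cvgD; first exact: cvg_cst.
  by apply: cvgZr_tmp; exact: cvg_id.
exists (point M a \o l); split => /=.
- apply: (within_comp cl (@point_continuous _ _ M a)) => t it.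
  exact: lball (Bl t it).
- by rewrite /l scale0r addr0 coordK.
- by rewrite /l scale1r addrC subrK coordK.
- move=> t it; have [dl le] := chart_imP (lball (Bl t it)).
  by split=> //; rewrite le; exact: Bl.
Qed.

(* To compare local forms, their coefficients are taken at each point p in a
   chart ref p chosen once and for all. *)
Variable ref : M -> chart M.
Hypothesis ref_dom : forall p, dom M (ref p) p.

Definition lvalue (i : local_form) (p : M) : C :=
  lcoef i (coord M (lchart i) p) * jacobian (ref p) (lchart i) p.

Lemma lvalue_neq0 i p : ldom i p -> lvalue i p != 0.
Proof.
by move=> [dp Bp]; rewrite mulf_neq0 ?jacobian_neq0//; exact: lcoef_neq0.
Qed.

Lemma lvalue_norm i p : ldom i p ->
  lvalue i p * conjc (lvalue i p) = density (ref p) (coord M (ref p) p).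
Proof.
move=> [dp Bp]; rewrite (density_change (ref_dom p) dp) -(lnorm Bp) /lvalue conjcM.
by rewrite mulrACA.
Qed.

Lemma lvalue_ratio i j p : ldom i p -> ldom j p ->
  nbhs p (fun q => lvalue i q / lvalue j q = lvalue i p / lvalue j p).
Proof.
move=> [dip Bip] [djp Bjp]; set a := lchart i in dip Bip *; set b := lchart j in djp Bjp *.
have E1 q : dom M a q -> dom M b q -> lvalue i q / lvalue j q =
    lcoef i (coord M a q) / (lcoef j (coord M b q) * jacobian a b q).
  move=> da db; rewrite /lvalue -/a -/b (jacobian_comp (ref_dom q) da db).
  rewrite [jacobian (ref q) a q * _]mulrC mulrA.
  have := jacobian_neq0 (ref_dom q) da; set t := jacobian (ref q) a q => t0.
  by rewrite -mulf_div divff// mulr1.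
have N := @same_norm_ratio R n M a b _ _ _ _ p (ball_open _ _) (ball_open _ _)
  (lholo i) (lholo j) dip djp Bip Bjp _ _ _.
apply: filterS3 (N _ _ _) (open_nbhs_nbhs (conj (dom_open a) dip)) (open_nbhs_nbhs (conj (dom_open b) djp)).
- by move=> q e da db; exact: (etrans (E1 q da db) (etrans e (esym (E1 p dip djp)))).
- by move=> q _ Bq; exact: lcoef_neq0.
- by move=> q _ Bq; exact: lcoef_neq0.
- move=> q da db Vq Wq; rewrite (lnorm Vq) (density_change da db) -(lnorm Wq) conjcM.
  by rewrite mulrACA.
Qed.

Hypothesis hM : simply_connected M.

(** [monodromy] yields a section up to a constant factor, which is chosen so as to
    satisfy the norm condition at one point. The quotient of |s|^2 by the density
    is locally constant, hence equal to 1. *)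
Lemma global_form : exists s : M -> C,
  (forall p, s p * conjc (s p) = density (ref p) (coord M (ref p) p)) /\
  forall i p q, ldom i p -> ldom i q -> s q / lvalue i q = s p / lvalue i p.
Proof.
have [cM loops] := hM.
have [s hs] : exists s : M -> C, forall p, s p != 0 /\
    forall i q, ldom i p -> ldom i q -> s q / lvalue i q = s p / lvalue i p.
  exact: (@monodromy R M C local_form ldom lvalue ldom_open ldom_cover
    lvalue_neq0 lvalue_ratio ldom_path loops cM).
have [[p0 _]|noM] := pselect (exists p : M, True); last first.
  by exists s; split=> [p|i p]; case: noM; exists p.
have [i0 Bi0] := ldom_cover p0.
pose k : C := lvalue i0 p0 / s p0.
have [s0 _] := hs p0.
have lc i p q : ldom i p -> ldom i q -> k * s q / lvalue i q = k * s p / lvalue i p.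
  move=> Bp Bq; have [_ e] := hs p; by have := e i q Bp Bq; rewrite -[k * s q / _]mulrA -[k * s p / _]mulrA => ->.
exists (fun p => k * s p); split=> // p.
pose D q := density (ref q) (coord M (ref q) q).
have D0 q : D q != 0 by rewrite gt_eqF// density_gt0//; exact: chart_im_coord.
suff e : (k * s p) * conjc (k * s p) / D p = (k * s p0) * conjc (k * s p0) / D p0.
  move: e; rewrite [k * s p0]divfK// (lvalue_norm Bi0) divff//; last exact: D0.
  by move=> /(congr1 (fun z => z * D p)); rewrite divfK// mul1r.
apply: (locally_constant_connected (g := fun p => (k * s p) * conjc (k * s p) / D p) cM) => // q _.
have [i Bq] := ldom_cover q.
apply: filterS (open_nbhs_nbhs (conj (@ldom_open i) Bq)) => q' Bq' _.
have sE r : ldom i r -> k * s r = (k * s q / lvalue i q) * lvalue i r.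
  by move=> Br; rewrite -(lc i q r Bq Br) divfK// lvalue_neq0.
have DE r : ldom i r -> D r = lvalue i r * conjc (lvalue i r) by move=> /lvalue_norm ->.
have G (c z : C) : z != 0 -> c * z * conjc (c * z) / (z * conjc z) = c * conjc c.
  move=> z0; rewrite conjcM mulrACA mulfK// mulf_neq0// conjc_eq0//.
have norm_cst r : ldom i r -> k * s r * conjc (k * s r) / D r =
    (k * s q / lvalue i q) * conjc (k * s q / lvalue i q).
  move=> Br; rewrite (DE r Br) (sE r Br); apply: G; exact: lvalue_neq0.
exact: (etrans (norm_cst q' Bq') (esym (norm_cst q Bq))).
Qed.

(** The value s p is the coefficient in the chart ref p; the one in the chart a
    differs by a Jacobian. Near each point it is a constant multiple of a local
    form of the same chart, hence holomorphic, whatever the choice of ref. *)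
Lemma volume_form_exists : exists U : holVolumeForm M, volume_normalized g f U.
Proof.
have [s [ns cs]] := global_form.
pose vc a x : C := s (point M a x) * jacobian a (ref (point M a x)) (point M a x).
have nvc a x : chart_im a x -> vc a x * conjc (vc a x) = density a x.
  move=> /chart_imP[da xE]; rewrite /vc conjcM mulrACA ns.
  by rewrite -(density_change da (ref_dom _)) xE.
have vc0 a x : chart_im a x -> vc a x != 0.
  move=> Ux; apply/eqP => v0; have := nvc a x Ux; rewrite v0 mul0r => e.
  by have := density_gt0 Ux; rewrite -e ltxx.
have vch a : holomorphic_on (chart_im a) (vc a).
  apply: holomorphic_on_local => x Ux; have [da xE] := chart_imP Ux.
  have [i [ia Bi]] := ldom_at da; subst a.
  exists (ball (lcenter i) (lradius i)),
    (fun y => (s (point M (lchart i) x) / lvalue i (point M (lchart i) x)) * lcoef i y).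
  have Bx : ball (lcenter i) (lradius i) x by case: Bi; rewrite xE.
  split; [exact: ball_open|by []|exact: holomorphic_scale (ball_open _ _) (lholo i)|] => y By.
  have [dy yE] := chart_imP (lball By); set q := point M (lchart i) y in dy yE *.
  have Bq : ldom i q by split=> //; rewrite yE.
  rewrite -(cs i _ q Bi Bq) /vc -/q /lvalue yE.
  have jV := jacobianV dy (ref_dom q); have l0 := lcoef_neq0 By.
  set u := lcoef i y in l0 *; set v := jacobian _ _ _ in jV *; set w := jacobian _ _ _ in jV *.
  have w0 : w != 0 by exact: jacobian_neq0.
  rewrite [u * w]mulrC invfM mulrA divfK//; congr (_ * _).
  by apply: (mulIf w0); rewrite mulVf.
have vcc a b x : overlap a b x ->
    vc a x = vc b (transition a b x) * \det (transition_jac a b x).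
  move=> /overlapP[Ux db]; have [da xE] := chart_imP Ux.
  have pE : point M b (transition a b x) = point M a x by rewrite /transition coordK.
  rewrite /vc pE -mulrA; congr (_ * _); rewrite -{5}xE -/(jacobian a b (point M a x)) mulrC.
  exact: jacobian_comp.
by exists (HolVolumeForm vch vc0 vcc); apply/volume_normalizedP.
Qed.

(** The quotient of the two coefficients does not depend on the chart, and it is
    locally constant by [same_norm_ratio]. *)
Lemma volume_form_unique (U V : holVolumeForm M) :
  volume_normalized g f U -> volume_normalized g f V ->
  exists c : C, c * conjc c = 1 /\ is_multiple c U V.
Proof.
have [cM _] := hM; move=> /volume_normalizedP NU /volume_normalizedP NV.
have [[p0 _]|noM] := pselect (exists p : M, True); last first.
  by exists 1; split=> [|a x [p]]; [rewrite conjc1 mulr1|case: noM; exists p].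
pose q a p : C := vcoef V a (coord M a p) / vcoef U a (coord M a p).
have U0 a p : dom M a p -> vcoef U a (coord M a p) != 0.
  by move=> da; apply: vcoef_neq0; exact: chart_im_coord.
have V0 a p : dom M a p -> vcoef V a (coord M a p) != 0.
  by move=> da; apply: vcoef_neq0; exact: chart_im_coord.
have N p a : dom M a p -> vcoef V a (coord M a p) * conjc (vcoef V a (coord M a p)) =
    vcoef U a (coord M a p) * conjc (vcoef U a (coord M a p)).
  by move=> da; rewrite (NU a _ (chart_im_coord da)) (NV a _ (chart_im_coord da)).
have change W a b p : dom M a p -> dom M b p ->
    vcoef W a (coord M a p) = vcoef W b (coord M b p) * jacobian a b p.
  by move=> da db; rewrite (vcoef_change W (overlap_coord da db)) transition_coord.
have qab a b p : dom M a p -> dom M b p -> q a p = q b p.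
  move=> da db; rewrite /q (change V a b p da db) (change U a b p da db).
  by rewrite -mulf_div divff ?mulr1// jacobian_neq0.
have q_cst p p' : q (ref p) p = q (ref p') p'.
  apply: (locally_constant_connected (g := fun p => q (ref p) p) cM) => // {}p _.
  have dp := ref_dom p; set a := ref p in dp *.
  have oa := chart_im_open (a := a).
  have K := @same_norm_ratio R n M a a _ _ _ _ p oa oa
    (vcoef_holomorphic V a) (vcoef_holomorphic U a) dp dp
    (chart_im_coord dp) (chart_im_coord dp) (fun r dr _ => V0 a r dr) (fun r dr _ => U0 a r dr).
  have {}K := K _; apply: filterS2 (K _) (open_nbhs_nbhs (conj (dom_open a) dp)).
    move=> r e dr _; rewrite (qab _ a _ (ref_dom r) dr) /q.
    by move: e; rewrite !jacobian_id// !mulr1.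
  by move=> r dr _ _ _; rewrite jacobian_id// mulr1; exact: N.
exists (q (ref p0) p0); split; first exact: norm_quotient (U0 _ _ (ref_dom p0)) (N _ _ (ref_dom p0)).
move=> a x /chart_imP[da xE]; rewrite (q_cst p0 (point M a x)) (qab _ a _ (ref_dom _) da) /q xE.
by rewrite divfK// -xE; exact: U0.
Qed.
End Global.

Theorem theorem1 (R : realType) (n : nat) (M : cxManifold R n)
    (hM : simply_connected M) (g : kahlerMetric M) (f : M -> R)
    (hf : ricci_potential g f) :
  exists U : holVolumeForm M,
    volume_normalized g f U /\
    forall V : holVolumeForm M,
      volume_normalized g f V <->
      exists c : R[i], `|c| = 1 /\ is_multiple c U V.
Proof.
have [ref ref_dom] := choice (@dom_cover R n M).
have [U NU] := volume_form_exists hf ref_dom hM; exists U; split=> // V.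
have normE (c : R[i]) : `|c| = 1 <-> c * conjc c = 1.
  have -> : c * conjc c = `|c| ^+ 2 by rewrite sqr_normc.
  split=> [->|/eqP]; first by rewrite expr1n.
  by rewrite sqrf_eq1 => /orP[/eqP//|/eqP c1]; have := normr_ge0 c; rewrite c1 ler0N1.
split=> [NV|[c [/normE c1 UV]]].
  by have [c [/normE c1 UV]] := volume_form_unique ref_dom hM NU NV; exists c.
apply/volume_normalizedP => a x Ux; rewrite UV// conjcM mulrACA c1 mul1r.
by move/volume_normalizedP: NU; apply.
Qed.
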